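(* For each integer $g\ge 2$, the generating function $$\vec{F}_g(q)=\sum_{d=1}^\infty \frac{q^d}{d!}\,\vec{H}_g^d$$ is a polynomial (with complex coefficients) in $$E_2(q)=1-24\sum_{n=1}^\infty\frac{nq^n}{1-q^n},\qquad E_4(q)=1+240\sum_{n=1}^\infty\frac{n^3q^n}{1-q^n},\qquad E_6(q)=1-504\sum_{n=1}^\infty\frac{n^5q^n}{1-q^n}.$$
   Context: For integers $d,g\ge 1$, $\vec{H}_g^d$ (the monotone simple Hurwitz number with torus target) is the number of $(r+2)$-tuples $(\pi_1,\pi_2,\tau_1,\dots,\tau_r)$ of permutations from the symmetric group $\mathrm{S}^d=\mathrm{Aut}\{1,\dots,d\}$ such that: (1) the product $\pi_1\pi_2\pi_1^{-1}\pi_2^{-1}\tau_1\cdots\tau_r$ equals the identity; (2) the group generated by $\pi_1,\pi_2,\tau_1,\dots,\tau_r$ acts transitively on $\{1,\dots,d\}$; (3) $\tau_1,\dots,\tau_r$ are transpositions; (4) $r=2g-2$; (5) writing $\tau_i=(k_i\ l_i)$ with $1\le k_i<l_i\le d$, we have $l_1\le\dots\le l_r$. *)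

(* Defs.v *)
From HB Require Import structures.
From mathcomp Require Import all_boot all_order all_algebra all_fingroup.
From mathcomp Require Import boolp reals.
From mathcomp Require Import complex.
From mathcomp Require Import mpoly.

Set Implicit Arguments.
Unset Strict Implicit.
Unset Printing Implicit Defensive.

Import GRing.Theory.
Local Open Scope ring_scope.

(** * Formal power series in one variable *)

Record fps (R : Type) := Fps { fcoef : nat -> R }.

HB.instance Definition _ (R : Type) := gen_eqMixin (fps R).
HB.instance Definition _ (R : Type) := gen_choiceMixin (fps R).

Lemma fpsP (R : Type) (f g : fps R) : fcoef f =1 fcoef g -> f = g.
Proof. by case: f g => [f] [g] /= /funext ->. Qed.

Section FpsRing.
Variable R : comNzRingType.
Implicit Types (f g h : fps R) (c : R) (n : nat).

Definition fps_add f g := Fps (fun n => fcoef f n + fcoef g n).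
Definition fps_opp f := Fps (fun n => - fcoef f n).
Definition fps_mul f g :=
  Fps (fun n => \sum_(i < n.+1) fcoef f i * fcoef g (n - i)).
Definition fpsC c : fps R := Fps (fun n => if n == 0%N then c else 0).
Definition fpsX : fps R := Fps (fun n => (n == 1%N)%:R).

Fact fps_addA : associative fps_add.
Proof. by move=> f g h; apply: fpsP => n /=; rewrite addrA. Qed.
Fact fps_addC : commutative fps_add.
Proof. by move=> f g; apply: fpsP => n /=; rewrite addrC. Qed.
Fact fps_add0 : left_id (fpsC 0) fps_add.
Proof. by move=> f; apply: fpsP => n /=; rewrite if_same add0r. Qed.
Fact fps_addN : left_inverse (fpsC 0) fps_opp fps_add.
Proof. by move=> f; apply: fpsP => n /=; rewrite if_same addNr. Qed.

HB.instance Definition _ :=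
  GRing.isZmodule.Build (fps R) fps_addA fps_addC fps_add0 fps_addN.

Definition fps_trunc n f : {poly R} := \poly_(i < n.+1) fcoef f i.

Fact fps_mulE N f g n : (n <= N)%N ->
  fcoef (fps_mul f g) n = (fps_trunc N f * fps_trunc N g)`_n.
Proof.
move=> nN; rewrite coefM; apply: eq_bigr => -[i /= +] _.
rewrite ltnS => lein; rewrite !coef_poly !ltnS (leq_trans lein nN).
by rewrite (leq_trans (leq_subr _ _) nN).
Qed.

Fact fps_mulA : associative fps_mul.
Proof.
move=> f g h; apply: fpsP => n.
transitivity (fps_trunc n f * (fps_trunc n g * fps_trunc n h))`_n.
  rewrite coefM /=; apply: eq_bigr => -[i /= +] _; rewrite ltnS => lein.
  by rewrite coef_poly ltnS lein -(fps_mulE _ _ (leq_subr _ _)).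
rewrite mulrA coefM /=; apply: eq_bigr => -[i /= +] _; rewrite ltnS => lein.
by rewrite [(fps_trunc n h)`__]coef_poly ltnS leq_subr -(fps_mulE _ _ lein).
Qed.

Fact fps_mulC : commutative fps_mul.
Proof.
by move=> f g; apply: fpsP => n; rewrite !(@fps_mulE n)// mulrC.
Qed.

Fact fps_mul1 : left_id (fpsC 1) fps_mul.
Proof.
move=> f; apply: fpsP => n /=; rewrite big_ord_recl big1 => [|i _] /=.
  by rewrite mul1r subn0 addr0.
by rewrite mul0r.
Qed.

Fact fps_mulDl : left_distributive fps_mul fps_add.
Proof.
move=> f g h; apply: fpsP => n /=; rewrite -big_split /=.
by apply: eq_bigr => i _; rewrite mulrDl.
Qed.

Fact fps_one_neq0 : fpsC 1 != 0.
Proof.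
by apply/eqP => /(congr1 (fun f => fcoef f 0)) /eqP; rewrite /= oner_eq0.
Qed.

HB.instance Definition _ := GRing.Zmodule_isComNzRing.Build (fps R)
  fps_mulA fps_mulC fps_mul1 fps_mulDl fps_one_neq0.

(* [f^-1] is the multiplicative inverse of [f] as soon as there is one. *)
Definition fps_unit : {pred fps R} := [pred f | `[< exists g, g * f = 1 >]].
Definition fps_inv f :=
  if pselect (exists g, g * f = 1) is left ex_g then projT1 (cid ex_g) else f.

Fact fps_mulVf : {in fps_unit, left_inverse 1 fps_inv *%R}.
Proof.
move=> f /asboolP ex_g; rewrite /fps_inv.
by case: pselect => // ex_g'; case: cid.
Qed.
Fact fps_unitP f g : g * f = 1 -> fps_unit f.
Proof. by move=> gf1; apply/asboolP; exists g. Qed.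
Fact fps_inv_out : {in [predC fps_unit], fps_inv =1 id}.
Proof. by move=> f /asboolP no_g; rewrite /fps_inv; case: pselect. Qed.

HB.instance Definition _ := GRing.ComNzRing_hasMulInverse.Build (fps R)
  fps_mulVf fps_unitP fps_inv_out.

Lemma fcoefD f g n : fcoef (f + g) n = fcoef f n + fcoef g n.
Proof. by []. Qed.
Lemma fcoefN f n : fcoef (- f) n = - fcoef f n.
Proof. by []. Qed.
Lemma fcoefM f g n :
  fcoef (f * g) n = \sum_(i < n.+1) fcoef f i * fcoef g (n - i).
Proof. by []. Qed.
Lemma fcoef0 n : fcoef (0 : fps R) n = 0.
Proof. exact: if_same. Qed.
Lemma fcoef1 n : fcoef (1 : fps R) n = (n == 0%N)%:R.
Proof. by rewrite /GRing.one /=; case: eqP. Qed.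
Lemma fcoef_sum I (s : seq I) (P : pred I) (F : I -> fps R) n :
  fcoef (\sum_(i <- s | P i) F i) n = \sum_(i <- s | P i) fcoef (F i) n.
Proof. by apply: (big_morph (fun f => fcoef f n)) => //; apply: fcoef0. Qed.

Fact fpsC_is_zmod_morphism : zmod_morphism fpsC.
Proof.
move=> a b; apply: fpsP => n; rewrite fcoefD fcoefN /=.
by case: eqP; rewrite ?subr0.
Qed.
Fact fpsC_is_monoid_morphism : monoid_morphism fpsC.
Proof.
split=> // a b; apply: fpsP => n; rewrite fcoefM big_ord_recl big1 => [|i _].
  by rewrite subn0 addr0 /=; case: eqP => // _; rewrite mulr0.
by rewrite mul0r.
Qed.
HB.instance Definition _ :=
  GRing.isZmodMorphism.Build R (fps R) fpsC fpsC_is_zmod_morphism.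
HB.instance Definition _ :=
  GRing.isMonoidMorphism.Build R (fps R) fpsC fpsC_is_monoid_morphism.

Lemma fcoefMX f n :
  fcoef (fpsX * f) n = if n is m.+1 then fcoef f m else 0.
Proof.
rewrite fcoefM; case: n => [|n]; first by rewrite big_ord1 /= mul0r.
rewrite 2!big_ord_recl big1 => [|i _] /=; last by rewrite mul0r.
by rewrite mul0r mul1r add0r addr0 subSS subn0.
Qed.

Lemma fcoefXn n k : fcoef (fpsX ^+ n) k = (k == n)%:R.
Proof.
elim: n k => [|n IHn] k; first by rewrite expr0 fcoef1.
by rewrite exprS fcoefMX; case: k => [|k].
Qed.

Lemma fps_unit_1subXn n : (0 < n)%N -> 1 - fpsX ^+ n \is a GRing.unit.
Proof.
move=> n_gt0; apply/asboolP; exists (Fps (fun k => (n %| k)%N%:R)).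
rewrite mulrC mulrBl mul1r; apply: fpsP => k.
have coefMXn f : fcoef (fpsX ^+ n * f) k
    = if (k < n)%N then 0 else fcoef f (k - n).
  elim: {n_gt0} n k => [|n IHn] k; first by rewrite expr0 mul1r subn0.
  by rewrite exprS -mulrA fcoefMX; case: k => [|k] //; rewrite IHn ltnS subSS.
rewrite fcoefD fcoefN coefMXn fcoef1 /=; case: ltnP => [k_lt | k_ge].
  case: k k_lt {coefMXn} => [|k] k_lt; first by rewrite dvdn0 subr0.
  by rewrite gtnNdvd // subr0.
rewrite -{1}(subnK k_ge) dvdn_addl // subrr.
by rewrite (gtn_eqF (leq_trans n_gt0 k_ge)).
Qed.

(* The infinite sum [\sum_(n >= 1) u n], for families in which [u n] is
   divisible by [fpsX ^+ n]: only the terms with [n <= k] then contribute to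
   the coefficient of [fpsX ^+ k], see [fps_sum1P]. *)
Definition fps_sum1 (u : nat -> fps R) : fps R :=
  Fps (fun k => \sum_(1 <= n < k.+1) fcoef (u n) k).

Lemma fps_sum1P (u : nat -> fps R) k N :
    (forall n, (k < n)%N -> fcoef (u n) k = 0) -> (k < N)%N ->
  fcoef (\sum_(1 <= n < N) u n) k = fcoef (fps_sum1 u) k.
Proof.
move=> u0 kN; rewrite fcoef_sum /= (big_cat_nat _ (n := k.+1)) //=.
rewrite [X in _ + X]big1_seq ?addr0 // => n.
by rewrite mem_index_iota => /andP[_ /andP[]] /u0.
Qed.

Definition lambert (j : nat) : fps R :=
  fps_sum1 (fun n => (n ^ j)%:R * (fpsX ^+ n / (1 - fpsX ^+ n))).

Definition E2 : fps R := 1 - 24%:R * lambert 1.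
Definition E4 : fps R := 1 + 240%:R * lambert 3.
Definition E6 : fps R := 1 - 504%:R * lambert 5.

End FpsRing.

Arguments fpsX {R}.
Arguments lambert {R} j.
Arguments E2 {R}.
Arguments E4 {R}.
Arguments E6 {R}.

(** * Monotone simple Hurwitz numbers with torus target *)

Section Hurwitz.
Variables d r : nat.
Implicit Types (p : 'S_d) (t : r.-tuple 'S_d).
Local Open Scope group_scope.

(* In MathComp [s * t] is "first [s], then [t]"; the number of solutions does
   not depend on this convention: since the entries of [t] are involutions,
   replacing [p1] and [p2] by their inverses exchanges the two readings. *)
Definition torus_relation p1 p2 t : bool :=
  p1 * p2 * p1^-1 * p2^-1 * \prod_(i < r) tnth t i == 1.

Definition generate_transitive p1 p2 t : bool :=
  [transitive << [set p1; p2] :|: [set s in t] >>, on [set: 'I_d] | 'P].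

(* [t] consists of transpositions [(k_i l_i)] with [k_i < l_i] and the [l_i]
   are weakly increasing. *)
Definition monotone_transpositions t : bool :=
  [exists k : {ffun 'I_r -> 'I_d}, [exists l : {ffun 'I_r -> 'I_d},
     [forall i, (k i < l i)%N && (tnth t i == tperm (k i) (l i))]
     && [forall i : 'I_r, [forall j : 'I_r, (i <= j)%N ==> (l i <= l j)%N]]]].

End Hurwitz.

Definition hurwitz (g d : nat) : nat :=
  #|[set x : 'S_d * 'S_d * (2 * g - 2)%N.-tuple 'S_d |
      [&& torus_relation x.1.1 x.1.2 x.2,
          generate_transitive x.1.1 x.1.2 x.2
        & monotone_transpositions x.2]]|.

Definition hurwitz_series (K : fieldType) (g : nat) : fps K :=
  fps_sum1 (fun d => fpsC ((hurwitz g d)%:R / d`!%:R) * fpsX ^+ d).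

(* Main.v *)
Require Import Defs.
From HB Require Import structures.
From mathcomp Require Import all_boot all_order all_algebra all_fingroup.
From mathcomp Require Import boolp reals.
From mathcomp Require Import complex.
From mathcomp Require Import mpoly.
From mathcomp Require Import ring zify.
Set Implicit Arguments.
Unset Strict Implicit.
Unset Printing Implicit Defensive.
Import GRing.Theory Num.Theory.
Local Open Scope ring_scope.

(** The transitivity condition is dropped at first. A sequence of transpositions
    with [l_1 <= ... <= l_r] is a term in the expansion of a monomial in the
    Jucys-Murphy elements, so that the number of all solutions of the monodromy
    equation is [d!] times the trace, on the centre of the group algebra of the
    symmetric group, of the multiplication by the complete homogeneous symmetric
    function [h_r] of these elements ([trace_class_mx]). This function is
    central ([jm_hsym_central]). It acts on the Specht polynomial of a tableau
    of shape [s] by [h_r] of the contents of [s] ([jm_hsym_specht]), because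
    Garnir relations make the Jucys-Murphy elements act by contents
    ([specht_jm]). Contents determine the partition ([contents_separate]) and
    there are no more conjugacy classes than partitions, so all the eigenvalues
    are obtained in this way: the number of solutions is [d!] times the sum of
    [h_r] of the contents over the partitions of [d] ([torus_countE]).

    Symmetric functions of the contents are polynomials in the functions [Q_k]
    of Bloch and Okounkov, so it must be shown that the generating series over
    all partitions of a monomial in the [Q_k] is the product of the generating
    series [P] of partitions and of a quasimodular form
    ([bracket_quasimodular]). Adding or removing one element of a Maya diagram
    is a sign-reversing involution, and the resulting vanishing sum is a linear
    relation between these series whose coefficients are the derivatives at the
    origin of Jacobi's theta function ([bloch_okounkov]). It can be solved
    recursively. The heat equation and the simplest of these relations show that
    the coefficients are quasimodular multiples of the first derivative
    ([theta_quasimodular]). Quasimodular forms are understood as the algebra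
    generated by [E2], [E4] and [E6]; it is stable under [q d/dq] by Ramanujan's
    differential equations, which follow from Liouville's elementary identities
    between sums over the solutions of [a * x + b * y = n].

    Finally let [Z_r] and [F_r] be the exponential generating series, in the
    number [d] of points, of all solutions and of the transitive ones. Marking a
    transposition and splitting off the orbit on which it acts gives
    [r Z_r = \sum_(s <= r) s F_s Z_(r - s)] ([disconnected_series_rec]). Each
    [Z_r] is [P] times a quasimodular form and [Z_0 = P], so [P] cancels and an
    induction on [r] shows that [F_r] is quasimodular for every [r > 0]
    ([connected_series_quasimodular]). *)

(** * Formal power series *)

Section FpsTheory.
Variable K : fieldType.
Implicit Types f g : fps K.

Lemma fcoefCM c f n : fcoef (fpsC c * f) n = c * fcoef f n.
Proof.
rewrite fcoefM big_ord_recl /= subn0 big1 ?addr0 // => i _.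
by rewrite mul0r.
Qed.

Lemma fcoefnM m f n : fcoef (m%:R * f) n = m%:R * fcoef f n.
Proof. by rewrite -(rmorph_nat (@fpsC K)) fcoefCM. Qed.

Lemma fcoefM0 f g : fcoef (f * g) 0 = fcoef f 0 * fcoef g 0.
Proof. by rewrite fcoefM big_ord1 subn0. Qed.

Lemma fcoef_exp_small f n k : fcoef f 0 = 0 -> (k < n)%N -> fcoef (f ^+ n) k = 0.
Proof.
move=> f0; elim: n k => // n IHn k; rewrite ltnS => kn.
rewrite exprS fcoefM big_ord_recl f0 mul0r add0r big1 // => i _.
rewrite IHn ?mulr0 //; case: k kn i => [|k] kn i; first by case: i.
by rewrite subSS (leq_ltn_trans (leq_subr _ _)).
Qed.

(** The inverse is a geometric series in [1 - f / c], where [c] is the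
    constant term of [f]. *)
Lemma fps_unit_coef0 f : fcoef f 0 != 0 -> f \is a GRing.unit.
Proof.
move=> f0; pose c := fcoef f 0; pose h := 1 - fpsC c^-1 * f.
have h0 : fcoef h 0 = 0.
  by rewrite fcoefD fcoefN fcoefCM fcoef1 mulVf // subrr.
have hE : fpsC c^-1 * f = 1 - h by rewrite /h opprB addrC subrK.
pose g := Fps (fun k => \sum_(i < k.+1) fcoef (h ^+ i) k).
have gE k N : (k < N)%N -> fcoef g k = fcoef (\sum_(i < N) h ^+ i) k.
  move=> kN; rewrite fcoef_sum /= -(subnKC kN) big_split_ord /=.
  rewrite [X in _ + X]big1 ?addr0 // => i _.
  by rewrite fcoef_exp_small // ltn_addr.
have g_inv : g * (1 - h) = 1.
  apply: fpsP => k.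
  have -> : fcoef (g * (1 - h)) k
      = fcoef ((\sum_(i < k.+1) h ^+ i) * (1 - h)) k.
    rewrite !fcoefM; apply: eq_bigr => i _.
    by rewrite (gE _ k.+1).
  have -> : (\sum_(i < k.+1) h ^+ i) * (1 - h) = 1 - h ^+ k.+1.
    by rewrite mulrC -opprB mulNr -subrX1 opprB.
  by rewrite fcoefD fcoefN fcoef_exp_small // subr0.
by apply/asboolP; exists (g * fpsC c^-1); rewrite -mulrA hE.
Qed.

(** The derivation [q d/dq]. *)
Definition qder f : fps K := Fps (fun n => n%:R * fcoef f n).

Lemma fcoef_qder f n : fcoef (qder f) n = n%:R * fcoef f n.
Proof. by []. Qed.

Lemma qderD f g : qder (f + g) = qder f + qder g.
Proof. by apply: fpsP => n; rewrite /= mulrDr. Qed.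

Lemma qderC c : qder (fpsC c) = 0.
Proof. by apply: fpsP => -[|n]; rewrite fcoef0 /= ?mul0r ?mulr0. Qed.

Lemma qderM f g : qder (f * g) = qder f * g + f * qder g.
Proof.
apply: fpsP => n; rewrite fcoefD !fcoefM /= big_distrr -big_split /=.
apply: eq_bigr => -[i /= +] _; rewrite ltnS => lein.
by rewrite -[X in X%:R](subnKC lein) natrD; ring.
Qed.

Lemma qderCM c f : qder (fpsC c * f) = fpsC c * qder f.
Proof. by rewrite qderM qderC mul0r add0r. Qed.

Lemma qderN f : qder (- f) = - qder f.
Proof. by apply: fpsP => n; rewrite /= mulrN. Qed.

Lemma qdernM m f : qder (m%:R * f) = m%:R * qder f.
Proof. by rewrite -(rmorph_nat (@fpsC K)) qderCM. Qed.

Lemma fcoefMXn n f k :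
  fcoef (fpsX ^+ n * f) k = if (k < n)%N then 0 else fcoef f (k - n).
Proof.
elim: n k => [|n IHn] k; first by rewrite expr0 mul1r subn0.
by rewrite exprS -mulrA fcoefMX; case: k => [|k] //; rewrite IHn ltnS subSS.
Qed.

Lemma inv_1subXn n : (0 < n)%N ->
  (1 - fpsX ^+ n)^-1 = Fps (fun k => (n %| k)%N%:R) :> fps K.
Proof.
move=> n_gt0; set g := Fps _.
apply: (mulrI (fps_unit_1subXn K n_gt0)).
rewrite divrr ?fps_unit_1subXn //; apply: fpsP => k.
rewrite mulrBl mul1r fcoefD fcoefN fcoef1.
rewrite fcoefMXn /g /=; case: ltnP => [k_lt | k_ge].
  case: k k_lt => [|k] k_lt; first by rewrite dvdn0 subr0.
  by rewrite gtnNdvd // subr0.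
rewrite -{2}(subnK k_ge) dvdn_addl // subrr.
by rewrite (gtn_eqF (leq_trans n_gt0 k_ge)).
Qed.

Lemma fcoef_geom m k : (0 < m)%N ->
  fcoef (fpsX ^+ m / (1 - fpsX ^+ m) : fps K) k = ((m %| k) && (0 < k))%N%:R.
Proof.
move=> m_gt0; rewrite inv_1subXn // fcoefMXn /=; case: ltnP => [km|mk].
  by case: k km => [|k] km; rewrite ?andbF // gtnNdvd.
by rewrite (leq_trans m_gt0 mk) andbT -{2}(subnK mk) dvdn_addl.
Qed.

Lemma fcoef_lambert j n :
  fcoef (lambert j : fps K) n
    = \sum_(1 <= m < n.+1 | (m %| n)%N) m%:R ^+ j.
Proof.
transitivity (\sum_(1 <= m < n.+1)
  fcoef ((m ^ j)%:R * (fpsX ^+ m / (1 - fpsX ^+ m)) : fps K) n); first by [].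
case: n => [|n]; first by rewrite !big_geq.
rewrite [RHS]big_mkcond.
apply: eq_big_nat => m /andP[m_gt0 _].
rewrite fcoefnM fcoef_geom // andbT natrX.
by case: (m %| _)%N; rewrite ?mulr1 ?mulr0.
Qed.

End FpsTheory.

Lemma big_seq_bij (R : Type) (idx : R) (op : Monoid.com_law idx)
    (I J : eqType) (r1 : seq I) (r2 : seq J) (h : I -> J) (h' : J -> I)
    (F : J -> R) :
    uniq r1 -> uniq r2 ->
    {in r1, forall x, h x \in r2 /\ h' (h x) = x} ->
    {in r2, forall y, h' y \in r1 /\ h (h' y) = y} ->
  \big[op/idx]_(y <- r2) F y = \big[op/idx]_(x <- r1) F (h x).
Proof.
move=> U1 U2 H1 H2; rewrite -(big_map h xpredT F).
apply: perm_big; apply: uniq_perm => //.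
  by rewrite map_inj_in_uniq // => x y /H1[_ {2}<-] /H1[_ {2}<-] ->.
move=> y; apply/idP/mapP => [/H2[? ?]|[x /H1[? _] ->] //].
by exists (h' y).
Qed.

(** * Ramanujan's differential equations *)

Section Convolution.
Variables (K : numFieldType) (n : nat).

Definition factor_pairs : seq (nat * nat) :=
  [seq (a, x) | a <- iota 1 n, x <- iota 1 n].

(** These quadruples index the coefficient of degree [n] in a product of two
    Lambert series. *)
Definition quads : seq (nat * nat * (nat * nat)) :=
  [seq q <- [seq (p, r) | p <- factor_pairs, r <- factor_pairs]
     | q.1.1 * q.1.2 + q.2.1 * q.2.2 == n]%N.

Lemma mem_factor_pairs a x :
  ((a, x) \in factor_pairs) = [&& 0 < a <= n & 0 < x <= n]%N.
Proof.
apply/allpairsP/idP => [[[a' x'] /= [+ + [-> ->]]]|/andP[a_n x_n]].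
  by rewrite !mem_iota !add1n !ltnS => -> ->.
by exists (a, x); rewrite !mem_iota !add1n !ltnS.
Qed.

Lemma factor_pairs_uniq : uniq factor_pairs.
Proof. by apply: allpairs_uniq; rewrite ?iota_uniq // => -[? ?] [? ?]. Qed.

Lemma quads_uniq : uniq quads.
Proof.
apply: filter_uniq; apply: allpairs_uniq => [||[? ?] [? ?] //];
exact: factor_pairs_uniq.
Qed.

Lemma mem_quads a x b y : (((a, x), (b, y)) \in quads)
  = [&& 0 < a, 0 < x, 0 < b, 0 < y & a * x + b * y == n]%N.
Proof.
rewrite mem_filter /=.
have -> : (((a, x), (b, y)) \in [seq (p, r) | p <- factor_pairs, r <- factor_pairs])
   = ((a, x) \in factor_pairs) && ((b, y) \in factor_pairs).
  apply/allpairsP/idP => [[[p r] /= [+ + [-> ->]]]|/andP[? ?]]; first by move=> -> ->.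
  by exists ((a, x), (b, y)).
rewrite !mem_factor_pairs; apply/idP/idP; nia.
Qed.

Lemma conv_quads (f g : nat -> nat -> K) :
  \sum_(i < n.+1) (\sum_(p <- factor_pairs | (p.1 * p.2 == i)%N) f p.1 p.2)
    * (\sum_(r <- factor_pairs | (r.1 * r.2 == n - i)%N) g r.1 r.2)
  = \sum_(q <- quads) f q.1.1 q.1.2 * g q.2.1 q.2.2.
Proof.
rewrite big_filter [RHS]big_mkcond big_allpairs /=.
under eq_bigr do rewrite big_mkcond big_distrl /=.
rewrite exchange_big; apply: eq_bigr => -[a x] _ /=.
have [axn|axn] := leqP (a * x) n.
  rewrite (bigD1 (Ordinal (axn : a * x < n.+1)%N)) //= eqxx [X in _ + X]big1 ?addr0.
    rewrite [X in _ * X]big_mkcond big_distrr /=; apply: eq_bigr => -[b y] _ /=.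
    have -> : (b * y == n - a * x)%N = (a * x + b * y == n)%N by lia.
    by case: ifP => //; rewrite mulr0.
  move=> i; rewrite -val_eqE /= => /negbTE; rewrite eq_sym => ->.
  by rewrite mul0r.
rewrite !big1 // => [[b y] _|i _] /=.
  by case: eqP => //; lia.
by case: eqP => [E|]; rewrite ?mul0r //; move: (ltn_ord i); lia.
Qed.

Lemma sum_factor_pairs i (f : nat -> nat -> K) : (0 < i <= n)%N ->
  \sum_(p <- factor_pairs | (p.1 * p.2 == i)%N) f p.1 p.2
  = \sum_(1 <= m < i.+1 | (m %| i)%N) f m (i %/ m)%N.
Proof.
move=> /andP[i0 ilen]; rewrite big_mkcond big_allpairs /=.
have -> : iota 1 n = index_iota 1 n.+1 by rewrite /index_iota subSS subn0.
rewrite (big_cat_nat (n := i.+1)) ?ltnS //=.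
rewrite [X in _ + X]big_nat [X in _ + X]big1 ?addr0.
  rewrite [RHS]big_mkcond /=.
  apply: eq_big_nat => m /andP[m0 mi].
  rewrite -big_mkcond; case: ifP => [/dvdnP [k E]|mi'].
    rewrite (eq_bigl (pred1 k)) => [|x].
      rewrite big_nat1_eq E mulnK // ifT //.
      by move: i0 ilen; rewrite E; nia.
    by rewrite /= E mulnC eqn_pmul2r.
  rewrite big1 // => x /eqP E.
  by move: mi'; rewrite -E dvdn_mulr.
move=> m /andP[im mn]; rewrite big_nat big1 // => x /andP[x0 xn].
by case: eqP => //; nia.
Qed.

Lemma lambert_factor_pairs j i : (i <= n)%N ->
  fcoef (lambert j : fps K) i
  = \sum_(p <- factor_pairs | (p.1 * p.2 == i)%N) p.1%:R ^+ j.
Proof.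
move=> ilen; rewrite fcoef_lambert.
case: (posnP i) => [->|i0].
  rewrite big_geq // big_seq_cond big1 // => -[a x].
  by rewrite mem_factor_pairs /= => /andP[? /eqP]; nia.
by rewrite (@sum_factor_pairs i (fun a _ => a%:R ^+ j)) // i0.
Qed.

Lemma lambert_conv j k :
  fcoef (lambert j * lambert k : fps K) n
  = \sum_(q <- quads) q.1.1%:R ^+ j * q.2.1%:R ^+ k.
Proof.
rewrite -(conv_quads (fun a _ => a%:R ^+ j) (fun a _ => a%:R ^+ k)) fcoefM.
apply: eq_bigr => i _.
by rewrite !lambert_factor_pairs ?leq_subr // -ltnS.
Qed.

(** Liouville's method compares sums over the quadruples with sums over those
    subject to a constraint [c] on all four entries, for summands depending on
    [a] and [b] only. *)
Definition quad_sum (c : nat -> nat -> nat -> nat -> bool) (f : K -> K -> K) :=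
  \sum_(q <- quads | c q.1.1 q.1.2 q.2.1 q.2.2) f q.1.1%:R q.2.1%:R.
Local Notation "\S_ c f" := (quad_sum c f) (at level 10, c at level 2, f at level 8).
Implicit Types f : K -> K -> K.

Definition qall (a x b y : nat) := true.
Definition a_gt_b (a x b y : nat) := (b < a)%N.
Definition a_eq_b (a x b y : nat) := (a == b)%N.
Definition a_lt_b (a x b y : nat) := (a < b)%N.
Definition x_gt_y (a x b y : nat) := (y < x)%N.
Definition x_eq_y (a x b y : nat) := (x == y)%N.
Definition x_lt_y (a x b y : nat) := (x < y)%N.

(** One step of Euclid's algorithm, [(a, x, b, y) |-> (a - b, x, b, x + y)],
    preserves [a * x + b * y] and is a bijection from the quadruples with
    [b < a] onto those with [x < y]. *)
Lemma euclid_step f : \S_ x_lt_y f = \S_ a_gt_b (fun a b => f (a - b) b).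
Proof.
rewrite /quad_sum -[LHS]big_filter -[RHS]big_filter.
pose h (q : nat * nat * (nat * nat)) :=
  ((q.1.1 - q.2.1, q.1.2), (q.2.1, q.1.2 + q.2.2))%N.
pose h' (q : nat * nat * (nat * nat)) :=
  ((q.1.1 + q.2.1, q.1.2), (q.2.1, q.2.2 - q.1.2))%N.
rewrite (@big_seq_bij _ _ _ _ _ [seq q <- quads | a_gt_b q.1.1 q.1.2 q.2.1 q.2.2]
  _ h h'); last 4 first.
- exact/filter_uniq/quads_uniq.
- exact/filter_uniq/quads_uniq.
- move=> [[a x] [b y]]; rewrite /h /h' !(mem_filter _ _ quads) /= !mem_quads /a_gt_b /x_lt_y.
  case/andP => ba /and5P[a0 x0 b0 y0 /eqP <-].
  rewrite mulnBl mulnDr subnK ?(ltnW ba) // [(x + y - x)%N]addKn.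
  have := leq_mul (ltnW ba) (leqnn x); split=> //; lia.
- move=> [[a x] [b y]]; rewrite /h /h' !(mem_filter _ _ quads) /= !mem_quads /a_gt_b /x_lt_y.
  case/andP => xy /and5P[a0 x0 b0 y0 /eqP <-].
  rewrite mulnBr mulnDl addnK subnKC ?(ltnW xy) //.
  have := leq_mul (leqnn b) (ltnW xy); split=> //; lia.
rewrite big_seq_cond [RHS]big_seq_cond; apply: eq_bigr => -[[a x] [b y]].
rewrite (mem_filter _ _ quads) /= mem_quads /a_gt_b /= => H.
by rewrite natrB //; lia.
Qed.

Lemma quads_swap (c c' : nat -> nat -> nat -> nat -> bool) f :
    (forall a x b y, c a x b y = c' b y a x) ->
  \S_ c f = \S_ c' (fun a b => f b a).
Proof.
move=> cc'; rewrite /quad_sum -[LHS]big_filter -[RHS]big_filter.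
pose h (q : nat * nat * (nat * nat)) := (q.2, q.1).
rewrite (@big_seq_bij _ _ _ _ _
  [seq q <- quads | c' q.1.1 q.1.2 q.2.1 q.2.2] _ h h) //.
- exact/filter_uniq/quads_uniq.
- exact/filter_uniq/quads_uniq.
- move=> [[a x] [b y]]; rewrite /h !(mem_filter _ _ quads) /= !mem_quads cc'.
  by move=> /and5P[-> -> -> ->] /andP[-> ]; rewrite addnC => ->.
- move=> [[a x] [b y]]; rewrite /h !(mem_filter _ _ quads) /= !mem_quads cc'.
  by move=> /and5P[-> -> -> ->] /andP[-> ]; rewrite addnC => ->.
Qed.

Lemma quads_split_a f :
  \S_ qall f = \S_ a_gt_b f + \S_ a_eq_b f + \S_ a_lt_b f.
Proof.
rewrite /quad_sum !(big_mkcond (fun q => _ q.1.1 _ _ _)) -!big_split /=; apply: eq_bigr => q _.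
rewrite /qall /a_gt_b /a_eq_b /a_lt_b.
by case: ltngtP; rewrite ?addr0 ?add0r.
Qed.

Lemma quads_split_x f :
  \S_ qall f = \S_ x_lt_y f + \S_ x_eq_y f + \S_ x_gt_y f.
Proof.
rewrite /quad_sum !(big_mkcond (fun q => _ q.1.1 _ _ _)) -!big_split /=; apply: eq_bigr => q _.
rewrite /qall /x_gt_y /x_eq_y /x_lt_y.
by case: ltngtP; rewrite ?addr0 ?add0r.
Qed.

Lemma x_gt_y_swap f : \S_ x_gt_y f = \S_ a_lt_b (fun a b => f a (b - a)).
Proof.
rewrite (quads_swap (c' := x_lt_y)) // euclid_step.
by rewrite (quads_swap (c' := a_lt_b)).
Qed.

Lemma quadsD c f g : \S_ c (fun a b => f a b + g a b) = \S_ c f + \S_ c g.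
Proof. exact: big_split. Qed.

Lemma quadsN c f : \S_ c (fun a b => - f a b) = - \S_ c f.
Proof. by rewrite /quad_sum sumrN. Qed.

Lemma quadsZ c k f : \S_ c (fun a b => k * f a b) = k * \S_ c f.
Proof. by rewrite /quad_sum big_distrr. Qed.

Lemma eq_quads c f g : (forall a b, f a b = g a b) -> \S_ c f = \S_ c g.
Proof. by move=> fg; apply: eq_bigr => q _; rewrite fg. Qed.

(** Splitting a sum over all the quadruples according to the order of [a] and
    [b], or of [x] and [y], produces off-diagonal parts that Euclid's step
    identifies with one another; they cancel and only the two diagonals
    remain. *)
Lemma liouville1 (F : K -> K) : (forall a, F (- a) = F a) ->
  \S_ qall (fun a b => F (a - b) - F (a + b))
  = \S_ a_eq_b (fun a b => F (a - b) + 2%:R * F a)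
    - \S_ x_eq_y (fun a b => F (a + b) + 2%:R * F a).
Proof.
move=> Feven.
rewrite !quadsD !quadsN !quadsZ.
rewrite {1}quads_split_a [\S_ qall _]quads_split_x.
rewrite (quads_swap (c := a_lt_b) (c' := a_gt_b)) //.
rewrite (quads_swap (c := x_gt_y) (c' := x_lt_y)) //.
have -> : \S_ a_gt_b (fun a b => F (b - a)) = \S_ x_lt_y (fun a _ => F a).
  by rewrite euclid_step; apply: eq_quads => a b /=; rewrite -Feven opprB.
have -> : \S_ a_gt_b (fun a b => F (a - b)) = \S_ x_lt_y (fun a _ => F a).
  by rewrite euclid_step.
rewrite !euclid_step.
have E := quads_split_x (fun a _ => F a).
rewrite quads_split_a x_gt_y_swap euclid_step in E.
have -> : \S_ a_gt_b (fun a b => F (a - b + b)) = \S_ a_gt_b (fun a _ => F a).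
  by apply: eq_quads => a b /=; rewrite subrK.
have -> : \S_ a_gt_b (fun a b => F (b + (a - b))) = \S_ a_gt_b (fun a _ => F a).
  by apply: eq_quads => a b /=; rewrite addrC subrK.
move: E => /(canRL (addrK _)) /(canRL (addrK _)) ->.
by ring.
Qed.

(** The same cancellation with the weight [a * b]; it gives access to the
    square of [lambert 3], which the other identity only yields in combination
    with the product of [lambert 1] and [lambert 5]. *)
Lemma liouville2 (F : K -> K) : (forall a, F (- a) = F a) ->
  \S_ qall (fun a b => a * b * (F (a + b) + F (a - b) - 4%:R * F a))
  = \S_ a_eq_b (fun a b => a * b * F (a - b))
    + \S_ x_eq_y (fun a b => a * b * F (a + b) - 2%:R * ((a * b + b ^+ 2) * F a)).
Proof.
move=> Feven.
have -> : \S_ qall (fun a b => a * b * (F (a + b) + F (a - b) - 4%:R * F a))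
  = \S_ qall (fun a b => a * b * F (a + b))
    + \S_ qall (fun a b => a * b * F (a - b))
    - 4%:R * \S_ qall (fun a b => a * b * F a).
  by rewrite -quadsZ -quadsN -!quadsD; apply: eq_quads => a b /=; ring.
rewrite [\S_ x_eq_y _]quadsD quadsN !quadsZ.
rewrite [X in X + _ - _]quads_split_x [X in _ + X - _]quads_split_a.
rewrite (quads_swap (c := a_lt_b) (c' := a_gt_b)) //.
rewrite (quads_swap (c := x_gt_y) (c' := x_lt_y)) //.
have -> : \S_ a_gt_b (fun a b => b * a * F (b - a))
    = \S_ x_lt_y (fun a b => (a * b + b ^+ 2) * F a).
  by rewrite euclid_step; apply: eq_quads => a b /=; rewrite -Feven opprB; ring.
have -> : \S_ a_gt_b (fun a b => a * b * F (a - b))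
    = \S_ x_lt_y (fun a b => (a * b + b ^+ 2) * F a).
  by rewrite euclid_step; apply: eq_quads => a b /=; ring.
have -> : \S_ x_lt_y (fun a b => a * b * F (a + b))
    = \S_ a_gt_b (fun a b => (a * b - b ^+ 2) * F a).
  by rewrite euclid_step; apply: eq_quads => a b /=; rewrite subrK; ring.
have -> : \S_ x_lt_y (fun a b => b * a * F (b + a))
    = \S_ a_gt_b (fun a b => (a * b - b ^+ 2) * F a).
  by rewrite euclid_step; apply: eq_quads => a b /=; rewrite [b + _]addrC subrK; ring.
have E1 := quads_split_x (fun a b => (a * b + b ^+ 2) * F a).
have E2 := quads_split_a (fun a b => (a * b - b ^+ 2) * F a).
rewrite x_gt_y_swap in E1.
have E3 : \S_ a_eq_b (fun a b => (a * b - b ^+ 2) * F a) = 0.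
  by apply: big1 => q; rewrite /a_eq_b => /eqP ->; rewrite expr2 subrr mul0r.
rewrite E3 addr0 in E2.
have E4 : \S_ a_lt_b (fun a b => (a * (b - a) + (b - a) ^+ 2) * F a)
    = - \S_ a_lt_b (fun a b => (a * b - b ^+ 2) * F a).
  by rewrite -quadsN; apply: eq_quads => a b /=; ring.
rewrite E4 in E1.
have E5 : \S_ qall (fun a b => (a * b + b ^+ 2) * F a)
    + \S_ qall (fun a b => (a * b - b ^+ 2) * F a)
    = 2%:R * \S_ qall (fun a b => a * b * F a).
  by rewrite -quadsD -quadsZ; apply: eq_quads => a b /=; ring.
rewrite E1 E2 in E5.
have -> : 4%:R * \S_ qall (fun a b => a * b * F a)
    = 2%:R * (2%:R * \S_ qall (fun a b => a * b * F a)) by ring.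
rewrite -E5; ring.
Qed.

(** On the diagonal [x = y] the constraint reads [(a + b) * x = n], so that
    [a + b] runs over the divisors of [n]. *)
Lemma diag_x f : (0 < n)%N -> \S_ x_eq_y f
  = \sum_(1 <= m < n.+1 | (m %| n)%N) \sum_(1 <= l < m) f l%:R (m%:R - l%:R).
Proof.
move=> n0; rewrite /quad_sum.
rewrite -(@sum_factor_pairs n
  (fun m _ => \sum_(1 <= l < m) f l%:R (m%:R - l%:R))) ?n0 ?leqnn //.
rewrite -big_filter.
pose r := [seq (p, l) | p <- [seq p <- factor_pairs | p.1 * p.2 == n]%N,
                         l <- index_iota 1 p.1].
have -> : \sum_(p <- factor_pairs | (p.1 * p.2 == n)%N)
    \sum_(1 <= l < p.1) f l%:R (p.1%:R - l%:R)
  = \sum_(z <- r) f z.2%:R (z.1.1%:R - z.2%:R).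
  by rewrite big_allpairs_dep /= big_filter.
have mem_r d x l : (((d, x), l) \in r) = [&& 0 < l < d, 0 < x & d * x == n]%N.
  apply/allpairsPdep/idP => [[[d' x'] [l']]|H].
    rewrite mem_filter mem_factor_pairs mem_index_iota /=.
    by case=> H1 H2 [-> -> ->]; lia.
  exists (d, x), l; rewrite mem_filter mem_factor_pairs mem_index_iota /=.
  by split=> //; nia.
pose h (z : nat * nat * nat) := ((z.2, z.1.2), (z.1.1 - z.2, z.1.2))%N.
pose h' (q : nat * nat * (nat * nat)) := ((q.1.1 + q.2.1, q.1.2), q.1.1)%N.
rewrite (@big_seq_bij _ _ _ _ _ r _ h h'); last 4 first.
- apply: allpairs_uniq_dep.
  + exact/filter_uniq/factor_pairs_uniq.
  + by move=> *; apply: iota_uniq.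
  + by move=> [[? ?] ?] [[? ?] ?] _ _ /= [-> -> ->].
- exact/filter_uniq/quads_uniq.
- move=> [[d x] l]; rewrite mem_r /h /h' (mem_filter _ _ quads) /= mem_quads /x_eq_y => H.
  by split; [nia | congr (_, _, _); lia].
- move=> [[a x] [b y]]; rewrite (mem_filter _ _ quads) /= mem_quads /h /h' mem_r /x_eq_y /=.
  case/andP=> /eqP <- H; split; [nia | by congr (_, _, (_, _)); lia].
rewrite big_seq_cond [RHS]big_seq_cond; apply: eq_bigr => -[[d x] l].
rewrite mem_r /= => H; rewrite natrB //; lia.
Qed.

(** On the diagonal [a = b] the constraint reads [a * (x + y) = n]; there are
    [n / a - 1] choices for [x]. *)
Lemma diag_a f : (0 < n)%N -> \S_ a_eq_b f
  = \sum_(1 <= m < n.+1 | (m %| n)%N) (n%:R / m%:R - 1) * f m%:R m%:R.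
Proof.
move=> n0; rewrite /quad_sum.
transitivity (\sum_(1 <= m < n.+1 | (m %| n)%N)
  \sum_(1 <= l < n %/ m) f m%:R m%:R); last first.
  rewrite big_nat_cond [RHS]big_nat_cond; apply: eq_bigr => m.
  case/andP=> /andP[m0 _] mn.
  rewrite sumr_const_nat -[in RHS](divnK mn) natrM mulfK ?pnatr_eq0 -?lt0n //.
  rewrite -[LHS]mulr_natl; congr (_ * _).
  rewrite natrB // divn_gt0 //; exact: dvdn_leq.
rewrite -(@sum_factor_pairs n
  (fun m k => \sum_(1 <= l < k) f m%:R m%:R)) ?n0 ?leqnn //.
rewrite -big_filter.
pose r := [seq (p, l) | p <- [seq p <- factor_pairs | p.1 * p.2 == n]%N,
                         l <- index_iota 1 p.2].
have -> : \sum_(p <- factor_pairs | (p.1 * p.2 == n)%N)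
    \sum_(1 <= l < p.2) f p.1%:R p.1%:R
  = \sum_(z <- r) f z.1.1%:R z.1.1%:R.
  by rewrite big_allpairs_dep /= big_filter.
have mem_r a k l : (((a, k), l) \in r) = [&& 0 < l < k, 0 < a & a * k == n]%N.
  apply/allpairsPdep/idP => [[[d' x'] [l']]|H].
    rewrite mem_filter mem_factor_pairs mem_index_iota /=.
    by case=> H1 H2 [-> -> ->]; lia.
  exists (a, k), l; rewrite mem_filter mem_factor_pairs mem_index_iota /=.
  by split=> //; nia.
pose h (z : nat * nat * nat) := ((z.1.1, z.2), (z.1.1, z.1.2 - z.2))%N.
pose h' (q : nat * nat * (nat * nat)) := ((q.1.1, q.1.2 + q.2.2), q.1.2)%N.
rewrite (@big_seq_bij _ _ _ _ _ r _ h h') //.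
- apply: allpairs_uniq_dep.
  + exact/filter_uniq/factor_pairs_uniq.
  + by move=> *; apply: iota_uniq.
  + by move=> [[? ?] ?] [[? ?] ?] _ _ /= [-> -> ->].
- exact/filter_uniq/quads_uniq.
- move=> [[d x] l]; rewrite mem_r /h /h' (mem_filter _ _ quads) /= mem_quads /a_eq_b => H.
  by split; [nia | congr (_, _, _); lia].
- move=> [[a x] [b y]]; rewrite (mem_filter _ _ quads) /= mem_quads /h /h' mem_r /a_eq_b /=.
  case/andP=> /eqP <- H; split; [nia | by congr (_, _, (_, _)); lia].
Qed.

End Convolution.

Section Ramanujan.
Variable K : numFieldType.

(** Faulhaber's formulas for the exponents occurring below, packaged in one
    identity so that a single induction proves them all. *)
Lemma sum_powers (c0 c1 c2 c4 c5 c6 : K) m (M := m.+1%:R : K) :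
  \sum_(1 <= l < m.+1) (c0 + c1 * l%:R + c2 * l%:R ^+ 2 + c4 * l%:R ^+ 4
                         + c5 * l%:R ^+ 5 + c6 * l%:R ^+ 6)
  = c0 * (M - 1) + c1 * (M ^+ 2 - M) / 2%:R
    + c2 * (M ^+ 3 / 3%:R - M ^+ 2 / 2%:R + M / 6%:R)
    + c4 * (M ^+ 5 / 5%:R - M ^+ 4 / 2%:R + M ^+ 3 / 3%:R - M / 30%:R)
    + c5 * (M ^+ 6 / 6%:R - M ^+ 5 / 2%:R + 5%:R / 12%:R * M ^+ 4 - M ^+ 2 / 12%:R)
    + c6 * (M ^+ 7 / 7%:R - M ^+ 6 / 2%:R + M ^+ 5 / 2%:R - M ^+ 3 / 6%:R + M / 42%:R).
Proof.
rewrite /M {M}; elim: m => [|m IHm].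
  by rewrite big_geq //; field.
by rewrite big_nat_recr //= IHm -!natr1; field.
Qed.

Definition divisor_sum n (f : K -> K) : K :=
  \sum_(1 <= m < n.+1 | (m %| n)%N) f m%:R.

Lemma eq_divisor_sum n f g : (0 < n)%N ->
    (forall m, f m.+1%:R = g m.+1%:R) ->
  divisor_sum n f = divisor_sum n g.
Proof.
move=> n0 fg; rewrite /divisor_sum big_nat_cond [RHS]big_nat_cond.
by apply: eq_bigr => -[|m] // _; rewrite fg.
Qed.

Lemma divisor_sumD n f g :
  divisor_sum n f + divisor_sum n g = divisor_sum n (fun x => f x + g x).
Proof. by rewrite /divisor_sum -big_split. Qed.

Lemma divisor_sumZ n c f :
  c * divisor_sum n f = divisor_sum n (fun x => c * f x).
Proof. by rewrite /divisor_sum big_distrr. Qed.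

Lemma divisor_sumN n f : - divisor_sum n f = divisor_sum n (fun x => - f x).
Proof. by rewrite /divisor_sum sumrN. Qed.

Lemma fcoef_lambert_divisor_sum j n :
  fcoef (lambert j : fps K) n = divisor_sum n (fun x => x ^+ j).
Proof. exact: fcoef_lambert. Qed.

Lemma fcoef_lambert0 j : fcoef (lambert j : fps K) 0 = 0.
Proof. by rewrite fcoef_lambert big_geq. Qed.

Lemma liouville1_divisor_sum n (F : K -> K) (g : K -> K) : (0 < n)%N ->
    (forall a, F (- a) = F a) ->
    (forall m, \sum_(1 <= l < m.+1) (F m.+1%:R + 2%:R * F l%:R) = g m.+1%:R) ->
  quad_sum n qall (fun a b => F (a - b) - F (a + b))
  = divisor_sum n (fun x => (n%:R / x - 1) * (F 0 + 2%:R * F x) - g x).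
Proof.
move=> n0 Feven gE; rewrite liouville1 // diag_a // diag_x //.
rewrite -sumrB /divisor_sum big_nat_cond [RHS]big_nat_cond.
apply: eq_bigr => -[|m] // _; rewrite subrr -gE; congr (_ - _).
by apply: eq_bigr => l _; rewrite [l%:R + _]addrC subrK.
Qed.

(** Liouville's first identity for the square function. *)
Lemma lambert11 : 12%:R * lambert 1 ^+ 2
  = 5%:R * lambert 3 + lambert 1 - 6%:R * qder (lambert 1) :> fps K.
Proof.
apply: fpsP => -[|n].
  by rewrite ?expr2 !(fcoefD, fcoefN, fcoefnM, fcoef_qder) fcoefM0 !fcoef_lambert0; ring.
rewrite ?expr2 !(fcoefD, fcoefN, fcoefnM) lambert_conv fcoef_qder.
rewrite !fcoef_lambert_divisor_sum.
(* Here and below the coefficient functions are the Faulhaber polynomials of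
   the diagonal terms. *)
have := @liouville1_divisor_sum n.+1 (fun x => x ^+ 2)
  (fun M => M ^+ 2 * (M - 1)
     + 2%:R * (M ^+ 3 / 3%:R - M ^+ 2 / 2%:R + M / 6%:R)) isT.
move=> /(_ (@sqrrN _)) E.
have {E} /E E : forall m, \sum_(1 <= l < m.+1)
    ((m.+1%:R : K) ^+ 2 + 2%:R * l%:R ^+ 2)
  = m.+1%:R ^+ 2 * (m.+1%:R - 1)
     + 2%:R * (m.+1%:R ^+ 3 / 3%:R - m.+1%:R ^+ 2 / 2%:R + m.+1%:R / 6%:R).
  move=> m; transitivity (\sum_(1 <= l < m.+1) ((m.+1%:R ^+ 2) + 0 * l%:R + 2%:R * l%:R ^+ 2
      + 0 * l%:R ^+ 4 + 0 * l%:R ^+ 5 + 0 * l%:R ^+ 6 : K)).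
    by apply: eq_bigr => l _; ring.
  by rewrite sum_powers; field.
have -> : \sum_(q <- quads n.+1) q.1.1%:R ^+ 1 * q.2.1%:R ^+ 1
  = - 4%:R^-1 * quad_sum n.+1 qall (fun a b => (a - b) ^+ 2 - (a + b) ^+ 2) :> K.
  by rewrite -quadsZ; apply: eq_bigr => q _; field.
rewrite E !(divisor_sumZ, divisor_sumN, divisor_sumD).
by apply: eq_divisor_sum => // m; field; rewrite nat1r pnatr_eq0.
Qed.

(** Liouville's second identity for the fourth power. *)
Lemma lambert33 : 120%:R * lambert 3 ^+ 2 = lambert 7 - lambert 3 :> fps K.
Proof.
apply: fpsP => -[|n].
  by rewrite ?expr2 !(fcoefD, fcoefN, fcoefnM, fcoef_qder) fcoefM0 !fcoef_lambert0; ring.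
rewrite ?expr2 !(fcoefD, fcoefN, fcoefnM) lambert_conv.
rewrite !fcoef_lambert_divisor_sum.
have Feven (a : K) : (- a) ^+ 4 = a ^+ 4 by ring.
have := liouville2 n.+1 Feven; rewrite diag_x //.
rewrite [X in _ = X + _]big1 ?add0r; last first.
  by move=> q /eqP ->; rewrite subrr expr0n /= mulr0.
have -> : quad_sum n.+1 qall
      (fun a b => a * b * ((a + b) ^+ 4 + (a - b) ^+ 4 - 4%:R * a ^+ 4))
    = 12%:R * \sum_(q <- quads n.+1) q.1.1%:R ^+ 3 * q.2.1%:R ^+ 3 :> K.
  transitivity (quad_sum n.+1 qall (fun a b : K => 12%:R * (a ^+ 3 * b ^+ 3)
      + (2%:R * (a * b ^+ 5) - 2%:R * (b * a ^+ 5)))).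
    by apply: eq_quads => a b; ring.
  rewrite quadsD quadsZ [X in _ + X]quadsD quadsN !quadsZ.
  rewrite [X in _ + (_ * X - _)](@quads_swap _ _ _ qall) //.
  by rewrite subrr addr0.
have -> : \sum_(1 <= m < n.+2 | (m %| n.+1)%N) \sum_(1 <= l < m)
      (l%:R * (m%:R - l%:R) * (l%:R + (m%:R - l%:R)) ^+ 4
       - 2%:R * ((l%:R * (m%:R - l%:R) + (m%:R - l%:R) ^+ 2) * l%:R ^+ 4))
    = divisor_sum n.+1 (fun x => (x ^+ 7 - x ^+ 3) / 10%:R).
  rewrite /divisor_sum big_nat_cond [RHS]big_nat_cond.
  apply: eq_bigr => -[|m] // _.
  pose M : K := m.+1%:R.
  transitivity (\sum_(1 <= l < m.+1) (0 + M ^+ 5 * l%:R + (- M ^+ 4) * l%:R ^+ 2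
      + (- (2%:R * M ^+ 2)) * l%:R ^+ 4 + 2%:R * M * l%:R ^+ 5 + 0 * l%:R ^+ 6)).
    by apply: eq_bigr => l _; rewrite -/M; ring.
  by rewrite sum_powers -/M; field.
move=> E.
rewrite (_ : 120%:R = 10%:R * 12%:R) ?natrM -?mulrA ?E; last by rewrite -natrM.
rewrite !(divisor_sumZ, divisor_sumN, divisor_sumD).
by apply: eq_divisor_sum => // m; field.
Qed.

(** Liouville's first identity for the fourth power. *)
Lemma lambert13 : 240%:R * (lambert 1 * lambert 3)
  = 21%:R * lambert 5 + 10%:R * lambert 3 - 30%:R * qder (lambert 3) - lambert 1
  :> fps K.
Proof.
apply: fpsP => -[|n].
  by rewrite ?expr2 !(fcoefD, fcoefN, fcoefnM, fcoef_qder) fcoefM0 !fcoef_lambert0; ring.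
rewrite ?expr2 !(fcoefD, fcoefN, fcoefnM) lambert_conv fcoef_qder.
rewrite !fcoef_lambert_divisor_sum.
have Feven (a : K) : (- a) ^+ 4 = a ^+ 4 by ring.
have := @liouville1_divisor_sum n.+1 (fun x => x ^+ 4)
  (fun M => M ^+ 4 * (M - 1)
     + 2%:R * (M ^+ 5 / 5%:R - M ^+ 4 / 2%:R + M ^+ 3 / 3%:R - M / 30%:R)) isT Feven.
have -> : quad_sum n.+1 qall (fun a b => (a - b) ^+ 4 - (a + b) ^+ 4)
    = - 16%:R * \sum_(q <- quads n.+1) q.1.1%:R ^+ 1 * q.2.1%:R ^+ 3 :> K.
  transitivity (quad_sum n.+1 qall (fun a b : K => - 8%:R * (a * b ^+ 3)
      + - 8%:R * (b * a ^+ 3))).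
    by apply: eq_quads => a b; ring.
  rewrite quadsD !quadsZ [X in _ + (_ * X)](@quads_swap _ _ _ qall) //.
  by rewrite -mulrDl -opprD -natrD.
move=> E; have {E} /E E : forall m, \sum_(1 <= l < m.+1)
    ((m.+1%:R : K) ^+ 4 + 2%:R * l%:R ^+ 4)
  = m.+1%:R ^+ 4 * (m.+1%:R - 1)
     + 2%:R * (m.+1%:R ^+ 5 / 5%:R - m.+1%:R ^+ 4 / 2%:R + m.+1%:R ^+ 3 / 3%:R
         - m.+1%:R / 30%:R).
  move=> m; transitivity (\sum_(1 <= l < m.+1) ((m.+1%:R ^+ 4) + 0 * l%:R + 0 * l%:R ^+ 2
      + 2%:R * l%:R ^+ 4 + 0 * l%:R ^+ 5 + 0 * l%:R ^+ 6 : K)).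
    by apply: eq_bigr => l _; ring.
  by rewrite sum_powers; field.
rewrite (_ : 240%:R = - 15%:R * - 16%:R); last by rewrite mulrNN -natrM.
rewrite -mulrA E !(divisor_sumZ, divisor_sumN, divisor_sumD).
by apply: eq_divisor_sum => // m; field; rewrite nat1r pnatr_eq0.
Qed.

(** Liouville's first identity for the sixth power; the square of [lambert 3]
    which it also involves is eliminated by [lambert33]. *)
Lemma lambert15 : 504%:R * (lambert 1 * lambert 5)
  = 20%:R * lambert 7 + 21%:R * lambert 5 - 42%:R * qder (lambert 5) + lambert 1
  :> fps K.
Proof.
have L33 n : fcoef (120%:R * lambert 3 ^+ 2 : fps K) n
  = fcoef (lambert 7 - lambert 3) n by rewrite lambert33.
apply: fpsP => -[|n].
  by rewrite ?expr2 !(fcoefD, fcoefN, fcoefnM, fcoef_qder) fcoefM0 !fcoef_lambert0; ring.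
move: {L33}(L33 n.+1).
rewrite ?expr2 !(fcoefD, fcoefN, fcoefnM) !lambert_conv fcoef_qder.
rewrite !fcoef_lambert_divisor_sum => L33.
have Feven (a : K) : (- a) ^+ 6 = a ^+ 6 by ring.
have := @liouville1_divisor_sum n.+1 (fun x => x ^+ 6)
  (fun M => M ^+ 6 * (M - 1)
     + 2%:R * (M ^+ 7 / 7%:R - M ^+ 6 / 2%:R + M ^+ 5 / 2%:R - M ^+ 3 / 6%:R + M / 42%:R))
  isT Feven.
have -> : quad_sum n.+1 qall (fun a b => (a - b) ^+ 6 - (a + b) ^+ 6)
    = - 24%:R * (\sum_(q <- quads n.+1) q.1.1%:R ^+ 1 * q.2.1%:R ^+ 5)
      - 3%:R^-1 * (120%:R * \sum_(q <- quads n.+1) q.1.1%:R ^+ 3 * q.2.1%:R ^+ 3)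
    :> K.
  transitivity (quad_sum n.+1 qall (fun a b : K => (- 12%:R * (a * b ^+ 5)
      + - 12%:R * (b * a ^+ 5)) - 40%:R * (a ^+ 3 * b ^+ 3))).
    by apply: eq_quads => a b; ring.
  rewrite !quadsD quadsN !quadsZ [X in _ + (_ * X) - _](@quads_swap _ _ _ qall) //.
  by rewrite -mulrDl -opprD -natrD; congr (_ - _); rewrite /quad_sum; field.
rewrite L33.
move=> E; have {E} /E E : forall m, \sum_(1 <= l < m.+1)
    ((m.+1%:R : K) ^+ 6 + 2%:R * l%:R ^+ 6)
  = m.+1%:R ^+ 6 * (m.+1%:R - 1)
     + 2%:R * (m.+1%:R ^+ 7 / 7%:R - m.+1%:R ^+ 6 / 2%:R + m.+1%:R ^+ 5 / 2%:R
         - m.+1%:R ^+ 3 / 6%:R + m.+1%:R / 42%:R).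
  move=> m; transitivity (\sum_(1 <= l < m.+1) ((m.+1%:R ^+ 6) + 0 * l%:R + 0 * l%:R ^+ 2
      + 0 * l%:R ^+ 4 + 0 * l%:R ^+ 5 + 2%:R * l%:R ^+ 6 : K)).
    by apply: eq_bigr => l _; ring.
  by rewrite sum_powers; field.
rewrite (_ : 504%:R = - 21%:R * - 24%:R); last by rewrite mulrNN -natrM.
move/(canRL (subrK _)): E => E.
rewrite -mulrA E !(divisor_sumZ, divisor_sumN, divisor_sumD).
by apply: eq_divisor_sum => // m; field; rewrite nat1r pnatr_eq0.
Qed.

Notation E2 := (@E2 K).
Notation E4 := (@E4 K).
Notation E6 := (@E6 K).

Lemma fps_nat_cancel m (f g : fps K) : (0 < m)%N -> m%:R * f = m%:R * g -> f = g.
Proof.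
move=> m0 fg; apply: fpsP => n; move: (congr1 (fun h => fcoef h n) fg).
by rewrite !fcoefnM => /mulfI; apply; rewrite pnatr_eq0 -lt0n.
Qed.

(** This identity and the next two are the purely algebraic step from the
    relations between Lambert series, the derivative being [d], to Ramanujan's
    equations. *)
Lemma E2_relation (A : comNzRingType) (a b d : A) :
    12%:R * a ^+ 2 = 5%:R * b + a - 6%:R * d ->
  12%:R * - (24%:R * d) = (1 - 24%:R * a) ^+ 2 - (1 + 240%:R * b).
Proof.
move=> /eqP; rewrite -subr_eq0 => /eqP H; apply/eqP; rewrite -subr_eq0; apply/eqP.
transitivity (- 48%:R * (12%:R * a ^+ 2 - (5%:R * b + a - 6%:R * d))); first by ring.
by rewrite H mulr0.
Qed.

Lemma E4_relation (A : comNzRingType) (a b c d : A) :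
    240%:R * (a * b) = 21%:R * c + 10%:R * b - 30%:R * d - a ->
  3%:R * (240%:R * d)
  = (1 - 24%:R * a) * (1 + 240%:R * b) - (1 - 504%:R * c).
Proof.
move=> /eqP; rewrite -subr_eq0 => /eqP H; apply/eqP; rewrite -subr_eq0; apply/eqP.
transitivity (24%:R * (240%:R * (a * b) - (21%:R * c + 10%:R * b - 30%:R * d - a))).
  by ring.
by rewrite H mulr0.
Qed.

Lemma E6_relation (A : comNzRingType) (a b c e d : A) :
    120%:R * b ^+ 2 = e - b ->
    504%:R * (a * c) = 20%:R * e + 21%:R * c - 42%:R * d + a ->
  2%:R * - (504%:R * d)
  = (1 - 24%:R * a) * (1 - 504%:R * c) - (1 + 240%:R * b) ^+ 2.
Proof.
move=> /eqP; rewrite -subr_eq0 => /eqP H1.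
move=> /eqP; rewrite -subr_eq0 => /eqP H2; apply/eqP; rewrite -subr_eq0; apply/eqP.
transitivity (480%:R * (120%:R * b ^+ 2 - (e - b))
  - 24%:R * (504%:R * (a * c) - (20%:R * e + 21%:R * c - 42%:R * d + a))).
  by ring.
by rewrite H1 H2 !mulr0 subr0.
Qed.

Lemma qder1 : qder (1 : fps K) = 0.
Proof. exact: qderC. Qed.

(** Ramanujan's equations for the derivatives of the three Eisenstein series
    are the reason why [q d/dq] preserves quasimodularity. *)
Lemma qder_E2 : 12%:R * qder E2 = E2 ^+ 2 - E4.
Proof.
rewrite qderD qder1 add0r qderN qdernM.
exact: E2_relation lambert11.
Qed.

Lemma qder_E4 : 3%:R * qder E4 = E2 * E4 - E6.
Proof.
rewrite qderD qder1 add0r qdernM.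
exact: E4_relation lambert13.
Qed.

Lemma qder_E6 : 2%:R * qder E6 = E2 * E6 - E4 ^+ 2.
Proof.
rewrite qderD qder1 add0r qderN qdernM.
exact: E6_relation lambert33 lambert15.
Qed.

(** Quasimodular forms for the full modular group, in terms of the generators
    of their algebra. An inductive predicate makes stability under [qder] a
    plain structural induction. *)
Inductive quasimodular : fps K -> Prop :=
| quasimodularC c : quasimodular (fpsC c)
| quasimodular_E2 : quasimodular E2
| quasimodular_E4 : quasimodular E4
| quasimodular_E6 : quasimodular E6
| quasimodularD f g : quasimodular f -> quasimodular g -> quasimodular (f + g)
| quasimodularM f g : quasimodular f -> quasimodular g -> quasimodular (f * g).

Lemma quasimodularN f : quasimodular f -> quasimodular (- f).
Proof.
move=> qf; rewrite -mulN1r -(rmorphN1 (@fpsC K)).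
by apply: quasimodularM; first exact: quasimodularC.
Qed.

Lemma quasimodularB f g : quasimodular f -> quasimodular g -> quasimodular (f - g).
Proof. by move=> qf /quasimodularN; apply: quasimodularD. Qed.

Lemma quasimodular_nat n : quasimodular n%:R.
Proof. by rewrite -(rmorph_nat (@fpsC K)); apply: quasimodularC. Qed.

Lemma quasimodular_div m f : (0 < m)%N -> quasimodular (m%:R * f) -> quasimodular f.
Proof.
move=> m0 qf; have -> : f = fpsC m%:R^-1 * (m%:R * f).
  rewrite mulrA -(rmorph_nat (@fpsC K)) -rmorphM mulVf ?rmorph1 ?mul1r //.
  by rewrite pnatr_eq0 -lt0n.
by apply: quasimodularM; first exact: quasimodularC.
Qed.

Lemma quasimodular_qder f : quasimodular f -> quasimodular (qder f).
Proof.
elim=> [c|||||].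
- by rewrite qderC; apply: (quasimodular_nat 0).
- apply: (@quasimodular_div 12) => //; rewrite qder_E2 expr2.
  by apply: quasimodularB; [apply: quasimodularM|]; constructor.
- apply: (@quasimodular_div 3) => //; rewrite qder_E4.
  by apply: quasimodularB; [apply: quasimodularM|]; constructor.
- apply: (@quasimodular_div 2) => //; rewrite qder_E6 expr2.
  by apply: quasimodularB; apply: quasimodularM; constructor.
- by move=> f1 g1 _ ? _ ?; rewrite qderD; apply: quasimodularD.
- move=> f1 g1 ? ? ? ?; rewrite qderM.
  by apply: quasimodularD; apply: quasimodularM.
Qed.

End Ramanujan.

(** * Partitions *)

Definition is_partition (s : seq nat) : bool := sorted geq s && (0 \notin s)%N.

(** Partitions are enumerated as bounded sequences over a finite type, since
    their size and their parts are at most [m]. *)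
Definition partitions (m : nat) : seq (seq nat) :=
  [seq s <- [seq map val (val t) | t <- enum {: m.-bseq 'I_m.+1}]
     | is_partition s & sumn s == m]%N.

Lemma leq_size_sumn (s : seq nat) : (0 \notin s)%N -> (size s <= sumn s)%N.
Proof. by elim: s => //= k s IHs; rewrite inE negb_or => /andP[? /IHs]; lia. Qed.

Lemma leq_mem_sumn (s : seq nat) k : k \in s -> (k <= sumn s)%N.
Proof. by elim: s => //= l s IHs; rewrite inE => /orP[/eqP->|/IHs]; lia. Qed.

Lemma mem_partitions m s : (s \in partitions m) = is_partition s && (sumn s == m).
Proof.
rewrite mem_filter; apply: andb_idr => /andP[/andP[_ s0] /eqP sm].
have sz : (size [seq inord k : 'I_m.+1 | k <- s] <= m)%N.
  by rewrite size_map -sm leq_size_sumn.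
apply/mapP; exists (Bseq sz); first by rewrite mem_enum.
rewrite /= -map_comp -[LHS]map_id; apply/eq_in_map => k ks /=.
by rewrite inordK // ltnS -sm leq_mem_sumn.
Qed.

Lemma partitions_uniq m : uniq (partitions m).
Proof.
apply: filter_uniq; rewrite map_inj_uniq ?enum_uniq // => s t.
by move/(inj_map val_inj)/val_inj.
Qed.

Lemma nth_partition (s : seq nat) i : sorted geq s -> (nth 0 s i.+1 <= nth 0 s i)%N.
Proof.
move=> ss; case: (ltnP i.+1 (size s)) => [lt|ge]; last by rewrite nth_default.
exact: (sortedP 0%N ss).
Qed.

Lemma filter_neq0_nth (s : seq nat) i : sorted geq s ->
  nth 0%N [seq k <- s | k != 0%N] i = nth 0%N s i.
Proof.
elim: s i => //= k s IHs i; rewrite (path_sortedE (rev_trans leq_trans)).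
case/andP=> ks /IHs{}IHs; case: eqP => /= [k0|_]; last by case: i => //= i.
have s0 : all (pred1 0%N) s by apply: sub_all ks => l /=; rewrite k0 leqn0.
move/all_pred1P: s0 => s0; rewrite s0 filter_nseq /= nth_nil k0.
by case: i => //= i; rewrite nth_nseq if_same.
Qed.

Lemma filter_neq0_partition (s : seq nat) : sorted geq s ->
  is_partition [seq k <- s | k != 0%N].
Proof.
move=> ss; rewrite /is_partition sorted_filter ?mem_filter //.
exact: rev_trans leq_trans.
Qed.

Lemma sumn_filter_neq0 s : sumn [seq k <- s | k != 0%N] = sumn s.
Proof. by elim: s => //= k s IHs; case: eqP => /= [->|]; rewrite IHs. Qed.

Lemma sumn_mkseq (f : nat -> nat) N : sumn (mkseq f N) = (\sum_(i < N) f i)%N.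
Proof. by rewrite sumnE big_map -{1}(subn0 N) big_mkord. Qed.

Lemma mkseq_nth_partition N (s : seq nat) : (0 \notin s)%N -> (size s <= N)%N ->
  [seq k <- mkseq (nth 0%N s) N | k != 0%N] = s.
Proof.
move=> s0 sN; rewrite -(subnKC sN) /mkseq iotaD map_cat filter_cat.
rewrite -/(mkseq _ _) mkseq_nth add0n.
have /all_filterP -> : all (fun k => k != 0%N) s.
  by apply/allP => k ks; apply: contra s0 => /eqP <-.
rewrite (eq_in_filter (a2 := pred0)) ?filter_pred0 ?cats0 //.
move=> k; case/(mapP (T1 := nat)) => i; rewrite mem_iota => /andP[si _] ->.
by rewrite nth_default.
Qed.

(** * Partitions and Maya diagrams *)

Section Beta.
Variables (L N : nat).

(** The first-column hook lengths of [s], padded with zeros to [N] parts. *)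
Definition beta (s : seq nat) : seq nat :=
  mkseq (fun i => nth 0 s i + (N - i.+1))%N N.

Definition beta_set (s : seq nat) : {set 'I_L} := [set a | val a \in beta s].

Definition decr_seq (A : {set 'I_L}) : seq nat := rev (map val (enum A)).

Definition unbeta (A : {set 'I_L}) : seq nat :=
  [seq k <- mkseq (fun i => nth 0 (decr_seq A) i - (N - i.+1))%N N | k != 0%N].

Lemma beta_sorted s : sorted geq s -> sorted gtn (beta s).
Proof.
move=> ss; apply/(sortedP 0%N) => i; rewrite size_mkseq => iN.
rewrite /= !nth_mkseq ?(ltnW iN) //; have := nth_partition i ss; lia.
Qed.

Lemma beta_bound s (a : nat) : (N + sumn s <= L)%N -> a \in beta s -> (a < L)%N.
Proof.
move=> NL; case/(mapP (T1 := nat)) => i; rewrite mem_iota add0n => /andP[_ iN] ->.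
have lt : (nth 0 s i <= sumn s)%N.
  have [/(mem_nth 0%N)|/(nth_default 0%N)->] := ltnP i (size s) => //.
  exact: leq_mem_sumn.
move: (sumn s) (nth _ _ _) lt NL iN => x y; lia.
Qed.

Lemma decr_seq_sorted A : sorted gtn (decr_seq A).
Proof.
rewrite /decr_seq rev_sorted.
have -> : (fun y x => gtn x y) = ltn by [].
rewrite -[enum A]filter_predT /enum_mem -enumT.
rewrite -filter_predI; apply: (subseq_sorted ltn_trans _ (iota_ltn_sorted 0 L)).
rewrite -val_enum_ord; apply: map_subseq; exact: filter_subseq.
Qed.

Lemma decr_seq_beta s : sorted geq s -> (N + sumn s <= L)%N ->
  decr_seq (beta_set s) = beta s.
Proof.
move=> ss NL; apply: (irr_sorted_eq (leT := gtn)).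
- exact: rev_trans ltn_trans.
- by move=> i; rewrite /= ltnn.
- exact: decr_seq_sorted.
- exact: beta_sorted.
move=> a; rewrite mem_rev; apply/mapP/idP => [[x]|aB].
  by rewrite mem_enum inE => ? ->.
by exists (Ordinal (beta_bound NL aB)); rewrite // mem_enum inE.
Qed.

Lemma sum_decr_seq (R : nmodType) (A : {set 'I_L}) (f : nat -> R) :
  \sum_(a in A) f a = \sum_(a <- decr_seq A) f a.
Proof.
rewrite /decr_seq (perm_big _ (permEl (perm_rev _))) /= big_map.
by rewrite big_enum.
Qed.

Lemma sum_beta_set (R : nmodType) s (f : nat -> R) :
    sorted geq s -> (N + sumn s <= L)%N ->
  \sum_(a in beta_set s) f a = \sum_(i < N) f (nth 0 s i + (N - i.+1))%N.
Proof.
move=> ss NL; rewrite sum_decr_seq decr_seq_beta // big_map.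
by rewrite -{1}(subn0 N) big_mkord.
Qed.

Lemma size_decr_seq A : size (decr_seq A) = #|A|.
Proof. by rewrite size_rev size_map -cardE. Qed.

Lemma nth_decr_seq_ge (A : {set 'I_L}) i : (i < #|A|)%N ->
  (#|A| - i.+1 <= nth 0 (decr_seq A) i)%N.
Proof.
move=> iA; have [k Ek] : exists k, (k = #|A| - i.+1)%N by exists (#|A| - i.+1)%N.
rewrite -Ek; elim: k i iA Ek => // k IHk i iA Ek.
have iA1 : (i.+1 < #|A|)%N by rewrite -subn_gt0 -Ek.
apply: leq_ltn_trans (IHk _ iA1 _) _; first by rewrite subnS -Ek.
by have := decr_seq_sorted A => /(sortedP 0%N) /(_ i); rewrite size_decr_seq; apply.
Qed.

(** The elements of [A] in increasing order dominate 0, 1, 2, and so on. *)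
Lemma sum_ge_bin (A : {set 'I_L}) : ('C(#|A|, 2) <= \sum_(a in A) a)%N.
Proof.
rewrite (sum_decr_seq A (fun a => a)) (big_nth 0%N) size_decr_seq.
rewrite -bin2_sum big_nat_rev /= add0n.
rewrite big_nat_cond [X in (_ <= X)%N]big_nat_cond; apply: leq_sum => i.
by case/andP=> /andP[_ iA] _; apply: nth_decr_seq_ge.
Qed.

Lemma unbeta_nth (A : {set 'I_L}) i : #|A| = N -> (i < N)%N ->
  nth 0%N (unbeta A) i = (nth 0 (decr_seq A) i - (N - i.+1))%N.
Proof.
move=> AN iN; rewrite filter_neq0_nth; first by rewrite nth_mkseq.
apply/(sortedP 0%N) => j; rewrite size_mkseq => jN.
rewrite !nth_mkseq ?(ltnW jN) //=.
have := decr_seq_sorted A => /(sortedP 0%N) /(_ j).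
rewrite size_decr_seq AN /= => /(_ jN); lia.
Qed.

Lemma beta_unbeta (A : {set 'I_L}) : #|A| = N -> beta_set (unbeta A) = A.
Proof.
move=> AN; apply/setP => a; rewrite inE.
have -> : beta (unbeta A) = decr_seq A.
  apply: (@eq_from_nth _ 0%N); first by rewrite size_mkseq size_decr_seq.
  move=> i; rewrite size_mkseq => iN; rewrite nth_mkseq // unbeta_nth //.
  by rewrite subnK // -[in X in (X <= _)%N]AN nth_decr_seq_ge ?AN.
by rewrite mem_rev mem_map ?mem_enum //; apply: val_inj.
Qed.

Lemma beta_setK s : is_partition s -> (size s <= N)%N -> (N + sumn s <= L)%N ->
  unbeta (beta_set s) = s.
Proof.
move=> /andP[ss s0] szN NL; rewrite /unbeta decr_seq_beta //.
rewrite -[RHS](mkseq_nth_partition s0 szN); congr filter.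
apply/eq_in_map => i; rewrite mem_iota add0n => /andP[_ iN].
by rewrite nth_mkseq // addnK.
Qed.

(** Sets with [N] elements correspond to partitions with at most [N] parts,
    the empty partition being the set of the first [N] naturals, of sum
    ['C(N, 2)]. *)
Lemma sum_beta_sets (R : nmodType) m (G : {set 'I_L} -> R) :
    (m <= N)%N -> (N + m <= L)%N ->
  \sum_(A : {set 'I_L} | (#|A| == N) && (\sum_(a in A) a == m + 'C(N, 2))%N) G A
  = \sum_(s <- partitions m) G (beta_set s).
Proof.
move=> mN NL; rewrite -big_filter.
apply: (@big_seq_bij _ _ _ _ _ _ _ _ unbeta).
- exact: partitions_uniq.
- exact/filter_uniq/index_enum_uniq.
- move=> s; rewrite mem_partitions => /andP[/andP[ss s0] /eqP sm].
  have NL' : (N + sumn s <= L)%N by rewrite sm.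
  have szN : (size s <= N)%N by apply: leq_trans mN; rewrite -sm leq_size_sumn.
  split; last by apply: beta_setK => //; apply/andP.
  rewrite mem_filter mem_index_enum andbT -size_decr_seq decr_seq_beta //.
  rewrite size_mkseq eqxx /= (@sum_beta_set nat s (fun a => a)) // (@big_split nat 0%N addn) /=.
  rewrite -(sumn_mkseq (nth 0%N s)) -sumn_filter_neq0 mkseq_nth_partition // sm.
  apply/eqP; congr (_ + _)%N.
  rewrite -bin2_sum (big_mkord xpredT (fun i => i)) (reindex_inj rev_ord_inj) /=.
  by apply: eq_bigr => i _; have := ltn_ord i; lia.
- move=> A; rewrite mem_filter => /andP[/andP[/eqP AN /eqP AS] _].
  split; last exact: beta_unbeta.
  rewrite mem_partitions filter_neq0_partition /=; last first.
    apply/(sortedP 0%N) => j; rewrite size_mkseq => jN.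
    rewrite !nth_mkseq ?(ltnW jN) //=.
    have := decr_seq_sorted A => /(sortedP 0%N) /(_ j).
    rewrite size_decr_seq AN /= => /(_ jN); lia.
  rewrite sumn_filter_neq0 sumn_mkseq -(eqn_add2r 'C(N, 2)) -AS.
  apply/eqP; rewrite (sum_decr_seq A (fun a => a)) (big_nth 0%N) size_decr_seq AN.
  rewrite big_mkord -bin2_sum (big_mkord xpredT (fun i => i)).
  rewrite [X in (_ + X)%N](reindex_inj rev_ord_inj) -big_split /=.
  apply: eq_bigr => i _; rewrite subnK //.
  by have := @nth_decr_seq_ge A i; rewrite AN => /(_ (ltn_ord i)).
Qed.

End Beta.

(** * Shifted symmetric functions *)

Section Exponentials.
Variable K : numFieldType.

Definition fexp (a : K) : fps K := Fps (fun n => a ^+ n / n`!%:R).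

Lemma fexpD a b : fexp (a + b) = fexp a * fexp b.
Proof.
apply: fpsP => n; rewrite fcoefM /= exprDn_comm; last exact: mulrC.
rewrite mulr_suml [RHS](reindex_inj rev_ord_inj) /=.
apply: eq_bigr => -[i /= +] _; rewrite ltnS => lein.
rewrite subSS subKn // -(bin_fact lein) -mulr_natl !natrM.
have n0 k : k`!%:R != 0 :> K by rewrite pnatr_eq0 -lt0n fact_gt0.
have b0 : 'C(n, i)%:R != 0 :> K by rewrite pnatr_eq0 -lt0n bin_gt0.
by field; rewrite !n0 b0.
Qed.

Lemma fexp0 : fexp 0 = 1.
Proof.
by apply: fpsP => -[|n]; rewrite fcoef1 /= ?expr0n ?mul0r // fact0 divr1.
Qed.

Definition half : K := 2%:R^-1.

Lemma half2 : half + half = 1.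
Proof. by rewrite /half; field. Qed.

(** The series [(exp (z/2) - exp (- z/2)) / z]. *)
Definition sinh_series : fps K :=
  Fps (fun n => (half ^+ n.+1 - (- half) ^+ n.+1) / n.+1`!%:R).

Lemma sinh_seriesE : fpsX * sinh_series = fexp half - fexp (- half).
Proof.
apply: fpsP => -[|n]; rewrite fcoefMX fcoefD fcoefN /=.
  by rewrite !expr0 subrr.
by rewrite mulrBl.
Qed.

Lemma fcoef_sinh0 : fcoef sinh_series 0 = 1.
Proof. by rewrite /= !expr1 opprK half2 divr1. Qed.

Lemma sinh_unit : sinh_series \is a GRing.unit.
Proof. by apply: fps_unit_coef0; rewrite fcoef_sinh0 oner_eq0. Qed.

Lemma sinh_telescope (c : K) n :
  fpsX * sinh_series * \sum_(i < n) fexp (c + i%:R)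
  = fexp (c + n%:R - half) - fexp (c - half).
Proof.
elim: n => [|n IHn]; first by rewrite big_ord0 mulr0 addr0 subrr.
rewrite big_ord_recr mulrDr IHn sinh_seriesE /= mulrBl -!fexpD.
have -> : c + n.+1%:R - half = half + (c + n%:R).
  by rewrite -natr1 /half; field.
by rewrite [- half + _]addrC; ring.
Qed.

Definition content_series (s : seq nat) : fps K :=
  \sum_(i < size s) \sum_(r < nth 0%N s i) fexp (r%:R - i%:R).

(** Up to the regularization of the divergent sum over all the rows, empty
    ones included, this is [z] times the sum of [exp ((s_i - i - 1/2) z)]. By
    telescoping along each row, [content_series] measures the difference with
    the empty partition, whose regularized sum is the inverse of
    [sinh_series]. *)
Definition row_series (s : seq nat) : fps K :=
  sinh_series^-1 + fpsX ^+ 2 * sinh_series * content_series s.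

Definition Qfun (k : nat) (s : seq nat) : K := fcoef (row_series s) k.

Lemma content_seriesE N s (t : K) : (size s <= N)%N ->
  fexp t * (fpsX * sinh_series * content_series s)
  = \sum_(i < N) (fexp (t + (nth 0%N s i)%:R - i%:R - half)
                  - fexp (t - i%:R - half)).
Proof.
move=> sN; rewrite mulrCA /content_series.
have -> : \sum_(i < size s) \sum_(r < nth 0%N s i) fexp (r%:R - i%:R)
   = \sum_(i < N) \sum_(r < nth 0%N s i) fexp (r%:R - i%:R).
  rewrite -(subnKC sN) big_split_ord /= [X in _ = _ + X]big1 ?addr0 // => i _.
  by rewrite nth_default ?big_ord0 // leq_addr.
rewrite !big_distrr /=; apply: eq_bigr => i _.
transitivity (fpsX * sinh_series * \sum_(r < nth 0%N s i) fexp (t - i%:R + r%:R)).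
  congr (_ * _); rewrite big_distrr /=.
  by apply: eq_bigr => r _; rewrite -fexpD; congr fexp; ring.
by rewrite sinh_telescope; congr (fexp _ - fexp _); ring.
Qed.

Lemma vacuum_series N (t : K) :
  fpsX * \sum_(i < N) fexp (t - i%:R - half)
  = sinh_series^-1 * (fexp t - fexp (t - N%:R)).
Proof.
have -> : \sum_(i < N) fexp (t - i%:R - half)
    = \sum_(i < N) fexp (t - N%:R + half + i%:R).
  rewrite (reindex_inj rev_ord_inj) /=; apply: eq_bigr => i _.
  by rewrite natrB ?ltn_ord // -natr1 /half; congr fexp; field.
apply: (mulrI sinh_unit); rewrite mulVKr ?sinh_unit //.
rewrite mulrA (mulrC sinh_series) sinh_telescope.
by congr (fexp _ - fexp _); ring.
Qed.

(** Think of [A] as a Maya diagram containing also all the negative integers;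
    this is the regularization of [z] times the sum of [exp ((a - M) z)] over
    its elements [a]. *)
Definition set_series L (M : nat) (A : {set 'I_L}) : fps K :=
  sinh_series^-1 * fexp (- M%:R - half) + fpsX * \sum_(a in A) fexp (a%:R - M%:R).

(** The Maya diagram of a partition is a translate of the set of the
    [s_i - i - 1/2], and translating multiplies the series by an exponential. *)
Lemma shift_row_series L N M s :
    sorted geq s -> (size s <= N)%N -> (N + sumn s <= L)%N ->
  fexp (N%:R - M%:R - half) * row_series s = set_series M (beta_set L N s).
Proof.
move=> ss sN NL; set t := _ - half.
rewrite mulrDr expr2 -!mulrA mulrCA [fpsX * (sinh_series * _)]mulrA.
rewrite (content_seriesE _ sN) sumrB mulrBr vacuum_series.
rewrite /set_series (@sum_beta_set L N _ s (fun a => fexp (a%:R - M%:R))) //.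
have -> : \sum_(i < N) fexp ((nth 0%N s i + (N - i.+1))%:R - M%:R)
    = \sum_(i < N) fexp (t + (nth 0%N s i)%:R - i%:R - half).
  apply: eq_bigr => i _; rewrite natrD natrB ?ltn_ord // -natr1 /t.
  by congr fexp; rewrite /half; field.
have -> : - M%:R - half = t - N%:R by rewrite /t; ring.
by rewrite mulrBr [fexp t * _]mulrC; ring.
Qed.

(** The element [M] contributes [z * exp 0], which is visible only in degree
    one. *)
Lemma fcoef_set_series_toggle L M (A : {set 'I_L}) (p : 'I_L) k :
    val p = M -> p \notin A -> k != 1%N ->
  fcoef (set_series M (p |: A)) k = fcoef (set_series M A) k.
Proof.
move=> pM pA k1; rewrite /set_series big_setU1 // mulrDr pM subrr fexp0 mulr1.
rewrite addrCA fcoefD [fcoef fpsX k]/= (negbTE k1) add0r //.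
Qed.

End Exponentials.

(** * The relations of Bloch and Okounkov *)

Section Toggle.
Variables (K : numFieldType) (M n : nat).
Notation L := (M.*2.+1).

(** Adding or removing [M] is an involution on the subsets of [0, L) that
    changes the sign and nothing else. The condition on [A] fixes the energy
    [n] of the diagram relative to its charge, and is invariant because [M]
    counts [M] on both sides. *)
Lemma toggle_sum (mu : seq nat) : 1%N \notin mu ->
  \sum_(A : {set 'I_L} | (\sum_(a in A) a + 'C(M.+1, 2) == n + M * #|A|)%N)
    (-1) ^+ #|A| * \prod_(k <- mu) fcoef (set_series K M A) k = 0.
Proof.
move=> mu1; have ML : (M < L)%N by lia.
pose p : 'I_L := Ordinal ML.
pose F (A : {set 'I_L}) : K :=
  (-1) ^+ #|A| * \prod_(k <- mu) fcoef (set_series K M A) k.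
pose c (A : {set 'I_L}) := (\sum_(a in A) a + 'C(M.+1, 2) == n + M * #|A|)%N.
rewrite -/F -/c (bigID (fun A : {set 'I_L} => p \in A)) /=.
rewrite (reindex_onto (fun A => p |: A) (fun A => A :\ p)) /=; last first.
  by move=> A /andP[_ pA]; rewrite setD1K.
have E (A : {set 'I_L}) : c (p |: A) && (p \in p |: A) && ((p |: A) :\ p == A)
    = c A && (p \notin A).
  rewrite setU11 andbT; case: (boolP (p \in A)) => pA /=; last first.
    rewrite setU1K // eqxx !andbT /c big_setU1 //= cardsU1 pA /=.
    by apply/eqP/eqP; lia.
  rewrite andbF; apply/negP => /andP[_ /eqP /setP /(_ p)].
  by rewrite !inE eqxx pA.
rewrite (eq_bigl _ _ E) -big_split big1 //= => A /andP[_ pA].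
rewrite /F cardsU1 pA exprS mulN1r mulNr.
have -> : \prod_(k <- mu) fcoef (set_series K M (p |: A)) k
    = \prod_(k <- mu) fcoef (set_series K M A) k; last by rewrite addNr.
apply: eq_big_seq => k kmu; rewrite fcoef_set_series_toggle //.
by apply: contraNneq mu1 => <-.
Qed.

End Toggle.

Section ChargeSum.
Variables (K : numFieldType) (n : nat).
Notation L := (n.*2.+1).

Lemma bin2_double k : ('C(k.+1, 2) * 2 = k * k.+1)%N.
Proof. by elim: k => // k IHk; rewrite binS bin1 mulnDl IHk; lia. Qed.

Lemma leq_bin2 c : (c <= 'C(c.+1, 2))%N.
Proof. by have := bin2_double c; nia. Qed.

Definition shifted_sum (mu : seq nat) (m : nat) (t : K) : K :=
  \sum_(s <- partitions m) \prod_(k <- mu) fcoef (fexp t * row_series K s) k.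

(** Diagrams with [N] elements carry the energy [e] due to the charge, so that
    [n - e] is left for the partition, if it is nonnegative. *)
Lemma fixed_charge_sum (mu : seq nat) (N e : nat) :
    ('C(N, 2) + 'C(n.+1, 2) = n * N + e)%N ->
    (e <= n -> n - e <= N /\ N + (n - e) <= L)%N ->
  \sum_(A : {set 'I_L} | (\sum_(a in A) a + 'C(n.+1, 2) == n + n * #|A|)%N
      && (#|A| == N))
    (-1) ^+ #|A| * \prod_(k <- mu) fcoef (set_series K n A) k
  = if (e <= n)%N then (-1) ^+ N * shifted_sum mu (n - e) (N%:R - n%:R - half K) else 0.
Proof.
move=> hN he; case: ifP => en.
  have [mN NL] := he en.
  rewrite /shifted_sum big_distrr.
  transitivity (\sum_(A : {set 'I_L} | (#|A| == N)
      && (\sum_(a in A) a == n - e + 'C(N, 2))%N)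
    (-1) ^+ N * \prod_(k <- mu) fcoef (set_series K n A) k).
    apply: eq_big => [A|A /andP[_ /eqP->]] //.
    rewrite andbC; case: (altP (#|A| =P N)) => //= ->.
    by apply/eqP/eqP; lia.
  rewrite (sum_beta_sets _ mN NL) [LHS]big_seq [RHS]big_seq.
  apply: eq_bigr => s; rewrite mem_partitions => /andP[/andP[ss s0] /eqP sm].
  congr (_ * _); apply: eq_bigr => k _.
  rewrite (@shift_row_series K L) ?sm //.
  by apply: leq_trans mN; rewrite -sm leq_size_sumn.
rewrite big_pred0 // => A; apply/negP => /andP[/eqP H /eqP AN].
have := sum_ge_bin A; rewrite AN in H *; move: en; lia.
Qed.

(** The vanishing sum of the involution, with the sets grouped by cardinal:
    those of cardinal [n + 1 + c] and those of cardinal [n - c] are the shifts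
    by [c + 1/2] and by [- (c + 1/2)] of the partitions of [n - 'C(c + 1, 2)].
    As [c] is at most [n], diagrams inside [0, 2 * n + 1) with [M = n] are
    large enough for the energy [n]. *)
Lemma charge_sum (mu : seq nat) : 1%N \notin mu ->
  \sum_(c < n.+1 | ('C(c.+1, 2) <= n)%N)
    (-1) ^+ c * (shifted_sum mu (n - 'C(c.+1, 2)) (c%:R + half K)
                 - shifted_sum mu (n - 'C(c.+1, 2)) (- (c%:R + half K))) = 0.
Proof.
move=> mu1; have := toggle_sum K n n mu1.
rewrite (partition_big (fun A : {set 'I_L} => inord #|A| : 'I_L.+1) xpredT) //=.
have cardA (A : {set 'I_L}) : (#|A| < L.+1)%N.
  by rewrite ltnS -[X in (_ <= X)%N]card_ord max_card.
pose F N := \sum_(A : {set 'I_L} | (\sum_(a in A) a + 'C(n.+1, 2) == n + n * #|A|)%N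
      && (#|A| == N))
    (-1) ^+ #|A| * \prod_(k <- mu) fcoef (set_series K n A) k.
rewrite (eq_bigr (fun N : 'I_L.+1 => F N)); last first.
  by move=> N _; apply: eq_bigl => A; rewrite -val_eqE /= inordK.
have -> : \sum_(N < L.+1) F N = \sum_(N < n.+1 + n.+1) F N.
  have -> : L.+1 = (n.+1 + n.+1)%N by rewrite -addnn addSn addnS.
  by [].
rewrite big_split_ord /= (reindex_inj rev_ord_inj) -big_split /= => E.
apply: (can_inj (signrMK n.+1)); rewrite mulr0 -{}[RHS]E big_distrr big_mkcond /=.
apply: eq_bigr => -[c /= cn] _; rewrite ltnS in cn.
have hc := bin2_double c; have hn := bin2_double n.
rewrite subSS /F (@fixed_charge_sum mu (n - c) 'C(c.+1, 2)); last 2 first.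
- have : ('C(n - c, 2) * 2 = (n - c) * (n - c).-1)%N.
    by case: (n - c)%N => // k; rewrite bin2_double mulnC.
  nia.
- by have := leq_bin2 c; lia.
rewrite (@fixed_charge_sum mu (n.+1 + c) 'C(c.+1, 2)); last 2 first.
- have : ('C(n.+1 + c, 2) * 2 = (n + c) * (n + c).+1)%N.
    by rewrite addSn bin2_double.
  nia.
- by have := leq_bin2 c; lia.
case: ifP => _; last by rewrite addr0.
have -> : (n - c)%:R - n%:R - half K = - (c%:R + half K).
  by rewrite natrB //; ring.
have -> : (n.+1 + c)%:R - n%:R - half K = c%:R + half K.
  by rewrite natrD -natr1 /half; field.
have -> : (-1) ^+ (n - c) = (-1) ^+ n.+1 * - (-1) ^+ c :> K.
  by rewrite exprS mulN1r mulrNN -{2}(subnK cn) exprD -mulrA -expr2 sqrr_sign mulr1.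
rewrite exprD; ring.
Qed.

End ChargeSum.

Section BlochOkounkov.
Variable K : numFieldType.

(** Up to the factor [q^(1/8)], the derivative of order [J] at the origin of
    Jacobi's theta function, the sum over the half-integers [v] of
    [(-1)^(v - 1/2) q^(v^2/2) exp (v z)]. The terms for [v = c + 1/2] and for
    [- v] are grouped. *)
Definition theta_null (J : nat) : fps K :=
  Fps (fun n => \sum_(c < n.+1 | ('C(c.+1, 2) == n)%N)
    (-1) ^+ c * ((c%:R + half K) ^+ J - (- (c%:R + half K)) ^+ J)).

(** The generating series of the averages over all partitions of a monomial in
    the functions [Qfun k]; dividing it by [bracket [::]] gives the bracket of
    Bloch and Okounkov. *)
Definition bracket (mu : seq nat) : fps K :=
  Fps (fun n => \sum_(s <- partitions n) \prod_(k <- mu) Qfun K k s).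

(** The terms [(J, a, nu)] of the expansion, in powers of the shift [t], of a
    product of coefficients of shifted row series: each stands for
    [a * t ^ J] times the product of the [Qfun k] for [k] in [nu]. *)
Fixpoint shift_terms (mu : seq nat) : seq (nat * K * seq nat) :=
  if mu is k :: mu' then
    [seq ((j + z.1.1)%N, z.1.2 / j`!%:R, (k - j)%N :: z.2)
       | j <- iota 0 k.+1, z <- shift_terms mu']
  else [:: (0%N, 1, [::])].

Lemma shift_termsE mu s (t : K) :
  \prod_(k <- mu) fcoef (fexp t * row_series K s) k
  = \sum_(z <- shift_terms mu) z.1.2 * t ^+ z.1.1 * \prod_(k <- z.2) Qfun K k s.
Proof.
elim: mu => [|k mu IHmu]; first by rewrite big_seq1 !big_nil expr0 !mulr1.
rewrite big_cons IHmu big_allpairs_dep fcoefM big_distrl.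
rewrite -[iota 0 k.+1]/(index_iota 0 k.+1) big_mkord.
apply: eq_bigr => j _; rewrite big_distrr; apply: eq_bigr => -[[J a] nu] _.
rewrite big_cons -/(Qfun K (k - j) s); move: (Qfun K (k - j) s) => q /=.
by rewrite exprD; ring.
Qed.

Lemma theta_nullM J f n : fcoef (theta_null J * f) n
  = \sum_(c < n.+1 | ('C(c.+1, 2) <= n)%N)
    (-1) ^+ c * ((c%:R + half K) ^+ J - (- (c%:R + half K)) ^+ J)
      * fcoef f (n - 'C(c.+1, 2)).
Proof.
pose T (c : nat) : K := (-1) ^+ c * ((c%:R + half K) ^+ J - (- (c%:R + half K)) ^+ J).
rewrite fcoefM; transitivity (\sum_(e < n.+1) \sum_(c < n.+1 | ('C(c.+1, 2) == e)%N)
   T c * fcoef f (n - e)).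
  apply: eq_bigr => e _; rewrite /= big_distrl /=.
  rewrite (big_ord_widen_cond n.+1 (fun c => 'C(c.+1, 2) == e)%N
    (fun c => T c * fcoef f (n - e))) //.
  apply: eq_bigl => c; case: eqP => //= <-; by rewrite ltnS leq_bin2.
under eq_bigr do rewrite big_mkcond.
rewrite exchange_big [RHS]big_mkcond; apply: eq_bigr => c _ /=.
case: leqP => cn; last first.
  by rewrite big1 // => e _; case: eqP => // E; have := ltn_ord e; lia.
rewrite (bigD1 (Ordinal (cn : 'C(c.+1, 2) < n.+1)%N)) //= eqxx.
rewrite big1 ?addr0 // => e; rewrite -val_eqE /= eq_sym => /negbTE -> //.
Qed.

(** This is [charge_sum] with the powers of the shifts [c + 1/2] expanded:
    these powers, together with the signs and the energies ['C(c + 1, 2)], sum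
    up to the derivatives of the theta function. *)
Theorem bloch_okounkov (mu : seq nat) : 1%N \notin mu ->
  \sum_(z <- shift_terms mu) fpsC z.1.2 * theta_null z.1.1 * bracket z.2 = 0.
Proof.
move=> mu1; apply: fpsP => n; rewrite fcoef0 -[RHS](charge_sum K n mu1) fcoef_sum.
under eq_bigr do rewrite -mulrA fcoefCM theta_nullM big_distrr.
rewrite exchange_big; apply: eq_bigr => c _ /=.
rewrite /shifted_sum -sumrB.
under [X in _ = _ * X]eq_bigr do rewrite !shift_termsE -sumrB.
rewrite exchange_big big_distrr /=; apply: eq_bigr => z _.
rewrite -!mulrA mulrCA; congr (_ * _).
rewrite mulrCA !big_distrr /=; apply: eq_bigr => s _; ring.
Qed.

End BlochOkounkov.

(** * Brackets are quasimodular *)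

Section PartitionSeries.
Variable K : numFieldType.

Definition partition_series : fps K := bracket K [::].

(** Euler's product is built one factor at a time by bounding the parts. *)
Definition bounded_series (k : nat) : fps K :=
  Fps (fun n => \sum_(s <- partitions n | all (leq^~ k) s) 1).

(** Removing one part equal to [k + 1] from the partitions that have one. *)
Lemma bounded_series_rec k :
  (1 - fpsX ^+ k.+1) * bounded_series k.+1 = bounded_series k.
Proof.
apply: fpsP => n; rewrite mulrBl mul1r fcoefD fcoefN fcoefMXn /=.
rewrite (bigID (all (leq^~ k))) /=.
have -> : \sum_(s <- partitions n | all (leq^~ k.+1) s && all (leq^~ k) s) 1
    = \sum_(s <- partitions n | all (leq^~ k) s) 1 :> K.
  apply: eq_bigl => s; rewrite andb_idl // => /sub_all; apply => l /=.
  exact: leqW.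
set S := (X in _ + X - _); set T := (X in _ - X).
suff -> : S = T by rewrite addrK.
rewrite /S /T; case: ltnP => kn.
  rewrite big_seq_cond big_pred0 // => s; rewrite mem_partitions.
  apply/negP => /andP[/andP[_ /eqP sn]] /andP[_] /allPn[l ls].
  by have := leq_mem_sumn ls; rewrite sn; lia.
rewrite -[LHS]big_filter -[RHS]big_filter.
rewrite (@big_seq_bij _ _ _ _ _
  [seq s <- partitions (n - k.+1) | all (leq^~ k.+1) s] _ (cons k.+1) behead) //.
- exact/filter_uniq/partitions_uniq.
- exact/filter_uniq/partitions_uniq.
- move=> s; rewrite !(mem_filter _ _ (partitions _)) !mem_partitions.
  case/andP=> sk /andP[/andP[ss s0] /eqP sn].
  split=> //; rewrite /= ltnn sk leqnn /= sn subnKC // eqxx andbT.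
  rewrite /is_partition /= inE negb_or s0 /= andbT (path_sortedE (rev_trans leq_trans)).
  by rewrite ss andbT; apply: sub_all sk.
- case=> [|l s]; rewrite !(mem_filter _ _ (partitions _)) !mem_partitions //=.
  case/andP=> /andP[/andP[lk sk] H] /andP[/andP[]].
  rewrite /is_partition /= inE negb_or (path_sortedE (rev_trans leq_trans)).
  case/andP=> sl ss /andP[l0 s0] /eqP sn.
  have El : l = k.+1.
    apply/eqP; rewrite eqn_leq lk ltnNge; apply: contra H => lk'.
    by rewrite lk' /=; apply: sub_all sl => i /= /leq_trans; apply.
  by rewrite El sk ss s0 /= -sn El addKn eqxx.
Qed.

Definition lambert_upto (k : nat) : fps K :=
  \sum_(1 <= m < k.+1) (m ^ 1)%:R * (fpsX ^+ m / (1 - fpsX ^+ m)).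

Lemma qder_fpsXn m : qder (fpsX ^+ m) = m%:R * fpsX ^+ m :> fps K.
Proof.
apply: fpsP => k; rewrite fcoef_qder fcoefnM fcoefXn.
by case: eqP => [->|]; rewrite ?mulr0.
Qed.

Lemma qder_bounded_series k :
  qder (bounded_series k) = bounded_series k * lambert_upto k.
Proof.
elim: k => [|k IHk].
  rewrite /lambert_upto big_geq // mulr0; apply: fpsP => -[|n]; rewrite fcoef0 /=.
    by rewrite mul0r.
  rewrite big_seq_cond big_pred0 ?mulr0 // => -[|l s]; rewrite mem_partitions //=.
  apply/negP => /andP[/andP[/andP[_ ]]].
  by rewrite inE; case: l.
have U := fps_unit_1subXn K (ltn0Sn k).
apply: (mulrI U).
have : qder ((1 - fpsX ^+ k.+1) * bounded_series k.+1)
    = (1 - fpsX ^+ k.+1) * bounded_series k.+1 * lambert_upto k.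
  by rewrite bounded_series_rec.
rewrite qderM qderD qderN qder_fpsXn qder1 add0r.
move=> H; rewrite -[LHS](addKr (- (k.+1%:R * fpsX ^+ k.+1) * bounded_series k.+1)).
rewrite H /lambert_upto [in RHS]big_nat_recr //= expn1.
set a := bounded_series _; set x := _ ^+ _; set l := \sum_(1 <= _ < _) _.
rewrite mulrDr mulrDr [RHS]addrC; congr (_ + _); last by rewrite mulrA.
rewrite mulNr opprK [(1 - x) * _]mulrC -!mulrA mulVr ?mulr1 //.
by rewrite mulrC -mulrA [x * a]mulrC mulrCA.
Qed.

(** The logarithmic derivative of Euler's product; a coefficient only sees
    finitely many factors. *)
Lemma qder_partition_series :
  qder partition_series = partition_series * lambert 1.
Proof.
apply: fpsP => n.
have bE i : (i <= n)%N -> fcoef partition_series i = fcoef (bounded_series n) i.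
  move=> ilen /=; rewrite big_seq [RHS]big_seq_cond.
  apply: eq_big => [s|s _]; last by rewrite big_nil.
  case: (boolP (s \in _)) => //=; rewrite mem_partitions => /andP[_ /eqP si].
  apply/esym/allP => l /leq_mem_sumn; lia.
rewrite fcoef_qder bE // -fcoef_qder qder_bounded_series !fcoefM.
apply: eq_bigr => -[i /= +] _; rewrite ltnS => ilen; congr (_ * _).
  exact/esym/bE.
apply: fps_sum1P; last by rewrite ltnS leq_subr.
move=> m nm; rewrite fcoefnM fcoefMXn; case: m nm => // m nm.
by rewrite nm mulr0.
Qed.

End PartitionSeries.

Section Theta.
Variable K : numFieldType.
Notation theta := (theta_null K).
Notation P := (partition_series K).

Lemma theta_even J : ~~ odd J -> theta J = 0.
Proof.
move=> oJ; apply: fpsP => n; rewrite fcoef0 /=.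
rewrite big1 // => c _; set x := _%:R + half K.
by rewrite [(- x) ^+ J]exprNn -(signr_odd _ J) (negbTE oJ) mul1r subrr mulr0.
Qed.

Lemma theta1_unit : theta 1 \is a GRing.unit.
Proof.
apply: fps_unit_coef0; rewrite /= big_mkcond big_ord1 /= expr0 !expr1 mul1r add0r.
by rewrite opprK half2 oner_eq0.
Qed.

(** Jacobi's theta function satisfies the heat equation; the factor [q^(1/8)]
    that was taken out is responsible for the last term. *)
Lemma theta_heat J : theta J.+2 = 2%:R * qder (theta J) + fpsC 4%:R^-1 * theta J.
Proof.
apply: fpsP => n; rewrite fcoefD fcoefnM fcoef_qder fcoefCM mulrA -mulrDl /=.
rewrite big_distrr; apply: eq_bigr => -[c /= _] /eqP cn.
have En : 2%:R * n%:R = c%:R * (c%:R + 1) :> K.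
  by rewrite -cn -natrM mulnC bin2_double natrM natr1.
have E2 : (c%:R + half K) ^+ 2 = 2%:R * n%:R + 4%:R^-1.
  by rewrite En /half; field.
rewrite -E2; set x := _ + half K; rewrite !exprS.
by set y := (- x) ^+ J; set z := x ^+ J; ring.
Qed.

Lemma fcoef_sinhV : [/\ fcoef (sinh_series K)^-1 0 = 1,
  fcoef (sinh_series K)^-1 1 = 0 & fcoef (sinh_series K)^-1 2 = - 24%:R^-1].
Proof.
set b := _^-1; have E n : fcoef (sinh_series K * b) n = (n == 0%N)%:R.
  by rewrite divrr ?fcoef1 // sinh_unit.
have b0 : fcoef b 0 = 1.
  by have := E 0; rewrite fcoefM0 fcoef_sinh0 mul1r.
have b1 : fcoef b 1 = 0.
  have := E 1%N; rewrite fcoefM !big_ord_recl big_ord0 fcoef_sinh0 mul1r addr0.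
  by rewrite /= sqrrN subrr mul0r mul0r addr0.
split=> //; have := E 2%N.
rewrite fcoefM !big_ord_recl big_ord0 fcoef_sinh0 mul1r addr0.
rewrite [X in _ + (_ + _ * fcoef b X)](_ : _ = 0%N) // b0.
rewrite [X in _ + (_ * fcoef b X + _)](_ : _ = 1%N) // b1 mulr0 add0r mulr1.
move/(canRL (addrK _)) => -> /=; 
rewrite /half (_ : (bump 0 (bump 0 0)).+1 = 3%N) // (_ : 3`! = 6%N) //; by field.
Qed.

Lemma fcoef_content0 s : fcoef (content_series K s) 0 = (sumn s)%:R.
Proof.
rewrite fcoef_sum -[in RHS](mkseq_nth 0%N s) sumn_mkseq natr_sum.
apply: eq_bigr => i _; rewrite fcoef_sum /=.
by rewrite (eq_bigr (fun=> 1)) ?sumr_const ?card_ord // => r _; rewrite expr0 fact0 divr1.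
Qed.

Lemma Qfun0 s : Qfun K 0 s = 1.
Proof.
have [b0 _ _] := fcoef_sinhV.
by rewrite /Qfun fcoefD b0 expr2 -!mulrA fcoefMX addr0.
Qed.

Lemma Qfun1 s : Qfun K 1 s = 0.
Proof.
have [_ b1 _] := fcoef_sinhV.
by rewrite /Qfun fcoefD b1 expr2 -!mulrA !fcoefMX addr0.
Qed.

Lemma Qfun2 s : Qfun K 2 s = (sumn s)%:R - 24%:R^-1.
Proof.
have [_ _ b2] := fcoef_sinhV.
rewrite /Qfun fcoefD b2 expr2 -!mulrA !fcoefMX fcoefM0 fcoef_sinh0 mul1r.
by rewrite fcoef_content0 addrC.
Qed.

Lemma bracket_cons0 mu : bracket K (0%N :: mu) = bracket K mu.
Proof.
by apply: fpsP => n; apply: eq_bigr => s _; rewrite big_cons Qfun0 mul1r.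
Qed.

Lemma bracket_has1 mu : 1%N \in mu -> bracket K mu = 0.
Proof.
move=> mu1; apply: fpsP => n; rewrite fcoef0 /= big1 // => s _.
by rewrite (big_rem 1%N) //= Qfun1 mul0r.
Qed.

(** Since [Qfun 2] is the size of the partition up to a constant, this bracket
    is essentially the derivative of [P]. *)
Lemma bracket2 : bracket K [:: 2%N] = P * (lambert 1 - fpsC 24%:R^-1).
Proof.
rewrite mulrBr -qder_partition_series [P * fpsC _]mulrC; apply: fpsP => n.
rewrite fcoefD fcoefN fcoef_qder fcoefCM /= !big_distrr -sumrB /=.
rewrite big_seq [RHS]big_seq; apply: eq_bigr => s.
rewrite mem_partitions => /andP[_ /eqP <-].
by rewrite big_seq1 Qfun2 big_nil !mulr1.
Qed.

Lemma partition_series_unit : P \is a GRing.unit.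
Proof.
apply: fps_unit_coef0; rewrite /= (big_rem [::]) ?mem_partitions //=.
rewrite big_nil big1_seq ?addr0 ?oner_eq0 // => s /andP[_].
rewrite mem_rem_uniq ?partitions_uniq // inE mem_partitions => /andP[s0].
by case: s s0 => //= k s _ /andP[/andP[_]]; rewrite inE; case: k.
Qed.

(** The relation of Bloch and Okounkov for the single function [Qfun 3]
    involves no bracket other than [bracket2], and therefore identifies the
    ratio of [theta 3] and [theta 1]. *)
Lemma theta3 : theta 3 = theta 1 * (fpsC 4%:R^-1 * E2).
Proof.
have := bloch_okounkov K (mu := [:: 3]) isT.
rewrite /= !big_cons big_nil /= !(theta_even (J := 0)) // !(theta_even (J := 2)) //.
rewrite !mulr0 !mul0r !add0r !addr0 bracket_cons0 bracket2 !mul1r invr1 rmorph1 mul1r.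
rewrite -/P (_ : 3`! = 6%N) // !addn0 => H.
have {}H : (lambert 1 - fpsC 24%:R^-1) * theta 1 + fpsC 6%:R^-1 * theta 3 = 0.
  apply: (mulrI partition_series_unit); rewrite mulr0 -[RHS]H mulrDr.
  by congr (_ + _); [rewrite [RHS]mulrC -mulrA | rewrite mulrC].
have -> : theta 3 = fpsC 6%:R * (fpsC 6%:R^-1 * theta 3).
  by rewrite mulrA -rmorphM divff ?rmorph1 ?mul1r // pnatr_eq0.
move/eqP: H; rewrite addrC addr_eq0 => /eqP ->.
rewrite -mulNr mulrA [RHS]mulrC; congr (_ * _).
rewrite mulrN mulrBr mulrBr mulr1 !mulrA -!rmorphM -(rmorph_nat (@fpsC K)) -!rmorphM.
by rewrite opprB; congr (fpsC _ - fpsC _ * _); field.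
Qed.

End Theta.

Section QuasimodularBrackets.
Variable K : numFieldType.
Notation theta := (theta_null K).
Notation P := (partition_series K).

(** The heat equation turns the value of [theta 3] into the logarithmic
    derivative of [theta 1], a constant multiple of [E2 - 1]. (This is
    Jacobi's identity between [theta 1] and the cube of Euler's product.) *)
Lemma qder_theta1 : qder (theta 1) = theta 1 * (fpsC 8%:R^-1 * (E2 - 1)).
Proof.
have := theta_heat K 1; rewrite theta3 => H.
apply: (@fps_nat_cancel K 2) => //.
move/eqP: H; rewrite -subr_eq => /eqP <-.
have e1 : fpsC (4%:R : K)^-1 = 2%:R * fpsC 8%:R^-1.
  by rewrite -(rmorph_nat (@fpsC K)) -rmorphM; congr fpsC; field.
by rewrite e1; ring.
Qed.

(** Starting from [theta 1], whose logarithmic derivative is quasimodular, the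
    heat equation gives all the other derivatives. *)
Lemma theta_quasimodular J :
  exists2 v, quasimodular v & theta J = theta 1 * v.
Proof.
elim/ltn_ind: J => -[|[|J]] IHJ.
- by exists 0; [exact: (quasimodular_nat K 0) | rewrite theta_even // mulr0].
- by exists 1; [exact: (quasimodular_nat K 1) | rewrite mulr1].
have [//|v qv Ev] := IHJ J.
exists (2%:R * (fpsC 8%:R^-1 * (E2 - 1) * v + qder v) + fpsC 4%:R^-1 * v).
  apply: quasimodularD; apply: quasimodularM => //; try exact: quasimodularC.
    exact: quasimodular_nat.
  apply: quasimodularD; last exact: quasimodular_qder.
  do 2?apply: quasimodularM => //; first exact: quasimodularC.
  by apply: quasimodularB; [exact: quasimodular_E2 | exact: (quasimodular_nat K 1)].
by rewrite theta_heat Ev qderM qder_theta1; ring.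
Qed.

(** The brackets are not themselves quasimodular, but their quotients by the
    generating series of partitions are. *)
Definition quasimodular_ratio (f : fps K) : Prop :=
  exists2 g, quasimodular g & f = P * g.

Lemma ratio0 : quasimodular_ratio 0.
Proof. by exists 0; [exact: (quasimodular_nat K 0) | rewrite mulr0]. Qed.

Lemma ratioD f g : quasimodular_ratio f -> quasimodular_ratio g ->
  quasimodular_ratio (f + g).
Proof.
by move=> [f' qf ->] [g' qg ->]; exists (f' + g'); [apply: quasimodularD | rewrite mulrDr].
Qed.

Lemma ratioM f g : quasimodular f -> quasimodular_ratio g ->
  quasimodular_ratio (f * g).
Proof.
by move=> qf [g' qg ->]; exists (f * g'); [apply: quasimodularM | rewrite mulrCA].
Qed.

Lemma ratio_sum (I : eqType) (r : seq I) (F : I -> fps K) :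
    {in r, forall i, quasimodular_ratio (F i)} ->
  quasimodular_ratio (\sum_(i <- r) F i).
Proof.
move=> qF; rewrite big_seq; elim/big_rec: _ => [|i f ir]; first exact: ratio0.
exact/ratioD/qF.
Qed.

Lemma theta_term c J mu : quasimodular_ratio (bracket K mu) ->
  exists2 f, quasimodular_ratio f & fpsC c * theta J * bracket K mu = theta 1 * f.
Proof.
have [v qv ->] := theta_quasimodular J; exists (fpsC c * v * bracket K mu).
  by apply: ratioM => //; apply: quasimodularM => //; apply: quasimodularC.
by ring.
Qed.

Lemma theta_sum (I : eqType) (r : seq I) (F : I -> fps K) :
    {in r, forall i, exists2 f, quasimodular_ratio f & F i = theta 1 * f} ->
  exists2 f, quasimodular_ratio f & \sum_(i <- r) F i = theta 1 * f.
Proof.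
move=> qF; rewrite big_seq; elim/big_rec: _ => [|i g ir [f qf ->]].
  by exists 0; [exact: ratio0 | rewrite mulr0].
by have [h qh ->] := qF i ir; exists (h + f); [exact: ratioD | rewrite mulrDr].
Qed.

Lemma bracket_filter0 k mu :
  bracket K (k :: mu) = bracket K (k :: [seq j <- mu | j != 0%N]).
Proof.
apply: fpsP => n; apply: eq_bigr => s _; rewrite !big_cons; congr (_ * _).
rewrite big_filter [RHS]big_mkcond; apply: eq_bigr => j _.
by case: eqP => //= ->; rewrite Qfun0.
Qed.

Lemma shift_terms_cons k mu : shift_terms K (k :: mu) =
  [seq ((j + z.1.1)%N, z.1.2 / j`!%:R, (k - j)%N :: z.2)
     | j <- iota 0 k.+1, z <- shift_terms K mu].
Proof. by []. Qed.

Lemma shift_terms_weight mu z : z \in shift_terms K mu ->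
  (sumn z.2 + z.1.1 = sumn mu)%N.
Proof.
elim: mu z => [|k mu IHmu] z; first by rewrite inE => /eqP ->.
move=> /allpairsP[[j [[J a] nu]] [/= jk /IHmu /= H ->]] /=.
by move: jk; rewrite -[0%N :: _]/(iota 0 k.+1) mem_iota; lia.
Qed.

Lemma shift_terms_head mu : exists2 r, shift_terms K mu = (0%N, 1, mu) :: r
  & {in r, forall z, 0 < z.1.1}%N.
Proof.
elim: mu => [|k mu [r Er Hr]]; first by exists [::].
rewrite [shift_terms K _]/= Er /=; eexists.
  by rewrite addn0 fact0 divr1 subn0.
move=> z; rewrite mem_cat => /orP[/mapP[y /Hr yr ->] //|].
case/flatten_mapP => j; rewrite mem_iota => jk.
by rewrite inE => /orP[/eqP->|/mapP[y _ ->]] /=; lia.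
Qed.

(** The relation of Bloch and Okounkov for [k + 2 :: m] contains [theta 1]
    times the bracket of [k + 1 :: m], when the shift falls on the first
    function. The other terms with [theta 1] have the same weight, but a tail
    of smaller weight; those with a higher derivative of theta have smaller
    weight. Hence an induction on the weight, and for a given weight on the
    weight of the tail. *)
Lemma bracket_quasimodular mu : quasimodular_ratio (bracket K mu).
Proof.
suff H w k m : (k + sumn m = w)%N -> quasimodular_ratio (bracket K (k :: m)).
  case: mu => [|k m]; last exact: H.
  by exists 1; [exact: (quasimodular_nat K 1) | rewrite mulr1].
elim/ltn_ind: w k m => w IHw.
suff H t k m : sumn m = t -> (k + t = w)%N -> quasimodular_ratio (bracket K (k :: m)).
  by move=> k m; apply: H.
elim/ltn_ind: t k m => t IHt k m mt ktw; rewrite bracket_filter0.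
have {mt} : sumn [seq j <- m | j != 0%N] = t by rewrite sumn_filter_neq0.
have : 0%N \notin [seq j <- m | j != 0%N] by rewrite mem_filter.
move: [seq _ <- _ | _] => {}m m0 mt.
have IHw' nu : (sumn nu < w)%N -> quasimodular_ratio (bracket K nu).
  case: nu => [_|j nu /IHw]; last exact.
  by exists 1; [exact: (quasimodular_nat K 1) | rewrite mulr1].
have [m1|m1] := boolP (1%N \in m).
  by rewrite bracket_has1 ?inE ?m1 ?orbT //; exact: ratio0.
case: k ktw => [|k] ktw.
  rewrite bracket_cons0; case: m m0 mt {m1} => [_ _|j m].
    by exists 1; [exact: (quasimodular_nat K 1) | rewrite mulr1].
  rewrite inE negb_or eq_sym => /andP[j0 m0] /= mt.
  by apply: (IHt (sumn m)) => //; lia.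
have := bloch_okounkov K (mu := k.+2 :: m); rewrite inE negb_or m1 => /(_ isT).
rewrite shift_terms_cons big_allpairs_dep.
rewrite -[iota 0 k.+3]/[:: 0, 1 & iota 2 k.+1]%N 2!big_cons.
set S0 := \sum_(z <- _) _; set S1 := \sum_(z <- _) _; set S2 := \sum_(j <- _) _.
move=> S012; have {S012} : S0 + (S1 + S2) = 0 := S012.
have [f0 qf0 E0] : exists2 f, quasimodular_ratio f & S0 = theta 1 * f.
  apply: theta_sum => -[[J a] nu] /shift_terms_weight /= zm; rewrite add0n.
  case: J zm => [|J] zm.
    by exists 0; [exact: ratio0 | rewrite theta_even // !mulr0 mul0r].
  apply: theta_term; case: J zm => [|J] zm; last by apply: IHw' => /=; lia.
  by apply: (IHt (sumn nu)); lia.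
have [r Er Hr] := shift_terms_head m.
have [f1 qf1 E1] : exists2 f, quasimodular_ratio f &
    S1 = theta 1 * (bracket K (k.+1 :: m) + f).
  rewrite /S1 Er big_cons /= addn0 divr1 rmorph1 mul1r subSS subn0.
  have [f qf ->] : exists2 f, quasimodular_ratio f &
    \sum_(j <- r) fpsC (j.1.2 / 1`!%:R) * theta (1 + j.1.1)
        * bracket K ((k.+1 - 0)%N :: j.2) = theta 1 * f.
    apply: theta_sum => -[[J a] nu] zr; apply: theta_term; apply: IHw' => /=.
    have := Hr _ zr; have := @shift_terms_weight m (J, a, nu).
    by rewrite Er inE zr orbT => /(_ isT) /=; lia.
  by exists f => //; rewrite mulrDr.
have [f2 qf2 E2] : exists2 f, quasimodular_ratio f & S2 = theta 1 * f.
  apply: theta_sum => j; rewrite mem_iota => jk.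
  apply: theta_sum => -[[J a] nu] /shift_terms_weight /= zm.
  by apply: theta_term; apply: IHw' => /=; lia.
rewrite E0 E1 E2 -!mulrDr -[RHS](mulr0 (theta 1)) => /(mulrI (theta1_unit K)) H.
have -> : bracket K (k.+1 :: m) = -1 * f0 + (-1 * f1 + -1 * f2).
  by apply/eqP; rewrite -subr_eq0; apply/eqP; rewrite -[RHS]H; ring.
have q1 : quasimodular (-1 : fps K).
  by apply: quasimodularN; exact: (quasimodular_nat K 1).
by do 2?apply: ratioD; apply: ratioM.
Qed.

(** * Symmetric functions of the contents *)

(** The algebra generated by the functions [Qfun k]. *)
Definition shifted_symmetric (f : seq nat -> K) : Prop :=
  exists l : seq (K * seq nat),
    forall s, f s = \sum_(p <- l) p.1 * \prod_(k <- p.2) Qfun K k s.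

Definition average (f : seq nat -> K) : fps K :=
  Fps (fun n => \sum_(s <- partitions n) f s).

Lemma average_quasimodular f : shifted_symmetric f ->
  quasimodular_ratio (average f).
Proof.
move=> [l fE]; have -> : average f = \sum_(p <- l) fpsC p.1 * bracket K p.2.
  apply: fpsP => n; rewrite fcoef_sum [LHS]/=; under eq_bigr do rewrite fE.
  rewrite exchange_big; apply: eq_bigr => p _.
  by rewrite fcoefCM big_distrr.
apply: ratio_sum => p _; apply: ratioM; first exact: quasimodularC.
exact: bracket_quasimodular.
Qed.

Lemma shifted_symmetric_ext f g : f =1 g ->
  shifted_symmetric f -> shifted_symmetric g.
Proof. by move=> fg [l fE]; exists l => s; rewrite -fg. Qed.

Lemma shifted_symmetricC c : shifted_symmetric (fun=> c).
Proof. by exists [:: (c, [::])] => s; rewrite big_seq1 big_nil mulr1. Qed.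

Lemma shifted_symmetricQ k : shifted_symmetric (Qfun K k).
Proof. by exists [:: (1, [:: k])] => s; rewrite !big_seq1 mul1r. Qed.

Lemma shifted_symmetricD f g : shifted_symmetric f -> shifted_symmetric g ->
  shifted_symmetric (fun s => f s + g s).
Proof. by move=> [l fE] [l' gE]; exists (l ++ l') => s; rewrite big_cat /= fE gE. Qed.

Lemma shifted_symmetricM f g : shifted_symmetric f -> shifted_symmetric g ->
  shifted_symmetric (fun s => f s * g s).
Proof.
move=> [l fE] [l' gE].
exists [seq (p.1 * q.1, p.2 ++ q.2) | p <- l, q <- l'] => s.
rewrite big_allpairs_dep fE gE big_distrl; apply: eq_bigr => p _ /=.
rewrite big_distrr; apply: eq_bigr => q _ /=; rewrite big_cat /=; ring.
Qed.

Lemma shifted_symmetric_sum n (F : 'I_n -> seq nat -> K) :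
    (forall i, shifted_symmetric (F i)) ->
  shifted_symmetric (fun s => \sum_(i < n) F i s).
Proof.
elim: n F => [|n IHn] F HF.
  apply: shifted_symmetric_ext (shifted_symmetricC 0) => s.
  by rewrite big_ord0.
apply: shifted_symmetric_ext (shifted_symmetricD (HF ord0)
  (IHn (fun i => F (lift ord0 i)) _)) => // s.
by rewrite big_ord_recl.
Qed.

(** Here [s] lists the columns, so that contents increase with the column.
    This is the convention of the tableaux below; the opposite one in
    [content_series] only changes signs, as it amounts to transposing the
    partition. *)
Definition contents (s : seq nat) : seq K :=
  [seq i%:R - r%:R | i <- iota 0 (size s), r <- iota 0 (nth 0%N s i)].

Definition content_power_sum (j : nat) (s : seq nat) : K :=
  \sum_(x <- contents s) x ^+ j.

Lemma fcoef_content j s : fcoef (content_series K s) j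
  = (-1) ^+ j / j`!%:R * content_power_sum j s.
Proof.
rewrite /content_power_sum big_allpairs_dep fcoef_sum big_distrr.
rewrite -[X in _ = \sum_(_ <- iota 0 X) _]subn0 big_mkord.
apply: eq_bigr => i _; rewrite fcoef_sum big_distrr /=.
rewrite -[X in \sum_(_ <- iota 0 X) _]subn0 big_mkord.
by apply: eq_bigr => r _; rewrite -(opprB i%:R r%:R) [(- (_ - _)) ^+ j]exprNn mulrAC.
Qed.

(** Dividing [row_series] by [sinh_series] recovers the generating series of
    the power sums of the contents. *)
Lemma content_power_sum_shifted j : shifted_symmetric (content_power_sum j).
Proof.
pose b := (sinh_series K)^-1.
apply: (shifted_symmetric_ext (f := fun s =>
  ((-1) ^+ j * j`!%:R) * \sum_(i < j.+1)
     fcoef b i * (Qfun K (j - i).+2 s + - fcoef b (j - i).+2))).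
  move=> s; have -> : content_power_sum j s
      = (-1) ^+ j * j`!%:R * fcoef (content_series K s) j.
    rewrite fcoef_content mulrA mulrACA -expr2 sqrr_sign mul1r.
    by rewrite divff ?mul1r // pnatr_eq0 -lt0n fact_gt0.
  congr (_ * _); rewrite -[content_series K s](mulKr (sinh_unit K)) fcoefM.
  apply: eq_bigr => i _; congr (_ * _).
  rewrite /Qfun fcoefD addrAC subrr add0r.
  by rewrite expr2 -!mulrA !fcoefMX.
apply: shifted_symmetricM; first exact: shifted_symmetricC.
apply: shifted_symmetric_sum => i; apply: shifted_symmetricM.
  exact: shifted_symmetricC.
by apply: shifted_symmetricD; [exact: shifted_symmetricQ | exact: shifted_symmetricC].
Qed.

Definition geometric (x : K) : fps K := Fps (fun n => x ^+ n).

Definition hsym_series (xs : seq K) : fps K := \prod_(x <- xs) geometric x.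
Definition hsym (r : nat) (xs : seq K) : K := fcoef (hsym_series xs) r.

Lemma qder_geometric x : qder (geometric x) = geometric x * (geometric x - 1).
Proof.
apply: fpsP => n; rewrite fcoefM big_ord_recr subnn -[RHS]/(_ + _).
rewrite [X in _ + _ * X](_ : _ = 0) ?mulr0 ?addr0; last first.
  by rewrite fcoefD fcoefN fcoef1 /= expr0 subrr.
rewrite (eq_bigr (fun=> x ^+ n)) => [|[i ilt] _].
  by rewrite sumr_const card_ord fcoef_qder mulr_natl.
rewrite [nat_of_ord _]/= fcoefD fcoefN fcoef1 subn_eq0 leqNgt ilt subr0 /= -exprD subnKC //.
exact: ltnW.
Qed.

(** Logarithmic differentiation of the product of geometric series. *)
Lemma newton r (xs : seq K) :
  r%:R * hsym r xs = \sum_(i < r) hsym i xs * \sum_(x <- xs) x ^+ (r - i).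
Proof.
have E : qder (hsym_series xs)
    = hsym_series xs * \sum_(x <- xs) (geometric x - 1).
  elim: xs => [|x xs IHxs].
    by rewrite /hsym_series !big_nil qder1 mulr0.
  rewrite /hsym_series !big_cons qderM IHxs qder_geometric -/(hsym_series xs).
  by move: (\sum_(_ <- _) _) => S; ring.
rewrite /hsym -fcoef_qder E fcoefM big_ord_recr subnn -[LHS]/(_ + _).
rewrite [X in _ + _ * X](_ : _ = 0) ?mulr0 ?addr0; last first.
  rewrite fcoef_sum big1 // => x _.
  by rewrite fcoefD fcoefN fcoef1 /= expr0 subrr.
apply: eq_bigr => -[i ir] _; rewrite [nat_of_ord _]/=; congr (_ * _).
rewrite fcoef_sum; apply: eq_bigr => x _.
by rewrite fcoefD fcoefN fcoef1 subn_eq0 leqNgt ir subr0.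
Qed.

Lemma hsym0 xs : hsym 0 xs = 1.
Proof.
rewrite /hsym /hsym_series; elim: xs => [|x xs IHxs]; first by rewrite big_nil fcoef1.
by rewrite big_cons fcoefM0 IHxs mulr1 /= expr0.
Qed.

(** Newton's identities express complete homogeneous symmetric functions
    through power sums. *)
Lemma hsym_contents_shifted r : shifted_symmetric (fun s => hsym r (contents s)).
Proof.
elim/ltn_ind: r => -[|r] IHr.
  by apply: shifted_symmetric_ext (shifted_symmetricC 1) => s; rewrite hsym0.
apply: (shifted_symmetric_ext (f := fun s => r.+1%:R^-1 *
   \sum_(i < r.+1) hsym i (contents s) * content_power_sum (r.+1 - i) s)).
  by move=> s; rewrite -newton mulKf // pnatr_eq0.
apply: shifted_symmetricM; first exact: shifted_symmetricC.
apply: shifted_symmetric_sum => i; apply: shifted_symmetricM; first exact: IHr.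
exact: content_power_sum_shifted.
Qed.

Theorem hsym_contents_quasimodular r :
  quasimodular_ratio (average (fun s => hsym r (contents s))).
Proof. exact/average_quasimodular/hsym_contents_shifted. Qed.

End QuasimodularBrackets.

(** * Group algebras and traces on their centre *)

(** The functions on a finite group, with the convolution product; the name
    protects this type from the pointwise product of functions. *)
Definition galg (K : fieldType) (gT : finGroupType) := {ffun gT -> K}.

Section GroupAlgebra.
Variables (K : fieldType) (gT : finGroupType).
Notation A := (galg K gT).
Implicit Types f g h : A.
Implicit Types x y : gT.

HB.instance Definition _ := GRing.Zmodule.copy A {ffun gT -> K}.

Definition gmul f g : A := [ffun x => \sum_y f y * g (y^-1 * x)%g].
Definition gdelta x : A := [ffun y => (y == x)%:R].

Lemma gmulE f g x : gmul f g x = \sum_y f y * g (y^-1 * x)%g.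
Proof. by rewrite ffunE. Qed.

Lemma gmul_deltal x g y : gmul (gdelta x) g y = g (x^-1 * y)%g.
Proof.
rewrite gmulE (bigD1 x) //= ffunE eqxx mul1r big1 ?addr0 // => z zx.
by rewrite ffunE (negbTE zx) mul0r.
Qed.

Lemma gmul_deltar f x y : gmul f (gdelta x) y = f (y * x^-1)%g.
Proof.
rewrite gmulE (bigD1 (y * x^-1)%g) //= ffunE invMg invgK mulgKV eqxx mulr1.
rewrite big1 ?addr0 // => z zx; rewrite ffunE; case: eqP => [E|]; rewrite ?mulr0 //.
by move: zx; rewrite -E invMg invgK mulKVg eqxx.
Qed.

Fact gmulA : associative gmul.
Proof.
move=> f g h; apply/ffunP => x; rewrite !gmulE.
transitivity (\sum_y \sum_z f y * (g (y^-1 * z)%g * h (z^-1 * x)%g)).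
  apply: eq_bigr => y _; rewrite gmulE big_distrr /=.
  rewrite (reindex_inj (mulgI y^-1%g)) /=; apply: eq_bigr => z _.
  by rewrite invMg invgK -!mulgA mulKVg.
rewrite exchange_big; apply: eq_bigr => z _ /=; rewrite gmulE big_distrl /=.
by apply: eq_bigr => y _; rewrite mulrA.
Qed.

Fact gmul1 : left_id (gdelta 1%g) gmul.
Proof. by move=> f; apply/ffunP => x; rewrite gmul_deltal invg1 mul1g. Qed.

Fact gmulr1 : right_id (gdelta 1%g) gmul.
Proof. by move=> f; apply/ffunP => x; rewrite gmul_deltar invg1 mulg1. Qed.

Fact gmulDl : left_distributive gmul +%R.
Proof.
move=> f g h; apply/ffunP => x; rewrite gmulE [in RHS]ffunE !gmulE -big_split.
by apply: eq_bigr => y _; rewrite ffunE mulrDl.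
Qed.

Fact gmulDr : right_distributive gmul +%R.
Proof.
move=> f g h; apply/ffunP => x; rewrite gmulE [in RHS]ffunE !gmulE -big_split.
by apply: eq_bigr => y _; rewrite ffunE mulrDr.
Qed.

Fact gone_neq0 : gdelta 1%g != 0.
Proof.
by apply/eqP => /ffunP /(_ 1%g); rewrite !ffunE eqxx => /eqP; rewrite oner_eq0.
Qed.

HB.instance Definition _ := GRing.Zmodule_isNzRing.Build A
  gmulA gmul1 gmulr1 gmulDl gmulDr gone_neq0.

Definition gscale (c : K) f : A := [ffun x => c * f x].

Lemma galgME f g x : (f * g) x = \sum_y f y * g (y^-1 * x)%g.
Proof. exact: gmulE. Qed.

Lemma gdelta_l x g y : (gdelta x * g) y = g (x^-1 * y)%g.
Proof. exact: gmul_deltal. Qed.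

Lemma gdelta_r f x y : (f * gdelta x) y = f (y * x^-1)%g.
Proof. exact: gmul_deltar. Qed.

Lemma gdelta1 : gdelta 1%g = 1.
Proof. by []. Qed.

Lemma gdeltaM x y : gdelta (x * y)%g = gdelta x * gdelta y.
Proof.
apply/ffunP => z; rewrite gdelta_r !ffunE; congr (_%:R).
by congr nat_of_bool; apply/eqP/eqP => [->|<-]; rewrite ?mulgK ?mulgKV.
Qed.

Lemma gscaleMl c f g : gscale c f * g = gscale c (f * g).
Proof.
apply/ffunP => x; rewrite galgME ffunE galgME big_distrr.
by apply: eq_bigr => y _ /=; rewrite ffunE mulrA.
Qed.

Lemma gscaleMr c f g : f * gscale c g = gscale c (f * g).
Proof.
apply/ffunP => x; rewrite galgME ffunE galgME big_distrr.
by apply: eq_bigr => y _ /=; rewrite ffunE mulrCA.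
Qed.

Lemma gscale_sum I (r : seq I) (P : pred I) c (F : I -> A) :
  gscale c (\sum_(i <- r | P i) F i) = \sum_(i <- r | P i) gscale c (F i).
Proof.
apply: (big_morph (gscale c)) => [f g|]; apply/ffunP => x;
by rewrite !ffunE ?mulr0 ?mulrDr.
Qed.

Lemma gscale1 f : gscale 1 f = f.
Proof. by apply/ffunP => x; rewrite ffunE mul1r. Qed.

Lemma gscale0 f : gscale 0 f = 0.
Proof. by apply/ffunP => x; rewrite !ffunE mul0r. Qed.

Lemma galg_sumE I (r : seq I) (P : pred I) (F : I -> A) x :
  (\sum_(i <- r | P i) F i) x = \sum_(i <- r | P i) F i x.
Proof. by apply: (big_morph (fun f : A => f x)) => [f g|]; rewrite ffunE. Qed.

Definition central f := forall x, gdelta x * f = f * gdelta x.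

Lemma centralP f : central f -> forall x y, f (x ^ y)%g = f x.
Proof.
move=> cf x y; have /ffunP/(_ (y * (x ^ y))%g) := cf y.
by rewrite gdelta_l gdelta_r mulKg conjgE !mulgA mulgV mul1g mulgK.
Qed.

End GroupAlgebra.

Section ClassTrace.
Variables (K : numFieldType) (gT : finGroupType).
Notation A := (galg K gT).
Notation G := [set: gT].
Notation k := #|classes G|.

Definition class_rep (i : 'I_k) : gT := repr (enum_val i).

Lemma class_repE (i : 'I_k) : enum_val i = (class_rep i ^: G)%g.
Proof. by have /repr_classesP[_] := enum_valP i. Qed.

Lemma class_rep_ex x : exists i y, x = (class_rep i ^ y)%g.
Proof.
have xC : (x ^: G)%g \in classes G by rewrite mem_classes ?inE.
pose i := enum_rank_in xC (x ^: G)%g; exists i.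
have := class_repE i; rewrite enum_rankK_in // => E.
have : x \in (x ^: G)%g by exact: class_refl.
by rewrite E => /imsetP[y _ ->]; exists y.
Qed.

Lemma sum_classes (F : gT -> K) :
  \sum_x F x = \sum_i \sum_(x in (class_rep i ^: G)%g) F x.
Proof.
transitivity (\sum_(x in G) F x); first by apply: eq_bigl => x; rewrite inE.
rewrite (set_partition_big _ (classes_partition [group of G])) big_enum_val /=.
by apply: eq_bigr => i _; rewrite class_repE.
Qed.

Lemma sum_conjg (F : gT -> K) (x : gT) :
  #|(x ^: G)%g|%:R * \sum_y F (x ^ y)%g = #|gT|%:R * \sum_(y in (x ^: G)%g) F y.
Proof.
have -> : \sum_y F (x ^ y)%g = #|'C[x]%g|%:R * \sum_(y in (x ^: G)%g) F y.
  rewrite (partition_big (fun y => x ^ y)%g (mem (x ^: G)%g)) /=; last first.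
    by move=> y _; rewrite memJ_class ?inE.
  rewrite big_distrr; apply: eq_bigr => z /imsetP[y _ ->] /=.
  rewrite (eq_bigr (fun=> F (x ^ y)%g)) => [|u /eqP -> //].
  rewrite sumr_const mulr_natl; congr (_ *+ _).
  rewrite -(card_rcoset 'C[x]%g y); apply: eq_card => u.
  rewrite mem_rcoset [LHS]unfold_in /=.
  apply/eqP/cent1P => [E|/commute_sym/commgP/conjg_fixP E].
    by apply/commute_sym/commgP/conjg_fixP; rewrite conjgM E -conjgM mulgV conjg1.
  by rewrite -[in LHS](mulgKV y u) conjgM E.
rewrite mulrA -natrM; congr (_%:R * _).
rewrite -cardsT -(Lagrange (subsetT 'C[x]%g)) mulnC -index_cent1.
by rewrite setTI.
Qed.

Variable z : A.
Hypothesis cz : central z.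

(** The matrix of the multiplication by the central element [z] on the class
    functions. *)
Definition class_mx : 'M[K]_k :=
  \matrix_(i, j) \sum_(y in (class_rep i ^: G)%g) z (class_rep j * y^-1)%g.

(** The left side sums the values of [z] over all commutators: averaging over
    [y] turns the conjugates of [x] into a sum over its class, and what
    remains is a diagonal entry. *)
Lemma trace_class_mx :
  \sum_x \sum_y z (x ^ y * x^-1)%g = #|gT|%:R * \tr class_mx.
Proof.
have n0 (i : 'I_k) : #|(class_rep i ^: G)%g|%:R != 0 :> K.
  rewrite pnatr_eq0 -lt0n; apply/card_gt0P; exists (class_rep i).
  exact: class_refl.
rewrite sum_classes /mxtrace big_distrr; apply: eq_bigr => i _ /=.
apply: (mulfI (n0 i)).
transitivity (\sum_(x in (class_rep i ^: G)%g)
    #|gT|%:R * \sum_(y in (class_rep i ^: G)%g) z (y * x^-1)%g).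
  rewrite big_distrr; apply: eq_bigr => x xC /=.
  rewrite -(class_eqP xC); exact: (sum_conjg (fun y => z (y * x^-1)%g)).
rewrite -big_distrr mulrCA; congr (_ * _); rewrite exchange_big mxE /=.
have -> : #|(class_rep i ^: G)%g|%:R
    = \sum_(x in (class_rep i ^: G)%g) 1 :> K by rewrite sumr_const.
rewrite big_distrl; apply: eq_bigr => x /imsetP[u _ ->] /=; rewrite mul1r.
rewrite (reindex_inj (conjg_inj u)) /=.
apply: eq_big => [y|y _].
  by rewrite memJ_norm // (subsetP (class_norm _ _)) ?inE.
by rewrite -conjVg -conjMg centralP.
Qed.

(** At least [k] independent eigenvectors in a space of dimension [k] form an
    eigenbasis. *)
Lemma trace_eigenbasis p (u : 'I_p -> A) (h : 'I_p -> K) :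
    (forall i, central (u i)) -> (forall i, z * u i = gscale (h i) (u i)) ->
    row_free (\matrix_(i, j) u i (class_rep j)) -> (k <= p)%N ->
  \tr class_mx = \sum_i h i.
Proof.
move=> cu zu; set U := \matrix_(i, j) _ => freeU kp.
have rU : \rank U = p by apply/eqP.
have fullU : row_full U by rewrite /row_full eqn_leq rank_leq_col rU.
have UM : U *m class_mx = diag_mx (\row_i h i) *m U.
  apply/matrixP => s j; rewrite mul_diag_mx !mxE.
  transitivity ((z * u s) (class_rep j)); last by rewrite zu ffunE.
  rewrite galgME.
  have -> : \sum_y z y * u s (y^-1 * class_rep j)%g
      = \sum_y u s y * z (class_rep j * y^-1)%g.
    have inj : injective (fun y => class_rep j * y^-1)%g.
      by move=> x y /mulgI /invg_inj.
    rewrite (reindex_inj inj) /=; apply: eq_bigr => y _.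
    by rewrite invMg invgK mulgKV mulrC.
  rewrite sum_classes; apply: eq_bigr => i _; rewrite !mxE big_distrr /=.
  by apply: eq_bigr => y /imsetP[x _ ->]; rewrite centralP.
rewrite -[class_mx]mul1mx -(mulVpmx fullU) -mulmxA UM mxtrace_mulC -mulmxA.
by rewrite mulmxVp // mulmx1 mxtrace_diag; apply: eq_bigr => i _; rewrite mxE.
Qed.

End ClassTrace.

(** In a vanishing combination, the operator [z r - h r s] kills the [s]-th
    eigenvector and multiplies the [t]-th by a nonzero factor if [r] separates
    [s] from [t]; killing all of them but the [t]-th shows that its
    coefficient vanishes. *)
Lemma eigen_row_free (K : numFieldType) (gT : finGroupType) p
    (z : nat -> galg K gT) (u : 'I_p -> galg K gT) (h : nat -> 'I_p -> K) :
    (forall i, central (u i)) ->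
    (forall r i, z r * u i = gscale (h r i) (u i)) ->
    (forall i j, i != j -> exists r, h r i != h r j) ->
    (forall i, u i 1%g != 0) ->
  row_free (\matrix_(i, j) u i (class_rep j)).
Proof.
move=> cu zu hij u1; apply/inj_row_free => a aU.
have a0 : \sum_i gscale (a 0 i) (u i) = 0.
  apply/ffunP => x; rewrite galg_sumE ffunE.
  have [j [y ->]] := class_rep_ex x.
  have /rowP/(_ j) := aU; rewrite !mxE => E; rewrite -[RHS]E.
  by apply: eq_bigr => i _; rewrite ffunE mxE centralP.
apply/rowP => t; rewrite mxE.
(* The eigenvectors other than the [t]-th are killed one after the other. *)
have [b [c [c0 bt bsum bl]]] : exists b c, [/\ c != 0, b t = c * a 0 t,
    \sum_i gscale (b i) (u i) = 0 & {in rem t (enum 'I_p), forall i, b i = 0}].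
  have : t \notin rem t (enum 'I_p) by rewrite mem_rem_uniq ?enum_uniq // inE eqxx.
  elim: (rem t _) => [|s l IHl].
    by exists (a 0), 1; split; rewrite ?oner_eq0 ?mul1r.
  rewrite inE negb_or => /andP[ts /IHl [b [c [c0 bt bsum bl]]]].
  have [r hr] := hij _ _ ts.
  exists (fun i => b i * (h r i - h r s)), (c * (h r t - h r s)); split.
  - by rewrite mulf_neq0 // subr_eq0.
  - by rewrite bt mulrAC.
  - have E : z r * (\sum_i gscale (b i) (u i))
        - gscale (h r s) (\sum_i gscale (b i) (u i)) = 0.
      by rewrite bsum mulr0 sub0r; apply/ffunP => x; rewrite !ffunE mulr0 oppr0.
    rewrite -[RHS]E mulr_sumr gscale_sum -sumrB; apply: eq_bigr => i _.
    rewrite gscaleMr zu; apply/ffunP => x; rewrite !ffunE; ring.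
  - move=> i; rewrite inE => /orP[/eqP->|/bl ->]; last by rewrite mul0r.
    by rewrite subrr mulr0.
have /ffunP/(_ 1%g) := bsum; rewrite galg_sumE ffunE (bigD1 t) //= big1 ?addr0.
  rewrite ffunE bt => /eqP; rewrite !mulf_eq0 (negbTE c0) (negbTE (u1 t)) orbF.
  by move/eqP.
by move=> i it; rewrite bl ?gscale0 ?ffunE // mem_rem_uniq ?enum_uniq // inE it mem_enum.
Qed.

(** * Jucys-Murphy elements *)

Section Words.
Variable d : nat.
Notation letter := ('I_d * 'I_d)%type.

Definition letter_le : rel letter := fun p q => (p.2 <= q.2)%N.

Lemma letter_le_trans : transitive letter_le.
Proof. by move=> p q r; apply: leq_trans. Qed.

Lemma letter_le_total : total letter_le.
Proof. by move=> p q; apply: leq_total. Qed.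

(** A letter [(k, l)] with [k < l] stands for the transposition of [k] and
    [l]. The bound [m] confines a word to the first [m] points and allows
    inductions on [m]. *)
Definition word_ok (m : nat) (w : seq letter) : bool :=
  sorted letter_le w && all (fun p : letter => (p.1 < p.2) && (p.2 < m))%N w.

Definition words (m r : nat) : seq (seq letter) :=
  [seq w <- [seq val t | t <- enum {: r.-tuple letter}] | word_ok m w].

Lemma mem_words m r w : (w \in words m r) = (size w == r) && word_ok m w.
Proof.
rewrite mem_filter andbC; congr (_ && _).
apply/mapP/eqP => [[t _ ->]|wr]; first by rewrite size_tuple.
by exists (Tuple (introT eqP wr)); rewrite ?mem_enum.
Qed.

Lemma words_uniq m r : uniq (words m r).
Proof. by apply: filter_uniq; rewrite map_inj_uniq ?enum_uniq //; apply: val_inj. Qed.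

Lemma word_ok_rcons m (i : 'I_d) w k : i = m :> nat ->
  word_ok m.+1 (rcons w (k, i)) = word_ok m.+1 w && (k < i)%N.
Proof.
move=> im; rewrite /word_ok !(sorted_pairwise letter_le_trans) pairwise_rcons.
rewrite all_rcons /= im ltnSn andbT.
case: (boolP (all (fun p : letter => _ && (p.2 < m.+1))%N w)) => [wm|]; last by rewrite !andbF.
have -> : all (letter_le^~ (k, i)) w.
  by apply: sub_all wm => p /andP[_]; rewrite ltnS /letter_le /= im.
by rewrite !andbT.
Qed.

(** Since [l] increases weakly along a word, the largest point is moved either
    by no letter or by the last one. *)
Lemma sum_words_rec (V : nmodType) (F : seq letter -> V) m (i : 'I_d) r :
    i = m :> nat ->
  \sum_(w <- words m.+1 r.+1) F w
  = \sum_(w <- words m r.+1) F w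
    + \sum_(w <- words m.+1 r) \sum_(k < d | (k < i)%N) F (rcons w (k, i)).
Proof.
move=> im; rewrite (bigID (fun w => all (fun p : letter => p.2 < m)%N w)) /=.
congr (_ + _).
  rewrite -big_filter; apply: perm_big; apply: uniq_perm.
  - exact/filter_uniq/words_uniq.
  - exact: words_uniq.
  move=> w; rewrite (mem_filter _ _ (words _ _)) !mem_words /word_ok.
  apply/andP/and3P => [[wm /and3P[-> -> w1]]|[-> -> wm]]; split=> //.
    apply/allP => p pw; move/allP/(_ _ pw): wm => /= ->.
    by move/allP/(_ _ pw): w1 => /andP[->].
    by apply: sub_all wm => p /andP[].
  by rewrite /=; apply: sub_all wm => p /andP[-> /ltnW].
rewrite -big_filter.
transitivity (\sum_(wk <- [seq (w, k) | w <- words m.+1 r,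
    k <- [seq k : 'I_d <- index_enum 'I_d | (k < i)%N]]) F (rcons wk.1 (wk.2, i))); last first.
  by rewrite big_allpairs_dep /=; apply: eq_bigr => w _; rewrite big_filter.
apply: (@big_seq_bij _ _ _ _ _ _ _ (fun wk : seq letter * 'I_d => rcons wk.1 (wk.2, i))
  (fun w => (take r w, (nth (i, i) w r).1))).
- apply: allpairs_uniq_dep; first exact: words_uniq.
    by move=> *; apply/filter_uniq/index_enum_uniq.
  by move=> [? ?] [? ?] _ _ /= [-> ->].
- exact/filter_uniq/words_uniq.
- move=> _ /allpairsPdep[w [k [+ + ->]]] /=.
  rewrite mem_words mem_filter mem_index_enum andbT => /andP[/eqP wr wok] ki.
  split; last by rewrite -cats1 take_cat nth_cat wr ltnn subnn /= cats0.
  rewrite (mem_filter _ _ (words _ _)) mem_words size_rcons wr eqxx /=.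
  by rewrite word_ok_rcons // wok ki all_rcons /= im ltnn.
move=> w; rewrite (mem_filter _ _ (words _ _)) mem_words.
case/andP=> wm /andP[/eqP wr wok].
have Ew : w = rcons (take r w) (nth (i, i) w r).
  by rewrite -take_nth ?wr // -wr take_size.
case: (nth _ w r) Ew => k l Ew /=.
suff El : l = i.
  rewrite El in Ew *; split=> //; apply/allpairsPdep.
  exists (take r w), k; rewrite mem_words mem_filter mem_index_enum size_take wr ltnSn eqxx.
  by rewrite Ew word_ok_rcons // in wok; case/andP: wok => -> ->.
move: wok; rewrite Ew /word_ok (sorted_pairwise letter_le_trans) pairwise_rcons all_rcons /=.
case/andP=> /andP[/allP wl _] /andP[/andP[_ lm] _].
apply/val_inj/eqP; rewrite /= im eqn_leq -ltnS lm leqNgt; apply: contra wm => lm'.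
rewrite Ew all_rcons lm'; apply/allP => p /wl; rewrite /letter_le /= => h.
exact: leq_ltn_trans h lm'.
Qed.

Lemma words0 m : words m 0 = [:: [::]].
Proof.
apply: perm_small_eq => //; apply: uniq_perm => //; first exact: words_uniq.
by move=> w; rewrite mem_words inE size_eq0 andb_idr // => /eqP ->.
Qed.

Lemma words_bound0 r : words 0 r.+1 = [::].
Proof.
apply: perm_small_eq => //; apply: uniq_perm => //; first exact: words_uniq.
move=> w; rewrite mem_words in_nil /word_ok; case: w => [|p w] //=.
by rewrite andbF /= !andbF.
Qed.

Definition word_perm (w : seq letter) : 'S_d := (\prod_(p <- w) tperm p.1 p.2)%g.

Lemma word_perm_rcons w p : word_perm (rcons w p) = (word_perm w * tperm p.1 p.2)%g.
Proof. by rewrite /word_perm -cats1 big_cat big_seq1. Qed.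

End Words.

Section JucysMurphy.
Variables (K : numFieldType) (d : nat).
Notation A := (galg K 'S_d).
Notation delta := (@gdelta K 'S_d).

Definition jucys_murphy (i : 'I_d) : A :=
  \sum_(k < d | (k < i)%N) delta (tperm k i).

(** A monotone word is a term in the expansion of a monomial in the
    Jucys-Murphy elements, so this is the complete homogeneous symmetric
    function of degree [r] of the first [m] of them. *)
Definition jm_hsym (m r : nat) : A := \sum_(w <- words d m r) delta (word_perm w).

Lemma jm_hsym_rec m (i : 'I_d) r : i = m :> nat ->
  jm_hsym m.+1 r.+1 = jm_hsym m r.+1 + jm_hsym m.+1 r * jucys_murphy i.
Proof.
move=> im; rewrite /jm_hsym (sum_words_rec _ _ im); congr (_ + _).
rewrite mulr_suml; apply: eq_bigr => w _; rewrite mulr_sumr.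
by apply: eq_bigr => k _; rewrite word_perm_rcons gdeltaM.
Qed.

Lemma jm_hsym_r0 m : jm_hsym m 0 = 1.
Proof. by rewrite /jm_hsym words0 big_seq1 /word_perm big_nil. Qed.

Lemma jm_hsym_m0 r : jm_hsym 0 r.+1 = 0.
Proof. by rewrite /jm_hsym words_bound0 big_nil. Qed.

Lemma comm_jucys_murphy (x : 'S_d) (i : 'I_d) :
    x i = i -> (forall k : 'I_d, (k < i)%N -> (x k < i)%N) ->
  delta x * jucys_murphy i = jucys_murphy i * delta x.
Proof.
move=> xi xlt; rewrite mulr_sumr mulr_suml.
have xlt' (k : 'I_d) : (x k < i)%N = (k < i)%N.
  apply/idP/idP => [|/xlt //]; apply: contraTT => ki.
  have xS : x @: [set k : 'I_d | (k < i)%N] = [set k : 'I_d | (k < i)%N].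
    apply/eqP; rewrite eqEcard card_imset ?leqnn ?andbT; last exact: perm_inj.
    by apply/subsetP => _ /imsetP[j + ->]; rewrite !inE => /xlt.
  apply/negP => xk; have : x k \in [set k : 'I_d | (k < i)%N] by rewrite inE.
  rewrite -xS => /imsetP[j + /perm_inj E]; rewrite inE -E.
  by rewrite (negbTE ki).
rewrite [LHS](reindex_inj (@perm_inj _ x)) /=.
apply: eq_big => [k|k _]; first exact: xlt'.
rewrite -!gdeltaM; congr delta.
have := tpermJ k i x; rewrite xi => <-.
by rewrite conjgE !mulgA mulgV mul1g.
Qed.

Lemma adjacent_jm (i j : 'I_d) : j = i.+1 :> nat ->
  delta (tperm i j) * jucys_murphy i * delta (tperm i j)
  = jucys_murphy j - delta (tperm i j).
Proof.
move=> ij; rewrite {2}/jucys_murphy (bigD1 i) /=; last by rewrite ij.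
rewrite addrAC subrr add0r mulr_sumr mulr_suml; apply: eq_big => [k|k ki].
  have -> : (k < j)%N = (k <= i)%N by rewrite ij.
  by rewrite ltn_neqAle andbC.
rewrite -!gdeltaM; congr delta.
rewrite -{1}(tpermV i j) -mulgA -conjgE tpermJ tpermL.
rewrite tpermD //; apply/eqP => E; move: ki; rewrite -E ?ltnn //.
by rewrite ij ltnNge leqnSn.
Qed.

End JucysMurphy.

Section Central.
Variables (K : numFieldType) (d : nat).
Notation delta := (@gdelta K 'S_d).
Notation H := (@jm_hsym K d).
Notation J := (@jucys_murphy K d).
Notation comm := (@GRing.comm (galg K 'S_d)).

Lemma comm_jm_hsym x m r : (m <= d)%N ->
  (forall i : 'I_d, (i < m)%N -> comm x (J i)) -> comm x (H m r).
Proof.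
elim: m r => [|m IHm] r md xJ.
  case: r => [|r]; first by rewrite jm_hsym_r0; apply: commr1.
  by rewrite jm_hsym_m0; apply: commr0.
elim: r => [|r IHr]; first by rewrite jm_hsym_r0; apply: commr1.
rewrite (@jm_hsym_rec K d m (Ordinal md)) //; apply: commrD.
  by apply: IHm => [|i im]; [exact: ltnW | exact/xJ/ltnW].
by apply: commrM => //; apply: xJ.
Qed.

Lemma comm_tperm_jm (i j l : 'I_d) : (i < l)%N -> (j < l)%N ->
  comm (delta (tperm i j)) (J l).
Proof.
move=> il jl; apply: comm_jucys_murphy => [|k kl].
  by rewrite tpermD // -val_eqE /= ltn_eqF.
by case: tpermP.
Qed.

Lemma comm_jm (i j : 'I_d) : comm (J i) (J j).
Proof.
wlog ij : i j / (i < j)%N => [H|].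
  have [/H//|ji|/val_inj -> //] := ltngtP i j.
  exact/commr_sym/H.
apply: commr_sym; apply: commr_sum => k ki; apply: commr_sym.
by apply: comm_tperm_jm => //; apply: ltn_trans ij.
Qed.

(** Isolating the last two variables [a] and [b], this function depends on
    them through [a + b] and [b * a] only. *)
Lemma jm_hsym_two_steps (i j : 'I_d) r : j = i.+1 :> nat ->
  H j.+1 r.+2 = H i r.+2 + H j.+1 r.+1 * (J i + J j) - H j.+1 r * (J j * J i).
Proof.
move=> ij; have Ej := @jm_hsym_rec K d j j.
have Ei r' : H j r'.+1 = H i r'.+1 + H j r' * J i.
  by rewrite ij (@jm_hsym_rec K d i i).
rewrite Ej // Ei.
have -> : H j r.+1 = H j.+1 r.+1 - H j.+1 r * J j by rewrite Ej // addrK.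
rewrite mulrBl mulrDr mulrA -!addrA; congr (_ + _).
by rewrite addrCA [RHS]addrA [RHS]addrC; congr (_ + _); rewrite addrC.
Qed.

(** With [s] the adjacent transposition and [a], [b] the corresponding
    Jucys-Murphy elements, [s * a * s = b - s] implies that [s] commutes with
    [a + b] and with [b * a], and hence with their symmetric functions. *)
Lemma comm_adjacent_hsym (i j : 'I_d) r : j = i.+1 :> nat ->
  comm (delta (tperm i j)) (H j.+1 r).
Proof.
move=> ij; set s := delta _.
have ss : s * s = 1 by rewrite -gdeltaM tperm2 gdelta1.
have sas := adjacent_jm K ij; rewrite -/s in sas.
have sa : s * J i = J j * s - 1.
  by rewrite -[LHS]mulr1 -ss mulrA sas mulrBl ss.
have as_ : J i * s = s * J j - 1.
  by rewrite -[LHS]mul1r -ss -mulrA [s * (J i * s)]mulrA sas mulrBr ss.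
have sb : s * J j = J i * s + 1 by rewrite as_ subrK.
have bs : J j * s = s * J i + 1 by rewrite sa subrK.
have sD : comm s (J i + J j).
  by rewrite /comm mulrDr mulrDl sb bs addrA [RHS]addrCA addrA.
have sM : comm s (J j * J i).
  rewrite /comm mulrA sb mulrDl mul1r -mulrA sa mulrBr mulr1 subrK.
  by rewrite mulrA (comm_jm i j).
have sH0 r' : comm s (H i r').
  apply: comm_jm_hsym => [|k ki]; first exact: ltnW.
  apply: comm_jucys_murphy => [|l lk]; rewrite tpermD // -val_eqE /= gtn_eqF //.
  - by rewrite ij ltnS ltnW.
  - exact: ltn_trans lk ki.
  - by rewrite ij ltnS ltnW // (ltn_trans lk).
have Ei r' : H j r'.+1 = H i r'.+1 + H j r' * J i.
  by rewrite ij (@jm_hsym_rec K d i i).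
elim/ltn_ind: r => -[|[|r]] IHr.
- by rewrite jm_hsym_r0; apply: commr1.
- rewrite (@jm_hsym_rec K d j j) // Ei !jm_hsym_r0 !mul1r -addrA.
  exact: commrD.
rewrite (jm_hsym_two_steps r ij); apply: commrB; last by apply: commrM => //; apply: IHr.
by apply: commrD => //; apply: commrM => //; apply: IHr.
Qed.

(** A transposition is a product of conjugates of adjacent ones by induction
    on the larger of the two points. *)
Lemma comm_tperm_hsym m r (i j : 'I_d) : (m <= d)%N -> (i < j)%N -> (j < m)%N ->
  comm (delta (tperm i j)) (H m r).
Proof.
elim: m r i j => // m IHm r i j md ij; rewrite ltnS leq_eqVlt => /orP[/eqP jm|jm].
  rewrite -jm; have [ij1|] := eqVneq (j : nat) i.+1; first exact: comm_adjacent_hsym.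
  rewrite neq_ltn ltnS leqNgt ij /= => ij1.
  have p_lt : (j.-1 < d)%N by apply: leq_ltn_trans (leq_pred _) (ltn_ord j).
  pose p := Ordinal p_lt; have jp : j = p.+1 :> nat.
    by rewrite /= prednK // (leq_ltn_trans (leq0n i) ij).
  have -> : tperm i j = (tperm p j * tperm i p * tperm p j)%g.
    rewrite -{1}(tpermV p j) -mulgA -conjgE tpermJ tpermL tpermD //.
      by rewrite -val_eqE /= gtn_eqF // -ltnS -jp.
    by rewrite -val_eqE /= gtn_eqF.
  rewrite !gdeltaM; have sH := comm_adjacent_hsym r jp.
  have ipH : comm (delta (tperm i p)) (H j.+1 r).
    elim: r {sH} => [|r IHr]; first by rewrite jm_hsym_r0; apply: commr1.
    rewrite (@jm_hsym_rec K d j j) //; apply: commrD.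
      rewrite jm; apply: IHm; first exact: ltnW.
        by rewrite -ltnS -jp.
      by rewrite -jm jp.
    apply: commrM => //; apply: comm_tperm_jm => //.
    by rewrite jp.
  by apply/commr_sym/commrM; [apply: commrM|]; apply: commr_sym.
elim: r => [|r IHr]; first by rewrite jm_hsym_r0; apply: commr1.
rewrite (@jm_hsym_rec K d m (Ordinal md)) //; apply: commrD.
  by apply: IHm => //; apply: ltnW.
by apply: commrM => //; apply: comm_tperm_jm => //=; apply: ltn_trans jm.
Qed.

(** Transpositions generate the symmetric group. *)
Theorem jm_hsym_central r : central (H d r).
Proof.
move=> x; have [ts -> _] := prod_tpermP x.
elim: ts => [|[i j] ts IHts]; first by rewrite big_nil; apply: commr_sym; apply: commr1.
rewrite big_cons gdeltaM; apply: commr_sym; apply: commrM; apply: commr_sym => //=.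
have [ij|ji|/val_inj ->] := ltngtP i j.
- exact: comm_tperm_hsym.
- by rewrite tpermC; apply: comm_tperm_hsym.
- by rewrite tperm1 gdelta1; apply: commr_sym; apply: commr1.
Qed.

End Central.

(** * Specht vectors *)

Section Vandermonde.
Variable K : fieldType.

Definition powers_mx h (f : nat -> K) : 'M[K]_h := \matrix_(i, j) f j ^+ i.

Lemma det_powers_update h (f f' : nat -> K) (r : 'I_h) :
    (forall j : 'I_h, j != r -> f' j = f j) ->
  \det (powers_mx h f') = \sum_(a < h) f' r ^+ a * cofactor (powers_mx h f) a r.
Proof.
move=> ff'; rewrite (expand_det_col _ r); apply: eq_bigr => a _.
rewrite mxE; congr (_ * (_ * \det _)); apply/matrixP => i j; rewrite !mxE.
by rewrite ff' // eq_sym neq_lift.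
Qed.

Lemma det_powers_swap h (f : nat -> K) (i r : 'I_h) : i != r ->
  \det (powers_mx h (fun j => f (if j == i then nat_of_ord r
                                 else if j == r then nat_of_ord i else j)))
  = - \det (powers_mx h f).
Proof.
move=> ir; set A := powers_mx h _.
have -> : A = col_perm (tperm i r) (powers_mx h f).
  apply/matrixP => a j; rewrite !mxE; congr (f _ ^+ a).
  case: tpermP => [->|->|/eqP ji /eqP jr]; rewrite ?eqxx //.
    by case: eqP => // /val_inj E; rewrite E eqxx in ir.
  by rewrite -val_eqE in ji; rewrite -val_eqE in jr; rewrite (negbTE ji) (negbTE jr).
rewrite col_permE det_mulmx det_perm odd_permV odd_tperm ir mulrN1 //.
Qed.

(** A Plucker relation between Vandermonde matrices: expanding both
    determinants along the column that changes and summing over [i] makes the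
    product of the first matrix with its adjugate appear. *)
Lemma garnir_det h h' (f f' : nat -> K) (r : 'I_h) : (h <= h')%N ->
  \sum_(i < h') \det (powers_mx h' (fun j => if j == i then f r else f' j))
     * \det (powers_mx h (fun j => if j == r then f' i else f j))
  = \det (powers_mx h' f') * \det (powers_mx h f).
Proof.
move=> hh'; pose A := powers_mx h' f'; pose B := powers_mx h f.
transitivity (\sum_(b < h) cofactor B b r * \sum_(a < h') f r ^+ a
    * \sum_(i < h') A (widen_ord hh' b) i * \adj A i a).
  under eq_bigr => i _.
    rewrite (@det_powers_update h' f' _ i) => [|j]; last first.
      by rewrite -val_eqE => /negbTE ->.
    rewrite (@det_powers_update h f _ r) => [|j]; last first.
      by rewrite -val_eqE => /negbTE ->.
    rewrite !eqxx big_distrlr /= exchange_big; over.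
  rewrite exchange_big; apply: eq_bigr => b _ /=.
  rewrite exchange_big big_distrr; apply: eq_bigr => a _ /=.
  rewrite !big_distrr; apply: eq_bigr => i _ /=; rewrite !mxE -/A -/B; ring.
rewrite (@det_powers_update h f f r) // big_distrr; apply: eq_bigr => b _ /=.
rewrite (bigD1 (widen_ord hh' b)) //= [X in _ * (_ + X)]big1 ?addr0 => [|a ab].
  have /matrixP/(_ (widen_ord hh' b) (widen_ord hh' b)) E := mul_mx_adj A.
  rewrite [LHS]mxE [RHS]mxE eqxx mulr1n in E.
  by rewrite E -/B; ring.
have /matrixP/(_ (widen_ord hh' b) a) E := mul_mx_adj A.
rewrite [LHS]mxE [RHS]mxE eq_sym (negbTE ab) mulr0n in E.
by rewrite E mulr0.
Qed.

End Vandermonde.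

Section Specht.
Variables (K : numFieldType) (s : seq nat).
Hypothesis ss : sorted geq s.

Notation height c := (nth 0%N s c).
Definition col_start (c : nat) : nat := sumn (take c s).

Definition column_det (y : nat -> K) (c : nat) : K :=
  \det (powers_mx (height c) (fun j => y (col_start c + j)%N)).

(** The Specht polynomial of the tableau whose columns have heights [s] and
    are filled consecutively, evaluated at [y]. *)
Definition specht (y : nat -> K) : K := \prod_(c < size s) column_det y c.

Definition nat_swap (k m t : nat) : nat :=
  if t == k then m else if t == m then k else t.

Lemma col_startS c : (c < size s)%N -> col_start c.+1 = (col_start c + height c)%N.
Proof. by move=> cs; rewrite /col_start (take_nth 0%N) // sumn_rcons. Qed.

Lemma col_start_lt c c' : (c < c')%N -> (c' <= size s)%N ->
  (col_start c + height c <= col_start c')%N.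
Proof.
elim: c' => // c' IHc'; rewrite ltnS leq_eqVlt => /orP[/eqP->|cc'] c's.
  by rewrite col_startS.
rewrite col_startS //; apply: leq_trans (leq_addr _ _).
exact: IHc' (ltnW c's).
Qed.

Lemma height_mono c c' : (c <= c')%N -> (height c' <= height c)%N.
Proof.
move/subnKC <-; elim: (c' - c)%N => [|i IHi]; first by rewrite addn0.
by rewrite addnS; apply: leq_trans IHi; apply: nth_partition.
Qed.

Lemma col_disjoint c c' i j : (c < size s)%N -> (c' < size s)%N -> c != c' ->
  (i < height c)%N -> (j < height c')%N ->
  (col_start c + i == col_start c' + j)%N = false.
Proof.
move=> cs c's; rewrite neq_ltn => /orP[cc'|cc'] ih jh; apply/negbTE; rewrite neq_ltn.
  by have := col_start_lt cc' (ltnW c's); move: (col_start _) (col_start _); lia.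
by have := col_start_lt cc' (ltnW cs); move: (col_start _) (col_start _); lia.
Qed.

Lemma column_det_swap_out y k m c :
    (forall j, (j < height c)%N -> (col_start c + j != k)%N && (col_start c + j != m)%N) ->
  column_det (y \o nat_swap k m) c = column_det y c.
Proof.
move=> H; congr (\det _); apply/matrixP => a j; rewrite !mxE /= /nat_swap.
by have /andP[/negbTE-> /negbTE->] := H j (ltn_ord j).
Qed.

Lemma specht_swap_same y c i r : (c < size s)%N ->
    (i < r)%N -> (r < height c)%N ->
  specht (y \o nat_swap (col_start c + i) (col_start c + r)) = - specht y.
Proof.
move=> cs ir rh; have ih := ltn_trans ir rh.
rewrite /specht (bigD1 (Ordinal cs)) //= [in RHS](bigD1 (Ordinal cs)) //= -mulNr.
congr (_ * _); last first.
  apply: eq_bigr => c' c'c; apply: column_det_swap_out => j jh.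
  by rewrite !col_disjoint.
rewrite /column_det -(@det_powers_swap _ _ _ (Ordinal ih) (Ordinal rh)); last first.
  by rewrite -val_eqE /= ltn_eqF.
congr (\det _); apply/matrixP => a j; rewrite !mxE /= /nat_swap !eqn_add2l.
by do 2?case: eqP => //.
Qed.

(** Exchanging a fixed entry of one column with each entry of an earlier,
    hence at least as long, column: a Garnir relation. *)
Lemma specht_garnir y c c' r : (c' < c)%N -> (c < size s)%N -> (r < height c)%N ->
  \sum_(i < height c')
     specht (y \o nat_swap (col_start c' + i) (col_start c + r)) = specht y.
Proof.
move=> c'c cs rh; have c's := ltn_trans c'c cs.
have c'nc : c' != c by rewrite ltn_eqF.
pose D := \prod_(b < size s | (b != Ordinal c's) && (b != Ordinal cs)) column_det y b.
have split_specht (z : nat -> K) : specht z = column_det z c' * column_det z c *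
    \prod_(b < size s | (b != Ordinal c's) && (b != Ordinal cs)) column_det z b.
  rewrite /specht (bigD1 (Ordinal c's)) //= (bigD1 (Ordinal cs)) /= ?mulrA //.
  by rewrite -val_eqE /= eq_sym.
rewrite [RHS]split_specht -/D /column_det.
rewrite -(garnir_det _ (fun j => y (col_start c' + j)%N) (Ordinal rh)
  (height_mono (ltnW c'c))) big_distrl /=.
apply: eq_bigr => i _; rewrite split_specht; congr (_ * _ * _).
- congr (\det _); apply/matrixP => a j; rewrite !mxE /= /nat_swap eqn_add2l.
  by case: eqP => // _; rewrite col_disjoint.
- congr (\det _); apply/matrixP => a j; rewrite !mxE /= /nat_swap eqn_add2l.
  by rewrite col_disjoint 1?eq_sym //; case: ifP.
apply: eq_bigr => b /andP[bc' bc]; apply: column_det_swap_out => j jh.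
by rewrite !col_disjoint.
Qed.

Lemma sum_before (V : nmodType) (F : nat -> V) c r : (c < size s)%N ->
  \sum_(k < col_start c + r) F k
  = \sum_(c' < c) \sum_(i < height c') F (col_start c' + i)%N
    + \sum_(i < r) F (col_start c + i)%N.
Proof.
move=> cs; rewrite big_split_ord /=; congr (_ + _).
elim: c cs => [|c IHc] cs; first by rewrite /col_start take0 !big_ord0.
rewrite col_startS ?(ltnW cs) // big_split_ord /= IHc ?(ltnW cs) //.
by rewrite [in RHS]big_ord_recr.
Qed.

(** The content of the cell [(c, r)] arises as [c] Garnir relations, one for
    each earlier column, and [r] sign changes within the column. *)
Lemma specht_jm y c r : (c < size s)%N -> (r < height c)%N ->
  \sum_(k < col_start c + r) specht (y \o nat_swap k (col_start c + r))
  = (c%:R - r%:R) * specht y.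
Proof.
move=> cs rh; rewrite (sum_before (fun k => specht (y \o nat_swap k _))) //.
rewrite (eq_bigr (fun=> specht y)); last by move=> c' _; apply: specht_garnir.
rewrite [X in _ + X](eq_bigr (fun=> - specht y)); last first.
  by move=> i _; apply: specht_swap_same.
by rewrite !sumr_const !card_ord mulrBl !mulr_natl mulNrn.
Qed.

Definition content_columns : seq (seq K) :=
  [seq [seq i%:R - r%:R | r <- iota 0 (height i)] | i <- iota 0 (size s)].

Lemma shape_content_columns : shape content_columns = s.
Proof.
rewrite /shape -map_comp -[RHS](mkseq_nth 0%N s) /mkseq; apply: eq_map => i /=.
by rewrite size_map size_iota.
Qed.

Definition content (m : nat) : K := nth 0 (contents K s) m.

(** The list of contents is read column by column, in the order in which the
    tableau is filled. *)
Lemma cell_of m : (m < sumn s)%N ->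
  exists c r, [/\ (c < size s)%N, (r < height c)%N, m = (col_start c + r)%N
    & content m = c%:R - r%:R].
Proof.
move=> ms; exists (reshape_index s m), (reshape_offset s m).
have c_lt := reshape_indexP ms; have r_lt := reshape_offsetP ms.
have Em := esym (reshape_indexK s m); split=> //.
rewrite /content -[contents K s]/(flatten content_columns) nth_flatten.
rewrite shape_content_columns.
rewrite (nth_map 0%N) ?size_iota // nth_iota // add0n.
by rewrite (nth_map 0%N) ?size_iota // nth_iota.
Qed.

Lemma size_contents : size (contents K s) = sumn s.
Proof.
by rewrite -[contents K s]/(flatten content_columns) size_flatten shape_content_columns.
Qed.

End Specht.

Section SpechtVector.
Variables (K : numFieldType) (d : nat).
Notation A := (galg K 'S_d).

(** The default value 0 is harmless: only the positions below [d] occur in a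
    tableau with [d] cells. *)
Definition perm_values (x : 'S_d) (t : nat) : K :=
  if insub t is Some i then (x i : nat)%:R else 0.

Lemma perm_valuesE (x : 'S_d) (i : 'I_d) : perm_values x i = (x i : nat)%:R.
Proof. by rewrite /perm_values valK. Qed.

(** A common eigenvector of the Jucys-Murphy elements acting by multiplication
    on the left: multiplication by a transposition permutes the arguments of
    the Specht polynomial, which is what [specht_jm] sums. *)
Definition specht_vector (s : seq nat) : A := [ffun x => specht s (perm_values x)].

Lemma perm_values_tperm (k m : 'I_d) x :
  perm_values (tperm k m * x)%g = perm_values x \o nat_swap k m.
Proof.
apply/funext => t; rewrite /= /nat_swap; case: (ltnP t d) => td.
  rewrite (perm_valuesE _ (Ordinal td)) permM.
  case: tpermP => [<-|<-|/eqP tk /eqP tm] /=; rewrite ?eqxx ?perm_valuesE //.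
    by case: eqP => [->|]; rewrite perm_valuesE.
  rewrite -val_eqE /= in tk; rewrite -val_eqE /= in tm.
  by rewrite (negbTE tk) (negbTE tm) -(perm_valuesE x (Ordinal td)).
rewrite !ifF; last 2 first.
- by apply/negbTE; rewrite neq_ltn (leq_trans (ltn_ord m) td) orbT.
- by apply/negbTE; rewrite neq_ltn (leq_trans (ltn_ord k) td) orbT.
by rewrite /perm_values !insubN // -leqNgt.
Qed.

Variable s : seq nat.
Hypothesis (ss : sorted geq s) (sd : sumn s = d).

Lemma jucys_murphy_specht (i : 'I_d) :
  jucys_murphy K i * specht_vector s = gscale (content K s i) (specht_vector s).
Proof.
apply/ffunP => x; rewrite mulr_suml galg_sumE !ffunE.
have [|c [r [cs rh Ei ->]]] := @cell_of K s i; first by rewrite sd.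
rewrite -specht_jm // -Ei.
rewrite (big_ord_widen d (fun k => specht s (perm_values x \o nat_swap k i))); last first.
  exact: ltnW.
apply: eq_bigr => k ki; rewrite gdelta_l ffunE tpermV.
by rewrite perm_values_tperm.
Qed.

Lemma hsym_rcons r (xs : seq K) x :
  hsym r.+1 (rcons xs x) = hsym r.+1 xs + hsym r (rcons xs x) * x.
Proof.
have E : geometric x = 1 + fpsX * (fpsC x * geometric x).
  apply: fpsP => -[|n]; rewrite fcoefD fcoef1 fcoefMX; first by rewrite addr0 /= expr0.
  by rewrite fcoefCM add0r /= exprS.
have Er : hsym_series (rcons xs x) = hsym_series xs * geometric x.
  by rewrite /hsym_series -cats1 big_cat big_seq1.
rewrite /hsym Er {1}E mulrDr mulr1 fcoefD; congr (_ + _).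
by rewrite mulrCA fcoefMX mulrCA fcoefCM mulrC.
Qed.

Lemma jm_hsym_specht_upto m r : (m <= d)%N ->
  jm_hsym K d m r * specht_vector s
  = gscale (hsym r (mkseq (content K s) m)) (specht_vector s).
Proof.
elim: m r => [|m IHm] r md.
  case: r => [|r]; first by rewrite jm_hsym_r0 mul1r hsym0 gscale1.
  rewrite jm_hsym_m0 mul0r /hsym /hsym_series big_nil fcoef1 /= gscale0 //.
elim: r => [|r IHr]; first by rewrite jm_hsym_r0 mul1r hsym0 gscale1.
rewrite (@jm_hsym_rec K d m (Ordinal md)) // mulrDl -mulrA jucys_murphy_specht.
rewrite IHm; last exact: ltnW.
rewrite gscaleMr IHr; apply/ffunP => x; rewrite !ffunE.
by rewrite mkseqS hsym_rcons; ring.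
Qed.

Lemma jm_hsym_specht r : jm_hsym K d d r * specht_vector s
  = gscale (hsym r (contents K s)) (specht_vector s).
Proof.
rewrite jm_hsym_specht_upto //; congr (gscale (hsym r _) _).
by rewrite -[d in LHS]sd -(size_contents K s) mkseq_nth.
Qed.

(** The sum of the conjugates of [v * v^*], where [v] is the Specht vector:
    conjugating makes it central, and multiplying by [v^*] makes its value at
    the identity a sum of squares. *)
Definition specht_central : A :=
  let v := specht_vector s in
  \sum_(x : 'S_d) gdelta K x * (v * [ffun y => v y^-1%g]) * gdelta K x^-1%g.

Lemma specht_central_central : central specht_central.
Proof.
move=> x; rewrite mulr_sumr mulr_suml (reindex_inj (mulgI x^-1%g)) /=.
apply: eq_bigr => y _; rewrite invMg invgK !gdeltaM !mulrA -gdeltaM mulgV.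
by rewrite gdelta1 mul1r.
Qed.

Lemma jm_hsym_specht_central r : jm_hsym K d d r * specht_central
  = gscale (hsym r (contents K s)) specht_central.
Proof.
rewrite mulr_sumr gscale_sum; apply: eq_bigr => x _.
rewrite !mulrA -jm_hsym_central -[gdelta K x * _ * specht_vector s]mulrA.
by rewrite jm_hsym_specht gscaleMr !gscaleMl.
Qed.

Lemma specht_vector_real x : specht_vector s x \is Num.real.
Proof.
rewrite ffunE; apply: rpred_prod => c _; rewrite /column_det /determinant.
apply: rpred_sum => p _; apply: rpredM.
  by rewrite rpredX // rpredN rpred1.
apply: rpred_prod => i _; rewrite mxE rpredX // /perm_values.
by case: insub => [j|]; rewrite ?realn ?rpred0.
Qed.

Lemma specht_vector1 : specht_vector s 1%g != 0.
Proof.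
rewrite ffunE; apply/prodf_neq0 => c _; rewrite /column_det.
pose a := \row_(j < nth 0%N s c) (perm_values 1 (col_start s c + j)%N : K).
have -> : powers_mx (nth 0%N s c) (fun j => perm_values 1 (col_start s c + j)%N)
    = Vandermonde (nth 0%N s c) a.
  by apply/matrixP => i j; rewrite !mxE.
rewrite det_Vandermonde; apply/prodf_neq0 => i _; apply/prodf_neq0 => j ij.
rewrite !mxE; have lt_d (l : 'I_(nth 0%N s c)) : (col_start s c + l < d)%N.
  apply: leq_trans (_ : col_start s c.+1 <= d)%N.
    by rewrite col_startS // ltn_add2l.
  by rewrite -sd -[X in (_ <= sumn X)%N](cat_take_drop c.+1 s) sumn_cat leq_addr.
rewrite (perm_valuesE _ (Ordinal (lt_d i))) (perm_valuesE _ (Ordinal (lt_d j))).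
by rewrite !perm1 /= subr_eq0 eqr_nat eqn_add2l gtn_eqF.
Qed.

(** It is a positive multiple of the sum of the squares of the values of the
    Specht vector, which are real and do not all vanish: at the identity the
    value is a product of Vandermonde determinants in distinct numbers. *)
Lemma specht_central1 : specht_central 1%g != 0.
Proof.
rewrite galg_sumE; set S := \sum_y specht_vector s y ^+ 2.
have -> : \sum_(x : 'S_d) (gdelta K x * (specht_vector s
    * [ffun y => specht_vector s y^-1%g]) * gdelta K x^-1%g) 1%g
    = \sum_(x : 'S_d) S.
  apply: eq_bigr => x _; rewrite gdelta_r mul1g invgK gdelta_l mulVg galgME.
  apply: eq_bigr => y _; rewrite expr2; congr (_ * _).
  by rewrite [LHS]ffunE mulg1 invgK.
rewrite sumr_const -mulr_natl mulf_neq0 //.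
  by rewrite pnatr_eq0 -lt0n; apply/card_gt0P; exists 1%g.
have S_ge0 y : 0 <= specht_vector s y ^+ 2.
  by rewrite real_exprn_even_ge0 // specht_vector_real.
rewrite /S psumr_eq0 //; apply/allPn; exists 1%g; first by rewrite mem_index_enum.
by rewrite expf_eq0 /= specht_vector1.
Qed.

End SpechtVector.

(** * Contents determine the partition *)

Section Separation.
Variable K : numFieldType.

(** By linearity the sums of the values of any polynomial agree; take one that
    vanishes at all points but one. *)
Lemma power_sums_separate L (A B : {set 'I_L}) :
    (forall j, \sum_(a in A) a%:R ^+ j = \sum_(b in B) b%:R ^+ j :> K) -> A = B.
Proof.
move=> AB; have pAB (p : {poly K}) : \sum_(a in A) p.[a%:R] = \sum_(b in B) p.[b%:R].
  under eq_bigr do rewrite horner_coef; under [RHS]eq_bigr do rewrite horner_coef.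
  rewrite exchange_big [RHS]exchange_big; apply: eq_bigr => j _ /=.
  by rewrite -!big_distrr AB.
apply/setP => t; pose p : {poly K} := \prod_(b < L | b != t) ('X - (b%:R)%:P).
have pt : p.[t%:R] != 0.
  rewrite horner_prod; apply/prodf_neq0 => b bt.
  by rewrite hornerXsubC subr_eq0 eqr_nat eq_sym val_eqE.
have p0 (b : 'I_L) : b != t -> p.[b%:R] = 0.
  move=> bt; rewrite horner_prod (bigD1 b) //=.
  by rewrite hornerXsubC subrr mul0r.
have pE (C : {set 'I_L}) : \sum_(a in C) p.[a%:R] = (t \in C)%:R * p.[t%:R].
  have [tC|tC] := boolP (t \in C); rewrite ?mul1r ?mul0r.
    by rewrite (bigD1 t) //= big1 ?addr0 // => b /andP[_ /p0].
  by rewrite big1 // => b bC; apply: p0; apply: contraNneq tC => <-.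
have := pAB p; rewrite !pE => /(mulIf pt) /eqP.
by rewrite eqr_nat; case: (t \in A); case: (t \in B).
Qed.

Lemma hsym_power_sums (xs ys : seq K) : (forall r, hsym r xs = hsym r ys) ->
  forall j, (0 < j)%N -> \sum_(x <- xs) x ^+ j = \sum_(y <- ys) y ^+ j.
Proof.
move=> E; elim/ltn_ind => -[//|j] IHj _.
have := newton j.+1 xs; rewrite E newton !big_ord_recl !hsym0 !mul1r.
rewrite -[LHS]/(_ + _) -[RHS]/(_ + _).
rewrite [X in _ + X = _](eq_bigr (fun i : 'I_j => hsym (lift ord0 i) xs *
    \sum_(x <- xs) x ^+ (j.+1 - lift ord0 i))); first by move/addIr => ->.
by move=> i _; rewrite E IHj // /= ?subn_gt0 ?ltnS //= /bump; have := ltn_ord i; lia.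
Qed.

(** The multiset of contents determines the power sums of the first-column
    hook lengths through [row_series], hence their set, hence the partition. *)
Lemma contents_separate d s t :
    s \in partitions d -> t \in partitions d ->
    (forall r, hsym r (contents K s) = hsym r (contents K t)) -> s = t.
Proof.
rewrite !mem_partitions => /andP[sP /eqP sd] /andP[tP /eqP td] E.
have [ss s0] := andP sP; have [tt t0] := andP tP.
have sz_s : (size s <= d)%N by rewrite -sd leq_size_sumn.
have sz_t : (size t <= d)%N by rewrite -td leq_size_sumn.
have sL : (d + sumn s <= d + d)%N by rewrite sd.
have tL : (d + sumn t <= d + d)%N by rewrite td.
have Ec : content_series K s = content_series K t.
  apply: fpsP => j; rewrite !fcoef_content; congr (_ * _).
  case: j => [|j]; last exact: (hsym_power_sums E).
  rewrite /content_power_sum; under eq_bigr do rewrite expr0.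
  under [RHS]eq_bigr do rewrite expr0.
  by rewrite !big_const_seq !count_predT !size_contents sd td.
rewrite -(beta_setK sP sz_s sL) -(beta_setK tP sz_t tL); congr unbeta.
apply: power_sums_separate => j.
have : set_series K 0 (beta_set (d + d) d s) = set_series K 0 (beta_set (d + d) d t).
  by rewrite -!shift_row_series // /row_series Ec.
move/addrI/(congr1 (fun f => fcoef f j.+1)); rewrite !fcoefMX !fcoef_sum /=.
rewrite -!mulr_suml => /(mulIf _); rewrite invr_eq0 pnatr_eq0 -lt0n fact_gt0 => /(_ isT).
have S0 (C : {set 'I_(d + d)}) :
    \sum_(i in C) (i%:R - 0) ^+ j = \sum_(i in C) i%:R ^+ j :> K.
  by apply: eq_bigr => i _; rewrite subr0.
by move=> E'; apply: etrans (esym (S0 _)) (etrans E' (S0 _)).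
Qed.

End Separation.

(** * Cycle types *)

Section CycleType.
Variable T : finType.
Implicit Types f g : T -> T.

Definition cycle_reps f : seq T :=
  sort (relpre (fingraph.order f) geq) (enum (froots f)).

Definition cycle_type f : seq nat := [seq fingraph.order f a | a <- cycle_reps f].

Lemma mem_cycle_reps f a : (a \in cycle_reps f) = (froot f a == a).
Proof. by rewrite mem_sort mem_enum. Qed.

Lemma cycle_reps_uniq f : uniq (cycle_reps f).
Proof. by rewrite sort_uniq enum_uniq. Qed.

Lemma froot_in_reps f i : injective f -> froot f i \in cycle_reps f.
Proof. by move=> If; rewrite mem_cycle_reps root_root //; apply: fconnect_sym. Qed.

Lemma cycle_type_partition f : injective f -> cycle_type f \in partitions #|T|.
Proof.
move=> If; have sym := fconnect_sym If.
rewrite mem_partitions /is_partition /cycle_type; apply/andP; split.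
  apply/andP; split; last first.
    by apply/mapP => -[a _]; have := fingraph.order_gt0 f a; case: fingraph.order.
  rewrite sorted_map; apply: sort_sorted => a b /=; exact: leq_total.
rewrite sumnE big_map (perm_big _ (permEl (perm_sort _ _))) big_enum /=.
rewrite -[X in _ == X]sum1_card; apply/eqP.
rewrite [RHS](partition_big (froot f) (froots f)) /=; last first.
  by move=> i _; apply: roots_root.
apply: eq_bigr => a /eqP ra; rewrite /fingraph.order -sum1_card.
apply: eq_bigl => i; rewrite !inE.
by rewrite -{2}ra eq_sym root_connect.
Qed.

Lemma cycle_type_conj f g : injective f -> injective g ->
  cycle_type f = cycle_type g ->
  exists2 h, injective h & forall i, h (f i) = g (h i).
Proof.
move=> If Ig fg; have symf := fconnect_sym If; have symg := fconnect_sym Ig.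
have sz : size (cycle_reps f) = size (cycle_reps g).
  by have := congr1 size fg; rewrite !size_map.
(* The cycle of [f] through [i] is matched with the cycle of [g] of the same
   rank [b i], and positions along the cycles are preserved. *)
pose b i := nth i (cycle_reps g) (index (froot f i) (cycle_reps f)).
pose k i := findex f (froot f i) i.
pose h i := iter (k i) g (b i).
have idx i : (index (froot f i) (cycle_reps f) < size (cycle_reps g))%N.
  by rewrite -sz index_mem froot_in_reps.
have conn i : fconnect f (froot f i) i by rewrite symf connect_root.
have bE i j : froot f i = froot f j -> b i = b j.
  by move=> ij; rewrite /b ij; apply: set_nth_default.
have b_rep i : b i \in cycle_reps g by apply: mem_nth.
have b_root i : froot g (b i) = b i by apply/eqP; rewrite -mem_cycle_reps.
have ord_b i : fingraph.order g (b i) = fingraph.order f (froot f i).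
  have Ex : nth 0%N (cycle_type f) (index (froot f i) (cycle_reps f))
      = fingraph.order f (froot f i).
    by rewrite (nth_map i) ?index_mem ?froot_in_reps // nth_index ?froot_in_reps.
  have Ey : nth 0%N (cycle_type g) (index (froot f i) (cycle_reps f))
      = fingraph.order g (b i) by apply: nth_map.
  by rewrite -Ey -fg.
have ki i : (k i < fingraph.order f (froot f i))%N by apply: findex_max.
have h_root i : froot g (h i) = b i.
  rewrite -[RHS](b_root i); apply/esym/eqP.
  by rewrite root_connect ?fconnect_iter.
have h_inj : injective h.
  move=> i j hij; have bij : b i = b j by rewrite -!h_root hij.
  have rij : froot f i = froot f j.
    rewrite -[LHS](nth_index i (froot_in_reps i If)) -[RHS](nth_index i (froot_in_reps j If)).
    congr nth; apply/eqP; rewrite -(nth_uniq i (idx i) (idx j) (cycle_reps_uniq g)).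
    by apply/eqP; rewrite -/(b i) bij; apply: set_nth_default.
  have kij : k i = k j.
    rewrite -[LHS](@findex_iter _ g (b i) (k i)) ?ord_b ?ki // -/(h i) hij bij.
    by rewrite /h findex_iter ?ord_b ?ki.
  rewrite -[LHS](iter_findex (conn i)) -[RHS](iter_findex (conn j)).
  by rewrite -/(k i) -/(k j) kij rij.
exists h => // i.
have root_f : froot f (f i) = froot f i.
  by apply/esym/eqP; rewrite root_connect ?fconnect1.
rewrite /h (bE _ _ root_f) -iterS {1}/k root_f.
have fi : f i = iter (k i).+1 f (froot f i) by rewrite /= iter_findex.
have := ki i; rewrite leq_eqVlt => /orP[/eqP kE|klt].
  by rewrite fi kE iter_order // findex0 -ord_b iter_order.
by rewrite {1}fi findex_iter.
Qed.

End CycleType.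

(** The cycle type is a complete invariant of the conjugacy classes. Together
    with the independence of the eigenvectors [specht_central], this bound
    forces equality. *)
Lemma card_classes_le d : (#|classes [set: 'S_d]| <= size (partitions d))%N.
Proof.
pose f (i : 'I_#|classes [set: 'S_d]|) := cycle_type (class_rep i).
have <- : size [seq f i | i <- enum 'I_#|classes [set: 'S_d]|] = #|classes [set: 'S_d]|.
  by rewrite size_map size_enum_ord.
apply: uniq_leq_size; last first.
  move=> _ /mapP[i _ ->]; rewrite -[X in partitions X](card_ord d).
  exact/cycle_type_partition/perm_inj.
rewrite map_inj_uniq ?enum_uniq // => i j /cycle_type_conj[||h h_inj hE]; try exact: perm_inj.
have E : class_rep j = (class_rep i ^ perm h_inj)%g.
  apply/permP => t; rewrite -[t](permKV (perm h_inj)).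
  by rewrite permJ !permE hE.
by apply: enum_val_inj; rewrite !class_repE E classGidl ?inE.
Qed.

(** * Counting monodromy data *)

Section TraceFormula.
Variables (K : numFieldType) (d r : nat).

Definition torus_count : nat :=
  (\sum_(w <- words d d r) \sum_(p : 'S_d) \sum_(q : 'S_d)
     (p * q * p^-1 * q^-1 * word_perm w == 1)%g)%N.

(** The element [jm_hsym] is the sum of all monotone words, so this count is a
    trace on the centre of the group algebra; its eigenvalues are the values
    of the complete homogeneous symmetric function at the contents. *)
Theorem torus_countE :
  torus_count%:R = d`!%:R * \sum_(s <- partitions d) hsym r (contents K s) :> K.
Proof.
pose z := jm_hsym K d d r; have cz : central z := @jm_hsym_central K d r.
have -> : torus_count%:R = \sum_x \sum_y z (x ^ y * x^-1)%g :> K.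
  rewrite /torus_count natr_sum.
  under eq_bigr => w _.
    rewrite natr_sum; under eq_bigr => p _.
      rewrite natr_sum; over.
    over.
  rewrite exchange_big; apply: eq_bigr => p _ /=.
  rewrite exchange_big (reindex_inj invg_inj) /=; apply: eq_bigr => q _.
  rewrite /z /jm_hsym galg_sumE; apply: eq_bigr => w _; rewrite ffunE.
  congr (nat_of_bool _)%:R; rewrite conjgE -eq_invg_mul; congr (_ == _).
  by rewrite !invMg !invgK !mulgA.
rewrite trace_class_mx //; congr (_%:R * _); first exact: card_Sn.
pose n := size (partitions d); pose part (i : 'I_n) := nth [::] (partitions d) i.
have partP i : part i \in partitions d by apply: mem_nth.
have [sorted_part sum_part] : (forall i, sorted geq (part i)) /\
    (forall i, sumn (part i) = d).
  by split=> i; have := partP i; rewrite mem_partitions => /andP[/andP[? _] /eqP].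
pose u i := specht_central K d (part i).
pose h r' i := hsym r' (contents K (part i)).
have cu i : central (u i) by apply: specht_central_central.
have zu r' i : jm_hsym K d d r' * u i = gscale (h r' i) (u i).
  exact: jm_hsym_specht_central.
rewrite (trace_eigenbasis cu (zu r)) ?card_classes_le //.
  by rewrite (big_nth [::]) big_mkord.
apply: (eigen_row_free cu zu) => [i j ij|i]; last exact: specht_central1.
apply: contrapT => nex; move: ij.
rewrite -val_eqE /= -(nth_uniq [::] (ltn_ord i) (ltn_ord j) (partitions_uniq d)) -/(part i) -/(part j).
rewrite (@contents_separate K _ _ _ (partP i) (partP j)) ?eqxx // => r'.
by apply/eqP/negPn/negP => ne; apply: nex; exists r'.
Qed.

End TraceFormula.

Local Close Scope ring_scope.
Local Open Scope group_scope.

(** * Connected components *)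

Lemma filter_none (T : Type) (a : pred T) s : all (predC a) s -> filter a s = [::].
Proof. by elim: s => //= l s IHs /andP[/negbTE-> /IHs]. Qed.

Section Components.
Variable d : nat.
Notation letter := ('I_d * 'I_d)%type.
Definition config := ('S_d * 'S_d * seq letter)%type.
Implicit Types (S : {set 'I_d}) (x : config) (w : seq letter) (p q u : 'S_d).

Definition torus_rel x : bool :=
  x.1.1 * x.1.2 * x.1.1^-1 * x.1.2^-1 * word_perm x.2 == 1.

Definition letter_in S : pred letter := fun l => (l.1 \in S) && (l.2 \in S).

Definition config_in S x : bool :=
  [&& perm_on S x.1.1, perm_on S x.1.2, all (letter_in S) x.2 & torus_rel x].

Definition configs S (r : nat) : seq config :=
  [seq x <- [seq (pq, w) | pq <- enum {: 'S_d * 'S_d}, w <- words d d r] | config_in S x].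

Lemma mem_configs S r x :
  (x \in configs S r) = [&& config_in S x, size x.2 == r & word_ok d x.2].
Proof.
rewrite mem_filter; congr (_ && _); case: x => pq w; rewrite -mem_words /=.
apply/allpairsP/idP => [[[pq' w'] /= [_ + [_ ->]]] //|wW].
by exists (pq, w); rewrite mem_enum.
Qed.

Lemma configs_uniq S r : uniq (configs S r).
Proof.
apply: filter_uniq; apply: allpairs_uniq; rewrite ?enum_uniq ?words_uniq //.
by move=> [? ?] [? ?].
Qed.

(** These are the unions of orbits of the group generated by the
    configuration. *)
Definition stable x S : bool :=
  [&& x.1.1 \in 'N(S | 'P), x.1.2 \in 'N(S | 'P)
    & all (fun l : letter => (l.1 \in S) == (l.2 \in S)) x.2].

Definition component x S : bool :=
  [&& S != set0, stable x S & [forall S' : {set 'I_d}, (S' \subset S) && stable x S' ==>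
                                 (S' == set0) || (S' == S)]].

Lemma normP p S : reflect (forall a, (p a \in S) = (a \in S)) (p \in 'N(S | 'P)).
Proof. by apply: (iffP idP) => [pN a|H]; [exact: (astabsP pN) | apply/astabsP]. Qed.

Lemma stableC x S : stable x S -> stable x (~: S).
Proof.
case/and3P=> pS qS wS; apply/and3P; split; rewrite ?astabsC //.
by apply: sub_all wS => l /eqP E; rewrite !inE E.
Qed.

Lemma stableI x S1 S2 : stable x S1 -> stable x S2 -> stable x (S1 :&: S2).
Proof.
case/and3P=> /normP p1 /normP q1 w1 /and3P[/normP p2 /normP q2 w2].
apply/and3P; split.
- by apply/normP => a; rewrite !inE p1 p2.
- by apply/normP => a; rewrite !inE q1 q2.
apply/allP => l lw; rewrite !inE.
by have /eqP-> := allP w1 l lw; have /eqP-> := allP w2 l lw.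
Qed.

Lemma stableT x : stable x setT.
Proof.
by apply/and3P; split; [apply/normP => a..|apply/allP => l _]; rewrite !inE.
Qed.

Definition component_of x (i : 'I_d) : {set 'I_d} :=
  \bigcap_(S : {set 'I_d} | stable x S && (i \in S)) S.

Lemma component_of_mem x i : i \in component_of x i.
Proof. by apply/bigcapP => S /andP[]. Qed.

Lemma component_of_stable x i : stable x (component_of x i).
Proof.
rewrite /component_of; elim/big_rec: _ => [|S S' /andP[sS _] sS'].
  exact: stableT.
exact: stableI.
Qed.

Lemma component_of_sub x i S : stable x S -> i \in S -> component_of x i \subset S.
Proof. by move=> sS iS; apply: bigcap_inf; rewrite sS. Qed.

Lemma component_ofP x i : component x (component_of x i).
Proof.
apply/and3P; split; first by apply/set0Pn; exists i; apply: component_of_mem.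
  exact: component_of_stable.
apply/forallP => S'; apply/implyP => /andP[S'sub sS'].
have [iS'|iS'] := boolP (i \in S').
  by apply/orP; right; rewrite eqEsubset S'sub component_of_sub.
have : component_of x i \subset ~: S'.
  by apply: component_of_sub; rewrite ?stableC // inE.
rewrite subsetC => S'C; apply/orP; left; rewrite -subset0.
by apply/subsetP => a aS'; have := subsetP S'C a aS'; rewrite inE (subsetP S'sub).
Qed.

Lemma component_unique x S i : component x S -> i \in S -> S = component_of x i.
Proof.
case/and3P=> _ sS /forallP min iS.
have /implyP := min (component_of x i); rewrite component_of_sub // component_of_stable.
move=> /(_ isT) /orP[/eqP E|/eqP -> //].
by have := component_of_mem x i; rewrite E inE.
Qed.

(** A stable set contains both points of a letter or none, so looking at the
    second point is enough. *)
Definition weight S w : nat := count (fun l : letter => l.2 \in S) w.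

(** Each letter lies in exactly one component, since the components partition
    the points. *)
Lemma sum_weight x : (\sum_(S | component x S) weight S x.2 = size x.2)%N.
Proof.
rewrite -sum1_size; under eq_bigr do rewrite /weight -sum1_count big_mkcond.
rewrite exchange_big; apply: eq_bigr => l _ /=; rewrite -big_mkcondr /=.
rewrite (big_pred1 (component_of x l.2)) // => S; apply/andP/eqP => [[cS lS]|->].
  exact: component_unique.
by rewrite component_ofP component_of_mem.
Qed.

(** * Splitting along a stable set *)

Lemma restr_permM S u v : u \in 'N(S | 'P) -> v \in 'N(S | 'P) ->
  restr_perm S (u * v) = restr_perm S u * restr_perm S v.
Proof. exact: morphM. Qed.

Lemma restr_permV S u : u \in 'N(S | 'P) -> restr_perm S u^-1 = (restr_perm S u)^-1.
Proof. exact: morphV. Qed.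

Lemma restr_perm1 S : restr_perm S 1 = 1.
Proof. exact: morph1. Qed.

Lemma restr_perm_split S u : u \in 'N(S | 'P) ->
  u = restr_perm S u * restr_perm (~: S) u.
Proof.
move=> uS; have uC : u \in 'N(~: S | 'P) by rewrite astabsC.
apply/permP => a; rewrite permM; have [aS|aS] := boolP (a \in S).
  rewrite (restr_permE uS aS) (out_perm (restr_perm_on (~: S) u)) //.
  by rewrite inE negbK (normP _ _ uS).
by rewrite (out_perm (restr_perm_on S u) aS) restr_permE // inE.
Qed.

Lemma perm_on_norm S u : perm_on S u -> u \in 'N(S | 'P).
Proof. by move=> uS; apply/normP => a; apply: perm_closed. Qed.

Lemma perm_onC_norm S u : perm_on (~: S) u -> u \in 'N(S | 'P).
Proof. by move=> uS; rewrite -astabsC perm_on_norm. Qed.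

Lemma restr_perm_id S u : perm_on S u -> restr_perm S u = u.
Proof.
move=> uS; apply/permP => a; have [aS|aS] := boolP (a \in S).
  by rewrite restr_permE // perm_on_norm.
by rewrite (out_perm uS) // (out_perm (restr_perm_on _ _)).
Qed.

Lemma restr_perm_out S u : perm_on (~: S) u -> restr_perm S u = 1.
Proof.
move=> uS; have uN : u \in 'N(S | 'P) by rewrite -astabsC perm_on_norm.
apply/permP => a; rewrite perm1; have [aS|aS] := boolP (a \in S).
  by rewrite restr_permE // (out_perm uS) // inE aS.
by rewrite (out_perm (restr_perm_on _ _)).
Qed.

Lemma tperm_on S (i j : 'I_d) : i \in S -> j \in S -> perm_on S (tperm i j).
Proof.
move=> iS jS; apply/subsetP => a; rewrite inE.
by case: tpermP => [->|->|_ _ /eqP].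
Qed.

Lemma word_perm_norm S w : all (fun l : letter => (l.1 \in S) == (l.2 \in S)) w ->
  word_perm w \in 'N(S | 'P).
Proof.
move=> /allP wS; rewrite /word_perm big_seq; apply: group_prod => l /wS /eqP E.
change (tperm l.1 l.2 \in 'N(S | 'P)).
case: (boolP (l.2 \in S)) => lS; first by rewrite perm_on_norm // tperm_on // E.
by rewrite -astabsC perm_on_norm // tperm_on // inE ?E.
Qed.

Lemma restr_perm_word S w : all (fun l : letter => (l.1 \in S) == (l.2 \in S)) w ->
  restr_perm S (word_perm w) = word_perm [seq l <- w | l.2 \in S].
Proof.
elim: w => [|l w IHw] /=; first by rewrite /word_perm !big_nil restr_perm1.
case/andP=> /eqP E wS; rewrite /word_perm big_cons -/(word_perm w).
have lN : tperm l.1 l.2 \in 'N(S | 'P).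
  by have := @word_perm_norm S [:: l]; rewrite /word_perm big_seq1 /= E eqxx; apply.
rewrite restr_permM ?word_perm_norm // IHw //; case: ifP => lS.
  by rewrite restr_perm_id ?tperm_on ?E // big_cons.
by rewrite restr_perm_out ?mul1g // tperm_on // inE ?E lS.
Qed.

Definition restrict S x : config :=
  ((restr_perm S x.1.1, restr_perm S x.1.2), [seq l <- x.2 | l.2 \in S]).

(** Monotonicity determines how two words on disjoint supports are to be
    merged: by a stable sort. *)
Definition glue (y z : config) : config :=
  ((y.1.1 * z.1.1, y.1.2 * z.1.2), sort (@letter_le d) (y.2 ++ z.2)).

(** Restriction to a stable set is a group morphism on the normaliser of this
    set. *)
Lemma restrict_torus_rel S x : stable x S -> torus_rel x -> torus_rel (restrict S x).
Proof.
case/and3P=> pS qS wS /eqP R; rewrite /torus_rel /= -restr_perm_word //.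
by rewrite -!restr_permV // -!restr_permM ?groupM ?groupV ?word_perm_norm // R restr_perm1.
Qed.

Lemma torus_rel_restrict S x : stable x S ->
  torus_rel (restrict S x) -> torus_rel (restrict (~: S) x) -> torus_rel x.
Proof.
move=> sS; have /and3P[pC qC wC] := stableC sS; case/and3P: sS => pS qS wS.
rewrite /torus_rel /= -!restr_perm_word //.
rewrite -!restr_permV // -!restr_permM ?groupM ?groupV ?word_perm_norm //.
set R := _ * word_perm _ => /eqP R1 /eqP R2.
rewrite [X in X == _](@restr_perm_split S) ?R1 ?R2 ?mulg1 //.
by rewrite !groupM ?groupV ?word_perm_norm.
Qed.

Lemma restrict_in S x : stable x S -> torus_rel x -> config_in S (restrict S x).
Proof.
move=> sS R; apply/and4P; split; rewrite ?restr_perm_on ?restrict_torus_rel //=.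
apply/allP => l; rewrite mem_filter => /andP[lS lw].
by case/and3P: sS => _ _ /allP /(_ _ lw) /eqP E; rewrite /letter_in E lS.
Qed.

Lemma restrict_word_ok S w : word_ok d w -> word_ok d [seq l <- w | l.2 \in S].
Proof.
case/andP=> ws /allP wl; apply/andP; split; last first.
  by apply/allP => l; rewrite mem_filter => /andP[_ /wl].
exact: sorted_filter (@letter_le_trans d) _ _ ws.
Qed.

(** Letters with equal second points belong to the same part, so the order
    leaves no freedom for the interleaving of the two parts. *)
Lemma words_filter_eq S w w' : sorted (@letter_le d) w -> sorted (@letter_le d) w' ->
    [seq l <- w | l.2 \in S] = [seq l <- w' | l.2 \in S] ->
    [seq l <- w | l.2 \notin S] = [seq l <- w' | l.2 \notin S] -> w = w'.
Proof.
elim: w w' => [|l w IHw] [|l' w'] //= sw sw'.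
- by case: (l'.2 \in S).
- by case: (l.2 \in S).
have wl := order_path_min (@letter_le_trans d) sw.
have wl' := order_path_min (@letter_le_trans d) sw'.
have IH := IHw w' (path_sorted sw) (path_sorted sw').
have mixed (a b : letter) (v v' : seq letter) : a.2 \in S -> b.2 \notin S ->
    all (letter_le a) v -> all (letter_le b) v' ->
    a :: [seq l <- v | l.2 \in S] = [seq l <- v' | l.2 \in S] ->
    [seq l <- v | l.2 \notin S] = b :: [seq l <- v' | l.2 \notin S] -> False.
  move=> aS bS /allP va /allP vb E1 E2.
  have av' : a \in v'.
    by have := mem_head a [seq l <- v | l.2 \in S]; rewrite E1 mem_filter => /andP[].
  have bv : b \in v.
    by have := mem_head b [seq l <- v' | l.2 \notin S]; rewrite -E2 mem_filter => /andP[].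
  have := va _ bv; have := vb _ av'; rewrite /letter_le => ba ab.
  by move: bS; rewrite (_ : b.2 = a.2) ?aS //; apply/val_inj/eqP; rewrite eqn_leq ba ab.
have [lS|lS] := boolP (l.2 \in S); have [lS'|lS'] := boolP (l'.2 \in S) => /= E1 E2.
- by case: E1 => -> E1; rewrite IH.
- by case: (mixed l l' w w').
- by case: (mixed l' l w' w).
- by case: E2 => -> E2; rewrite IH.
Qed.

Lemma glue_restrict S x : stable x S -> word_ok d x.2 ->
  glue (restrict S x) (restrict (~: S) x) = x.
Proof.
case: x => [[p q] w] /and3P[/= pS qS wS] /andP[/= ws wl].
rewrite /glue /= -!restr_perm_split //; congr (_, _, _).
apply: (@words_filter_eq S) => //.
- exact/sort_sorted/letter_le_total.
- rewrite (filter_sort (@letter_le_total d) (@letter_le_trans d)) filter_cat.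
  rewrite filter_id [X in _ ++ X]filter_none ?cats0 ?sorted_sort //.
  + exact: letter_le_trans.
  + exact: sorted_filter (@letter_le_trans d) _ _ ws.
  by apply/allP => l; rewrite mem_filter inE => /andP[].
rewrite (filter_sort (@letter_le_total d) (@letter_le_trans d)) filter_cat.
rewrite filter_none; last by apply/allP => l; rewrite mem_filter /= negbK => /andP[].
have -> : [seq l <- w | l.2 \in ~: S] = [seq l <- w | l.2 \notin S].
  by apply: eq_filter => l; rewrite inE.
rewrite filter_id sorted_sort //; first exact: letter_le_trans.
exact: sorted_filter (@letter_le_trans d) _ _ ws.
Qed.

Lemma glue_stable S y z : config_in S y -> config_in (~: S) z -> stable (glue y z) S.
Proof.
case/and4P=> py qy wy _ /and4P[pz qz wz _]; apply/and3P; split => /=.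
- by apply: groupM; [apply: perm_on_norm | apply: perm_onC_norm].
- by apply: groupM; [apply: perm_on_norm | apply: perm_onC_norm].
rewrite all_sort all_cat; apply/andP; split.
  by apply: sub_all wy => l /andP[-> ->].
by apply: sub_all wz => l /andP[]; rewrite !inE => /negbTE-> /negbTE->.
Qed.

Lemma restrict_glue S y z : config_in S y -> config_in (~: S) z ->
    word_ok d y.2 -> word_ok d z.2 ->
  restrict S (glue y z) = y /\ restrict (~: S) (glue y z) = z.
Proof.
case: y z => [[p q] w] [[p' q'] w'] /and4P[/= py qy wy _] /and4P[/= pz qz wz _].
move=> /andP[ws _] /andP[ws' _].
have pzN : p' \in 'N(S | 'P) by rewrite -astabsC perm_on_norm.
have qzN : q' \in 'N(S | 'P) by rewrite -astabsC perm_on_norm.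
have pyN : p \in 'N(~: S | 'P) by rewrite astabsC perm_on_norm.
have qyN : q \in 'N(~: S | 'P) by rewrite astabsC perm_on_norm.
have wyS : [seq l <- w | l.2 \in S] = w.
  by apply/all_filterP; apply: sub_all wy => l /andP[].
have wzS : [seq l <- w' | l.2 \in S] = [::].
  rewrite (eq_in_filter (a2 := pred0)) ?filter_pred0 // => l /(allP wz) /andP[_].
  by rewrite inE => /negbTE.
have wyC : [seq l <- w | l.2 \in ~: S] = [::].
  rewrite (eq_in_filter (a2 := pred0)) ?filter_pred0 // => l /(allP wy) /andP[_ lS].
  by rewrite inE lS.
have wzC : [seq l <- w' | l.2 \in ~: S] = w'.
  by apply/all_filterP; apply: sub_all wz => l /andP[].
have out u : perm_on S u -> restr_perm (~: S) u = 1.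
  by move=> uS; apply: restr_perm_out; rewrite setCK.
split; rewrite /restrict /=; congr (_, _, _).
- by rewrite restr_permM ?(perm_on_norm py) // (restr_perm_id py) (restr_perm_out pz) mulg1.
- by rewrite restr_permM ?(perm_on_norm qy) // (restr_perm_id qy) (restr_perm_out qz) mulg1.
- rewrite (filter_sort (@letter_le_total d) (@letter_le_trans d)) filter_cat.
  by rewrite wyS wzS cats0 sorted_sort //; apply: letter_le_trans.
- by rewrite restr_permM ?(perm_on_norm pz) // (restr_perm_id pz) (out _ py) mul1g.
- by rewrite restr_permM ?(perm_on_norm qz) // (restr_perm_id qz) (out _ qy) mul1g.
rewrite (filter_sort (@letter_le_total d) (@letter_le_trans d)) filter_cat.
by rewrite wyC wzC /= sorted_sort //; apply: letter_le_trans.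
Qed.

Lemma stable_restrict S S' x : stable x S -> S' \subset S ->
  stable (restrict S x) S' = stable x S'.
Proof.
case/and3P=> pS qS wS sub.
have notS' a : a \notin S -> (a \in S') = false.
  by apply: contraNF; apply: (subsetP sub).
have normE u : u \in 'N(S | 'P) ->
    (restr_perm S u \in 'N(S' | 'P)) = (u \in 'N(S' | 'P)).
  move=> uS; apply/normP/normP => H a; have [aS|aS] := boolP (a \in S).
  - by have := H a; rewrite restr_permE.
  - by rewrite !notS' // (normP _ _ uS).
  - by rewrite restr_permE.
  - by rewrite (out_perm (restr_perm_on _ _)).
rewrite /stable /= !normE //; congr [&& _, _ & _].
elim: (x.2) wS => //= l w IHw /andP[/eqP E wS].
case: ifP => lS /=; rewrite IHw //.
by rewrite !notS' ?E ?lS.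
Qed.

Lemma component_restrict S x : stable x S ->
  component (restrict S x) S = component x S.
Proof.
move=> sS; rewrite /component stable_restrict //; congr [&& _, _ & _].
apply: eq_forallb => S'; case: (boolP (S' \subset S)) => //= sub.
by rewrite stable_restrict.
Qed.

Definition connected_configs S r := [seq x <- configs S r | component x S].

Lemma glue_config S r s y z : (s <= r)%N ->
    y \in configs S s -> z \in configs (~: S) (r - s) -> glue y z \in configs setT r.
Proof.
move=> sr; rewrite !mem_configs => /and3P[yS /eqP ys yok] /and3P[zS /eqP zs zok].
have sS := glue_stable yS zS; have [Ey Ez] := restrict_glue yS zS yok zok.
have onT u : perm_on setT u by apply/subsetP => a; rewrite inE.
apply/and3P; split.
- apply/and4P; split=> //; first by apply/allP => l _; rewrite /letter_in !inE.
  apply: (torus_rel_restrict sS); rewrite ?Ey ?Ez.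
    by case/and4P: yS.
  by case/and4P: zS.
- by rewrite size_sort size_cat ys zs subnKC.
case/andP: yok => _ yok; case/andP: zok => _ zok; apply/andP; split.
  exact/sort_sorted/letter_le_total.
by rewrite all_sort all_cat yok.
Qed.

(** Restriction and gluing are inverse bijections between the configurations
    with a given component and the pairs formed of a connected configuration
    on that component and of a configuration on its complement. *)
Lemma component_count S r s : (s <= r)%N ->
  size [seq x <- configs setT r | component x S & weight S x.2 == s]
  = (size (connected_configs S s) * size (configs (~: S) (r - s)))%N.
Proof.
move=> sr; rewrite -(size_allpairs pair) -!sum1_size.
apply: esym; apply: (@big_seq_bij nat 0%N addn config (config * config)%type _ _
  (fun x => (restrict S x, restrict (~: S) x)) (fun yz => glue yz.1 yz.2) (fun=> 1%N)).
- exact/filter_uniq/configs_uniq.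
- apply: allpairs_uniq => [||[? ?] [? ?] //]; last exact: configs_uniq.
  exact/filter_uniq/configs_uniq.
- move=> x; rewrite (mem_filter _ _ (configs _ _)) mem_configs.
  case/andP => /andP[cS /eqP wx] /and3P[/and4P[_ _ _ R] /eqP sx wok].
  have sS : stable x S by case/and3P: cS.
  split; last exact: glue_restrict.
  apply/allpairsP; exists (restrict S x, restrict (~: S) x); split=> //=.
    rewrite (mem_filter _ _ (configs _ _)) mem_configs component_restrict // cS.
    by rewrite restrict_in // restrict_word_ok // size_filter -wx eqxx.
  rewrite mem_configs restrict_in ?stableC // restrict_word_ok // andbT /=.
  rewrite size_filter -sx -wx -(count_predC (fun l : letter => l.2 \in S)).
  by rewrite addKn; apply/eqP/eq_count => l; rewrite inE.
move=> _ /allpairsP[[y z] [/= + zC ->]] /=.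
rewrite (mem_filter _ _ (configs _ _)) => /andP[cy yC].
have := glue_config sr yC zC; move: yC zC; rewrite !mem_configs.
move=> /and3P[yS /eqP ys yok] /and3P[zS /eqP zs zok] gC.
have sS := glue_stable yS zS; have [Ey Ez] := restrict_glue yS zS yok zok.
split; last by rewrite Ey Ez.
rewrite (mem_filter _ _ (configs _ _)) mem_configs gC -(component_restrict sS) Ey cy /=.
rewrite /weight -size_filter -/(restrict S (glue y z)).2.
by rewrite -[[seq l <- _ | _]]/((restrict S (glue y z)).2) Ey ys eqxx.
Qed.

(** Marking one of the [r] transpositions singles out the component that
    contains it. *)
Theorem configs_rec r : (r * size (configs setT r) =
  \sum_(S : {set 'I_d}) \sum_(s < r.+1)
     s * size (connected_configs S s) * size (configs (~: S) (r - s)))%N.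
Proof.
have -> : (r * size (configs setT r) = \sum_(x <- configs setT r) size x.2)%N.
  rewrite big_seq (eq_bigr (fun=> r)) => [|x].
    by rewrite -big_seq big_const_seq count_predT iter_addn_0.
  by rewrite mem_configs => /and3P[_ /eqP].
under eq_bigr do rewrite -sum_weight big_mkcond.
rewrite exchange_big; apply: eq_bigr => S _ /=; rewrite -big_mkcond /=.
transitivity (\sum_(s < r.+1)
    \sum_(x <- configs setT r | component x S && (weight S x.2 == s)) s)%N.
  under [RHS]eq_bigr do rewrite big_mkcond.
  rewrite exchange_big [LHS]big_mkcond big_seq [RHS]big_seq.
  apply: eq_bigr => x; rewrite mem_configs => /and3P[_ /eqP sx _] /=.
  case: ifP => cx /=; last by rewrite big1.
  have wlt : (weight S x.2 < r.+1)%N by rewrite ltnS -sx; apply: count_size.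
  rewrite (bigD1 (Ordinal wlt)) //= eqxx big1 ?addn0 // => i.
  by rewrite -val_eqE /= eq_sym => /negbTE ->.
apply: eq_bigr => -[s /= +] _; rewrite ltnS => sr.
rewrite -mulnA -(component_count S sr) -big_filter big_const_seq count_predT.
by rewrite iter_addn_0.
Qed.

End Components.

(** * Relabelling the points *)

Section Relabel.
Variables (k d : nat) (e : 'I_k -> 'I_d).
Hypothesis e_mono : forall i j, (e i < e j)%N = (i < j)%N.
Implicit Types (q : 'S_k) (x : config k).

Let e_inj : injective e.
Proof.
move=> i j ij; apply/val_inj; have := e_mono i j; have := e_mono j i.
by rewrite ij ltnn; case: ltngtP.
Qed.

Let e_le i j : (e i <= e j)%N = (i <= j)%N.
Proof. by rewrite leqNgt e_mono -leqNgt. Qed.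

Let S : {set 'I_d} := e @: setT.

Let e_in i : e i \in S.
Proof. exact: imset_f. Qed.

Definition extend_fun q (t : 'I_d) : 'I_d :=
  if [pick i | e i == t] is Some i then e (q i) else t.

Lemma extend_funE q i : extend_fun q (e i) = e (q i).
Proof.
rewrite /extend_fun; case: pickP => [j /eqP /e_inj -> //|/(_ i)].
by rewrite eqxx.
Qed.

Lemma extend_fun_out q t : t \notin S -> extend_fun q t = t.
Proof.
by move=> tS; rewrite /extend_fun; case: pickP => // j /eqP jt; rewrite -jt e_in in tS.
Qed.

Lemma extend_fun_inj q : injective (extend_fun q).
Proof.
apply: (can_inj (g := extend_fun q^-1)) => t.
have [/imsetP[i _ ->]|tS] := boolP (t \in S).
  by rewrite !extend_funE permK.
by rewrite !extend_fun_out.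
Qed.

Definition extend q : 'S_d := perm (@extend_fun_inj q).

Lemma extendE q i : extend q (e i) = e (q i).
Proof. by rewrite permE extend_funE. Qed.

Lemma extend_out q t : t \notin S -> extend q t = t.
Proof. by rewrite permE; apply: extend_fun_out. Qed.

Lemma extend_eq q (u : 'S_d) : (forall i, u (e i) = e (q i)) ->
  (forall t, t \notin S -> u t = t) -> extend q = u.
Proof.
move=> uE uout; apply/permP => t; have [/imsetP[i _ ->]|tS] := boolP (t \in S).
  by rewrite extendE uE.
by rewrite extend_out // uout.
Qed.

Lemma extendM q q' : extend (q * q') = extend q * extend q'.
Proof.
apply: extend_eq => [i|t tS]; first by rewrite !permM !extendE.
by rewrite permM !extend_out.
Qed.

Lemma extend1 : extend 1 = 1.
Proof. by apply: extend_eq => [i|t _]; rewrite !perm1. Qed.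

Lemma extendV q : extend q^-1 = (extend q)^-1.
Proof. by apply/eqP; rewrite eq_sym eq_invg_mul -extendM mulgV extend1. Qed.

Lemma extend_tperm i j : extend (tperm i j) = tperm (e i) (e j).
Proof.
apply: extend_eq => [l|t tS].
  by rewrite -inj_tperm.
by apply: tpermD; apply: contraNneq tS => <-.
Qed.

Lemma extend_inj : injective extend.
Proof.
by move=> q q' E; apply/permP => i; apply: e_inj; rewrite -!extendE E.
Qed.

Lemma extend_on q : perm_on S (extend q).
Proof.
by apply/subsetP => t; rewrite inE; apply: contraR => /(extend_out q) ->.
Qed.

Lemma extend_surj (u : 'S_d) : perm_on S u -> exists q, extend q = u.
Proof.
move=> uS; have H i : exists j, u (e i) == e j.
  have : u (e i) \in S by rewrite perm_closed.
  by case/imsetP => j _ ->; exists j.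
have [f fE] := fin_all_exists H.
have f_inj : injective f.
  by move=> i j ij; apply/e_inj/(@perm_inj _ u); rewrite (eqP (fE i)) ij (eqP (fE j)).
exists (perm f_inj); apply: extend_eq => [i|t]; first by rewrite (eqP (fE i)) permE.
exact: out_perm.
Qed.

Definition relabel_letter (l : 'I_k * 'I_k) : 'I_d * 'I_d := (e l.1, e l.2).

Lemma relabel_letter_inj : injective relabel_letter.
Proof. by move=> [? ?] [? ?] [/e_inj -> /e_inj ->]. Qed.

Definition relabel x : config d :=
  ((extend x.1.1, extend x.1.2), map relabel_letter x.2).

Lemma relabel_inj : injective relabel.
Proof.
move=> [[p q] w] [[p' q'] w'] [/extend_inj -> /extend_inj ->].
by move/(inj_map relabel_letter_inj) ->.
Qed.

Lemma extend_word w : extend (word_perm w) = word_perm (map relabel_letter w).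
Proof.
elim: w => [|l w IHw]; first by rewrite /word_perm !big_nil extend1.
by rewrite /word_perm /= !big_cons extendM extend_tperm; congr (_ * _).
Qed.

Lemma relabel_torus_rel x : torus_rel (relabel x) = torus_rel x.
Proof.
rewrite /torus_rel /= -extend_word -!extendV -!extendM -extend1.
by rewrite (inj_eq extend_inj).
Qed.

Lemma relabel_word_ok w : word_ok d (map relabel_letter w) = word_ok k w.
Proof.
rewrite /word_ok sorted_map all_map; congr (_ && _).
  by apply: eq_sorted => l l'; rewrite /= /letter_le /= e_le.
by apply: eq_all => l; rewrite /= e_mono !ltn_ord.
Qed.

(** An increasing relabelling preserves monotone words, so that only the
    cardinal of the support matters. *)
Lemma relabel_configs r : perm_eq (map relabel (configs setT r)) (configs S r).
Proof.
apply: uniq_perm.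
- by rewrite map_inj_uniq ?configs_uniq //; apply: relabel_inj.
- exact: configs_uniq.
move=> y; apply/mapP/idP => [[x + ->]|].
  rewrite !mem_configs => /and3P[/and4P[_ _ _ R] sx wx].
  rewrite size_map sx relabel_word_ok wx /config_in !extend_on relabel_torus_rel R.
  by rewrite !andbT; apply/allP => _ /mapP[l _ ->]; rewrite /letter_in !e_in.
rewrite mem_configs => /and3P[/and4P[pS qS /allP wS R] sy wy].
have [p Ep] := extend_surj pS; have [q Eq] := extend_surj qS.
have [w Ew] : exists w, map relabel_letter w = y.2.
  elim: (y.2) wS => [|[a b] v IHv] wS; first by exists [::].
  have [w <-] := IHv (fun l lv => wS l (mem_behead (s := _ :: _) lv)).
  have := wS (a, b) (mem_head _ _); rewrite /letter_in => /andP[/imsetP[i _ ai] /imsetP[j _ bj]].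
  by exists ((i, j) :: w); rewrite /= /relabel_letter /= -ai -bj.
have Ey : y = relabel (p, q, w) by rewrite /relabel /= Ep Eq Ew; case: (y) => [[]].
exists (p, q, w) => //; rewrite Ey in R sy wy.
rewrite relabel_torus_rel in R; rewrite /= size_map in sy; rewrite /= relabel_word_ok in wy.
have onT u : perm_on setT u by apply/subsetP => a; rewrite inE.
rewrite mem_configs /config_in !onT R sy wy !andbT /=.
by apply/allP => l _; rewrite /letter_in !inE.
Qed.

Lemma stable_relabel x (U : {set 'I_k}) : stable (relabel x) (e @: U) = stable x U.
Proof.
have memE i : (e i \in e @: U) = (i \in U) by apply: mem_imset.
have normE q : (extend q \in 'N(e @: U | 'P)) = (q \in 'N(U | 'P)).
  apply/normP/normP => H i; first by rewrite -!memE -extendE H.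
  have [/imsetP[j _ ->]|iS] := boolP (i \in S); first by rewrite extendE !memE H.
  by rewrite extend_out.
rewrite /stable /= !normE all_map; congr [&& _, _ & _].
by apply: eq_all => l; rewrite /= !memE.
Qed.

Lemma component_relabel x : component (relabel x) S = component x setT.
Proof.
have img0 (U : {set 'I_k}) : (e @: U == set0) = (U == set0).
  by rewrite -!cards_eq0 card_imset.
have imgT (U : {set 'I_k}) : (e @: U == S) = (U == setT).
  by rewrite /S (inj_eq (imset_inj e_inj)).
rewrite /component img0 stable_relabel; congr [&& _, _ & _].
apply/forallP/forallP => H U.
  by have := H (e @: U); rewrite imsetS ?subsetT // stable_relabel img0 imgT.
apply/implyP => /andP[US sU].
have EU : U = e @: (e @^-1: U).
  apply/setP => t; apply/idP/imsetP => [tU|[i iU ->]]; last by rewrite inE in iU.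
  by have /imsetP[i _ ti] := subsetP US t tU; exists i; rewrite // inE -ti.
have := H (e @^-1: U); rewrite subsetT -stable_relabel -EU sU /=.
by rewrite -img0 -imgT -EU.
Qed.

Lemma size_configs_relabel r : size (configs S r) = size (configs (d := k) setT r).
Proof. by rewrite -(perm_size (relabel_configs r)) size_map. Qed.

Lemma size_connected_relabel r :
  size (connected_configs S r) = size (connected_configs (d := k) setT r).
Proof.
rewrite /connected_configs -!sum1_size !big_filter.
rewrite -(perm_big _ (relabel_configs r)) big_map.
by apply: eq_bigl => x; apply: component_relabel.
Qed.

End Relabel.

Section RelabelSet.
Variables (d : nat) (S : {set 'I_d}).

Lemma enum_val_mono (i j : 'I_#|S|) : (enum_val i < enum_val j)%N = (i < j)%N.
Proof.
have homo (a b : 'I_#|S|) : (a < b)%N -> (enum_val a < enum_val b)%N.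
  move=> ab; have := decr_seq_sorted S; rewrite /decr_seq rev_sorted => st.
  have E (c : 'I_#|S|) : nat_of_ord (enum_val c) = nth 0%N (map val (enum S)) c.
    by rewrite (nth_map (enum_val c)) -?cardE // -enum_val_nth.
  rewrite !E; apply: (sorted_ltn_nth ltn_trans 0%N st) => //;
  by rewrite inE size_map -cardE.
apply/idP/idP => [|/homo //]; apply: contraTT; rewrite -!leqNgt leq_eqVlt.
by case/orP=> [/eqP/val_inj -> //|/homo /ltnW].
Qed.

Lemma enum_val_image : (@enum_val _ (mem S)) @: setT = S.
Proof.
apply/setP => a; apply/imsetP/idP => [[i _ ->]|aS]; first exact: enum_valP.
by exists (enum_rank_in aS a); rewrite ?enum_rankK_in.
Qed.

Lemma size_configs_set r : size (configs S r) = size (configs (d := #|S|) setT r).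
Proof. by rewrite -(size_configs_relabel enum_val_mono) enum_val_image. Qed.

Lemma size_connected_set r :
  size (connected_configs S r) = size (connected_configs (d := #|S|) setT r).
Proof. by rewrite -(size_connected_relabel enum_val_mono) enum_val_image. Qed.

End RelabelSet.

(** * Connected and disconnected numbers *)

Definition disconnected_number (d r : nat) : nat := size (configs (d := d) setT r).
Definition connected_number (d r : nat) : nat := size (connected_configs (d := d) setT r).

(** There are ['C(d, k)] possible components of cardinal [k]. *)
Lemma disconnected_number_rec d r : (r * disconnected_number d r =
  \sum_(k < d.+1) \sum_(s < r.+1) 'C(d, k) *
    (s * connected_number k s * disconnected_number (d - k) (r - s)))%N.
Proof.
rewrite /disconnected_number configs_rec.
rewrite (partition_big (fun S : {set 'I_d} => inord #|S| : 'I_d.+1) xpredT) //=.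
apply: eq_bigr => k _; rewrite -big_distrr /=.
transitivity (\sum_(S : {set 'I_d} | #|S| == k) \sum_(s < r.+1)
   (s * connected_number k s * disconnected_number (d - k) (r - s)))%N.
  apply: eq_big => [S|S /eqP Sk].
    by rewrite -val_eqE /= inordK // ltnS -[X in (_ <= X)%N]card_ord max_card.
  have {Sk}Sk : #|S| = k.
    by rewrite -Sk inordK // ltnS -[X in (_ <= X)%N]card_ord max_card.
  apply: eq_bigr => s _; rewrite size_configs_set size_connected_set.
  rewrite -/(connected_number _ _) -/(disconnected_number _ _).
  by rewrite [#|~: S|]cardsCs setCK card_ord Sk.
rewrite sum_nat_const; congr (_ * _)%N.
transitivity #|[set S : {set 'I_d} | #|S| == k]|; last by rewrite card_draws card_ord.
by apply: eq_card => S; rewrite inE.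
Qed.

Lemma torus_count_disconnected d r : torus_count d r = disconnected_number d r.
Proof.
rewrite /disconnected_number /configs -sum1_size big_filter big_mkcond.
rewrite big_allpairs_dep exchange_big; apply: eq_bigr => w _ /=.
rewrite big_enum pair_bigA /=; apply: eq_bigr => -[p q] _ /=.
have onT (u : 'S_d) : perm_on setT u by apply/subsetP => a; rewrite inE.
rewrite /config_in !onT /= (_ : all _ w) /torus_rel /=; last first.
  by apply/allP => l _; rewrite /letter_in !inE.
by case: eqP.
Qed.

Section Tuples.
Variable d : nat.
Notation letter := ('I_d * 'I_d)%type.
Implicit Types (p q : 'S_d) (w : seq letter) (S : {set 'I_d}).

Definition transpositions w : seq 'S_d := [seq tperm l.1 l.2 | l : letter <- w].

(** Stability under a group is tested on its generators. *)
Lemma stable_gen p q w r (t : r.-tuple 'S_d) S : t = transpositions w :> seq _ ->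
  stable (p, q, w) S = (<< [set p; q] :|: [set s in t] >> \subset 'N(S | 'P)).
Proof.
move=> tw; have mt s : (s \in t) = (s \in transpositions w) by rewrite -tw.
rewrite gen_subG subUset subUset !sub1set -andbA.
rewrite /stable /=; congr [&& _, _ & _].
apply/allP/subsetP => [H s|H l lw].
  rewrite inE mt => /mapP[l lw ->]; have := @word_perm_norm d S [:: l].
  by rewrite /word_perm big_seq1 /= H // => ->.
have /H : tperm l.1 l.2 \in [set s in t] by rewrite inE mt; apply: map_f.
by move/normP/(_ l.1); rewrite tpermL => ->.
Qed.

(** A transitive group has no stable set other than the empty set and the
    whole set; conversely the orbit of a point is a stable set. *)
Lemma generate_transitiveE p q w r (t : r.-tuple 'S_d) : t = transpositions w :> seq _ ->
  generate_transitive p q t = component (p, q, w) setT.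
Proof.
move=> tw; rewrite /generate_transitive /component stableT /=.
set G := << _ >>; have stE S := stable_gen p q S tw; rewrite -/G in stE.
apply/idP/andP => [trG|[/set0Pn[a _] /forallP min]].
  split; first by case/imsetP: trG => a _ ->; apply/set0Pn; exists a; apply: orbit_refl.
  apply/forallP => S; apply/implyP => /andP[_]; rewrite stE => GS.
  have [->|[a aS]] := set_0Vmem S; first by rewrite eqxx.
  apply/orP; right; rewrite eqEsubset subsetT /= -(atransP trG a) ?inE //.
  by rewrite acts_sub_orbit.
apply/imsetP; exists a; rewrite ?inE //; apply/esym/eqP.
have := min (orbit 'P G a); rewrite subsetT stE acts_orbit ?subsetT //=.
case/orP=> // /eqP E; have := orbit_refl 'P G a; by rewrite E inE.
Qed.

Lemma torus_relationE p q w r (t : r.-tuple 'S_d) : t = transpositions w :> seq _ ->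
  torus_relation p q t = torus_rel (p, q, w).
Proof.
move=> tw; rewrite /torus_relation /torus_rel /word_perm /=.
by rewrite -(big_tuple _ _ t xpredT id) /= tw big_map.
Qed.

Lemma monotone_transpositionsP r (t : r.-tuple 'S_d) :
  reflect (exists2 w, word_ok d w & t = transpositions w :> seq _)
          (monotone_transpositions t).
Proof.
apply: (iffP existsP) => [[k /existsP[l /andP[/forallP kl /forallP lmono]]]|[w wok tw]].
  exists [seq (k i, l i) | i <- enum 'I_r].
    apply/andP; split; last first.
      by apply/allP => _ /mapP[i _ ->] /=; have /andP[->] := kl i; rewrite ltn_ord.
    rewrite sorted_map; have : sorted ltn (map val (enum 'I_r)).
      by rewrite val_enum_ord iota_ltn_sorted.
    rewrite sorted_map; apply: sub_sorted; move=> i j ij.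
    by have /forallP/(_ j)/implyP := lmono i; apply; apply: ltnW.
  rewrite /transpositions -map_comp -[LHS]map_tnth_enum /=.
  by apply: eq_map => i /=; have /andP[_ /eqP] := kl i.
have sw : size w == r by rewrite -(size_tuple t) tw size_map.
have {}tw i : tnth t i = tperm (tnth (Tuple sw) i).1 (tnth (Tuple sw) i).2.
  rewrite (tnth_nth 1) tw (nth_map (tnth (Tuple sw) i)) ?(eqP sw) //.
  by rewrite (_ : nth _ w i = tnth (Tuple sw) i) // [RHS](tnth_nth (tnth (Tuple sw) i)).
case/andP: wok => ws /allP wl.
pose l i := (tnth (Tuple sw) i).2; pose k i := (tnth (Tuple sw) i).1.
exists [ffun i => k i]; apply/existsP; exists [ffun i => l i]; apply/andP; split.
  apply/forallP => i; rewrite !ffunE tw eqxx andbT.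
  by have /andP[] := wl _ (mem_tnth i (Tuple sw)).
apply/forallP => i; apply/forallP => j; apply/implyP => ij; rewrite !ffunE.
have := sorted_leq_nth (@letter_le_trans d) (fun l : letter => leqnn l.2) (k i, l i) ws.
move/(_ i j); rewrite !inE !(eqP sw) !ltn_ord => /(_ isT isT ij).
have E (i0 : 'I_r) : nth (k i, l i) w i0 = tnth (Tuple sw) i0 by rewrite (tnth_nth (k i, l i)).
by rewrite !E.
Qed.

(** The order [k < l] within a letter makes it determined by the
    transposition. *)
Lemma transpositions_inj w w' : word_ok d w -> word_ok d w' ->
  transpositions w = transpositions w' -> w = w'.
Proof.
case/andP=> _ + /andP[_]; elim: w w' => [|l w IHw] [|l' w'] //=.
move=> /andP[/andP[kl _] wl] /andP[/andP[kl' _] wl'] [E /(IHw _ wl wl') ->].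
congr (_ :: _); case: l l' kl kl' E => [k l] [k' l'] /= kl kl' E.
have := congr1 (fun s : 'S_d => s l) E; rewrite /= tpermR.
case: tpermP => [lk|-> -> //|_ _ kE]; last by rewrite kE ltnn in kl.
by move=> kE; rewrite kE lk ltnNge ltnW in kl.
Qed.

Theorem card_torus_tuples r :
  #|[set x : 'S_d * 'S_d * r.-tuple 'S_d |
      [&& torus_relation x.1.1 x.1.2 x.2,
          generate_transitive x.1.1 x.1.2 x.2
        & monotone_transpositions x.2]]| = connected_number d r.
Proof.
rewrite cardE -(size_map (fun x => (x.1, val x.2))) /connected_number.
rewrite -[RHS](size_map (fun x => (x.1, transpositions x.2))).
apply/perm_size/uniq_perm.
- rewrite map_inj_uniq ?enum_uniq // => -[pq t] [pq' t'] /= [-> tt].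
  by congr (_, _); apply: val_inj.
- rewrite map_inj_in_uniq; first exact/filter_uniq/configs_uniq.
  move=> [pq w] [pq' w']; rewrite !(mem_filter _ _ (configs _ _)) !mem_configs.
  move=> /and4P[_ _ _ wok] /and4P[_ _ _ wok'] [-> ww].
  by congr (_, _); apply: transpositions_inj ww.
have onT (u : 'S_d) : perm_on setT u by apply/subsetP => a; rewrite inE.
move=> [[p q] s]; apply/mapP/mapP => [[[[p' q'] t]]|[[[p' q'] w]]].
  rewrite mem_enum inE /= => /and3P[R T /monotone_transpositionsP[w wok tw]] [-> -> ->].
  exists (p', q', w); last by rewrite tw.
  rewrite (mem_filter _ _ (configs _ _)) mem_configs /config_in !onT /=.
  rewrite -(generate_transitiveE _ _ tw) T -(torus_relationE _ _ tw) R wok.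
  rewrite -(size_tuple t) tw size_map eqxx !andbT /=.
  by apply/allP => l _; rewrite /letter_in !inE.
rewrite (mem_filter _ _ (configs _ _)) mem_configs.
move=> /and4P[T /and4P[_ _ _ R] sw wok] [-> -> ->].
have st : size (transpositions w) == r by rewrite size_map.
have tw : Tuple st = transpositions w :> seq _ by [].
exists (p', q', Tuple st) => //; rewrite mem_enum inE /=.
rewrite (generate_transitiveE _ _ tw) T (torus_relationE _ _ tw) R /=.
by apply/monotone_transpositionsP; exists w.
Qed.

End Tuples.

Lemma hurwitzE g d : hurwitz g d = connected_number d (2 * g - 2).
Proof. exact: card_torus_tuples. Qed.

Lemma connected_number0 r : connected_number 0 r = 0%N.
Proof.
rewrite /connected_number /connected_configs (eq_filter (a2 := pred0)) ?filter_pred0 //.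
move=> x; apply/negbTE; rewrite negb_and; apply/orP; left; rewrite negbK.
by apply/eqP/setP => -[].
Qed.

Local Close Scope group_scope.
Local Open Scope ring_scope.

(** * Quasimodularity of the generating series *)

Section HurwitzQuasimodular.
Variable K : numFieldType.
Notation P := (partition_series K).

Definition disconnected_series r : fps K :=
  Fps (fun d => (disconnected_number d r)%:R / d`!%:R).
Definition connected_series r : fps K :=
  Fps (fun d => (connected_number d r)%:R / d`!%:R).

Lemma natr_fact_neq0 n : n`!%:R != 0 :> K.
Proof. by rewrite pnatr_eq0 -lt0n fact_gt0. Qed.

Lemma disconnected_seriesE r :
  disconnected_series r = average (fun s => hsym r (contents K s)).
Proof.
apply: fpsP => d; rewrite /= -torus_count_disconnected torus_countE.
by rewrite mulrC mulKf // natr_fact_neq0.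
Qed.

Lemma disconnected_series_ratio r : quasimodular_ratio (disconnected_series r).
Proof. by rewrite disconnected_seriesE; apply: hsym_contents_quasimodular. Qed.

Lemma disconnected_series0 : disconnected_series 0 = P.
Proof.
rewrite disconnected_seriesE; apply: fpsP => d; apply: eq_bigr => s _.
by rewrite hsym0 big_nil.
Qed.

(** Dividing by factorials turns the binomial coefficients of
    [disconnected_number_rec] into a product of series. *)
Lemma disconnected_series_rec r : r%:R * disconnected_series r
  = \sum_(s < r.+1) s%:R * connected_series s * disconnected_series (r - s).
Proof.
apply: fpsP => d; rewrite fcoefnM fcoef_sum.
under [RHS]eq_bigr => s _.
  rewrite fcoefM; under eq_bigr do rewrite fcoefnM.
  over.
rewrite exchange_big [fcoef _ _]/= mulrA -natrM disconnected_number_rec.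
rewrite natr_sum big_distrl; apply: eq_bigr => -[k /= +] _; rewrite ltnS => kd.
rewrite natr_sum big_distrl; apply: eq_bigr => s _ /=.
rewrite -(bin_fact kd) !natrM.
have := natr_fact_neq0 k; have := natr_fact_neq0 (d - k).
have : ('C(d, k))%:R != 0 :> K by rewrite pnatr_eq0 -lt0n bin_gt0.
move: (_%:R) (_%:R) (_%:R) (_%:R) (_%:R) (_%:R) => a b c x y z.
by move=> *; field; apply/and3P; split.
Qed.

(** All the [disconnected_series r] are quasimodular multiples of
    [disconnected_series 0], which is the series of partitions. Dividing the
    recursion by this unit expresses [connected_series r] through quasimodular
    forms and the [connected_series s] with [s < r]. *)
Theorem connected_series_quasimodular r : (0 < r)%N -> quasimodular (connected_series r).
Proof.
elim/ltn_ind: r => r IHr r0.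
have [g qg Dg] := disconnected_series_ratio r.
have [h qh Sh] : quasimodular_ratio
    (\sum_(s < r) s%:R * connected_series s * disconnected_series (r - s)).
  apply: ratio_sum => -[s sr] _ /=; case: s sr => [|s] sr.
    by rewrite !mul0r; apply: ratio0.
  apply: ratioM; last exact: disconnected_series_ratio.
  by apply: quasimodularM; [exact: quasimodular_nat | exact: IHr].
apply: (quasimodular_div r0).
have := disconnected_series_rec r.
rewrite big_ord_recr [nat_of_ord ord_max]/= subnn disconnected_series0 Sh Dg.
move=> E; have -> : r%:R * connected_series r = r%:R * g - h.
  apply: (mulrI (partition_series_unit K)).
  by rewrite mulrBr [P * (r%:R * g)]mulrCA E mulrC addrAC subrr add0r.
by apply: quasimodularB => //; apply: quasimodularM => //; apply: quasimodular_nat.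
Qed.

Lemma hurwitz_seriesE g : hurwitz_series K g = connected_series (2 * g - 2).
Proof.
apply: fpsP => d.
transitivity (\sum_(1 <= m < d.+1)
  fcoef (fpsC ((hurwitz g m)%:R / m`!%:R) * fpsX ^+ m : fps K) d); first by [].
case: d => [|d]; first by rewrite big_geq //= connected_number0 mul0r.
rewrite (bigD1_seq d.+1) ?iota_uniq ?mem_index_iota ?ltnSn //.
rewrite -[LHS]/(_ + _) fcoefCM fcoefXn eqxx mulr1 hurwitzE big1 ?addr0 // => m md.
by rewrite fcoefCM fcoefXn eq_sym (negbTE md) mulr0.
Qed.

Lemma quasimodular_mmap (f : fps K) : quasimodular f ->
  exists P : {mpoly K[3]}, f = mmap (@fpsC K) (tnth [tuple E2; E4; E6]) P.
Proof.
have X i : tnth [tuple E2; E4; E6] i = mmap (@fpsC K) (tnth [tuple E2; E4; E6]) 'X_i.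
  by rewrite mmapX mmap1U.
elim=> {f} [c|||| f1 f2 _ [P1 ->] _ [P2 ->]|f1 f2 _ [P1 ->] _ [P2 ->]].
- by exists c%:MP; rewrite mmapC.
- by exists 'X_0; rewrite -X.
- by exists 'X_1; rewrite -X.
- by exists 'X_(inord 2); rewrite -X (tnth_nth 0) inordK.
- by exists (P1 + P2); rewrite mmapD.
by exists (P1 * P2); rewrite rmorphM.
Qed.

End HurwitzQuasimodular.

Theorem theorem1p4 (R : realType) (g : nat) (hg : (2 <= g)%N) :
  exists P : {mpoly R[i][3]},
    hurwitz_series R[i] g
    = mmap (@fpsC R[i]) (tnth [tuple E2; E4; E6]) P.
Proof.
have q := @connected_series_quasimodular R[i] (2 * g - 2).
apply: quasimodular_mmap; rewrite hurwitz_seriesE; apply: q; lia.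
Qed.
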